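(* Let $r,s\in[1,2]$ and $p,q\in[1,+\infty)$ with $s\le q$. Then $E(L_r,p)\le_B E(L_s,q)$ if and only if $p\le q$ and $\frac{r}{p}\ge\frac{s}{q}$.
   Context: $L_r=L_r[0,1]$. For a separable Banach space $X$ and $p\in[1,\infty)$, $E(X,p)$ is the equivalence relation on the Polish space $X^{\mathbb N}$ given by $(x,y)\in E(X,p)\iff\sum_{n}\|x(n)-y(n)\|_X^p<+\infty$. $E\le_B F$ means there is a Borel map $\theta$ between the underlying Polish spaces with $(x,y)\in E\iff(\theta(x),\theta(y))\in F$. *)

(* Defs.v *)
From HB Require Import structures.
From mathcomp Require Import all_boot all_order all_algebra generic_quotient.
From mathcomp Require Import all_classical all_reals all_analysis.
From mathcomp Require Import measurable_realfun ess_sup_inf.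

Set Implicit Arguments.
Unset Strict Implicit.
Unset Printing Implicit Defensive.

Import Order.TTheory GRing.Theory Num.Theory.
Import numFieldNormedType.Exports.

Local Open Scope classical_set_scope.
Local Open Scope ring_scope.

(* [LspaceType mu p1] is the library's type of a.e.-classes of measurable     *)
(* functions with finite p-norm; the library gives it no algebraic structure. *)
(* We equip it with the normed space structure carried by representatives.    *)
Section Lspace_normedMod.
Context d (T : measurableType d) (R : realType).
Variables (mu : {measure set T -> \bar R}) (p : \bar R) (p1 : (1 <= p)%E).

Local Notation Lp := (LspaceType mu p1).
Local Notation Lf := (LfunType mu p1).

Lemma ae_eq_Lnorm (f g : T -> R) :
    measurable_fun setT f -> measurable_fun setT g -> f = g %[ae mu] ->
  'N[mu]_p[EFin \o f]%E = 'N[mu]_p[EFin \o g]%E.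
Proof.
move=> mf mg fg; rewrite unlock /Lnorm; case: p p1 => [r r1||//].
- have mpow (h : T -> R) : measurable_fun setT h ->
      measurable_fun setT ((@poweR R ^~ r) \o (abse \o (EFin \o h))).
    move=> mh; apply: measurableT_comp; first exact: measurable_poweR.
    exact/measurableT_comp/measurable_EFinP.
  congr (_ `^ _)%E; apply: ae_eq_integral => //; [exact: mpow..|].
  by apply: filterS fg => x /= fgx _; rewrite fgx.
- case: ifP => // _ _; apply: eq_ess_sup.
  by apply: filterS fg => x /= fgx; rewrite fgx.
Qed.

Lemma Lspace_Lfun (f : Lp) : (f : T -> R) \in Lfun mu p.
Proof.
rewrite inE; apply/andP; split; apply/mem_set.
  exact: (@measurable_funPT _ _ _ _
    (repr (f : {mfun_ mu, T >-> measurableTypeR R}))).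
exact: (@Lebesgue_finite _ _ _ _ _ p1 f).
Qed.

Definition Lrepr (f : Lp) : Lf := Lfun_Sub p1 (Lspace_Lfun f).

Lemma measurable_Lfun (f : Lf) : (f : T -> measurableTypeR R) \in mfun.
Proof.
apply/mem_set => /=; exact: (@measurable_funPT _ _ _ _ (f : {mfun T >-> R})).
Qed.

Definition Lclass_mfun (f : Lf) : {mfun_ mu, T >-> measurableTypeR R} :=
  \pi_({mfun_ mu, T >-> measurableTypeR R})%qT (mfun_Sub (measurable_Lfun f)).

Lemma Lclass_mfunE (f : Lf) : (Lclass_mfun f : T -> R) = f %[ae mu].
Proof.
have /eqP : (\pi_({mfun_ mu, T >-> measurableTypeR R}) (repr (Lclass_mfun f)) =
  Lclass_mfun f)%qT by rewrite reprK.
by rewrite eqmodE => /asboolP.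
Qed.

Lemma Lclass_finite (f : Lf) : finite_norm mu p (Lclass_mfun f : T -> R).
Proof.
rewrite /finite_norm (ae_eq_Lnorm _ _ (Lclass_mfunE f)).
- exact: Lfunction_finite.
- exact: (@measurable_funPT _ _ _ _ (repr (Lclass_mfun f))).
- exact: measurable_funPT.
Qed.

Definition Lclass (f : Lf) : Lp :=
  HB.pack_for Lp (Lclass_mfun f)
    (isFinLebesgue.Build _ _ _ _ _ p1 (Lclass_mfun f) (Lclass_finite f)).

Lemma LclassE (f : Lf) : Lrepr (Lclass f) = f %[ae mu].
Proof. exact: Lclass_mfunE. Qed.

Lemma Lspace_eqP (f g : Lp) : (f : T -> R) = g %[ae mu] <-> f = g.
Proof.
split=> [fg|->]; last exact: ae_eq_refl.
have : (f : {mfun_ mu, T >-> measurableTypeR R}) = g.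
  rewrite -[LHS]reprK -[RHS]reprK; apply/eqP; rewrite eqmodE.
  exact/asboolP.
case: f g {fg} => [f [[fP]]] [g [[gP]]] /= fg.
by move: fP gP; rewrite fg => fP gP; rewrite (bool_irrelevance fP gP).
Qed.

Lemma Lclass_eq (f g : Lf) : f = g %[ae mu] -> Lclass f = Lclass g.
Proof.
move=> fg; apply/Lspace_eqP; apply: ae_eq_trans (LclassE f) _.
by apply: ae_eq_trans fg _; apply/ae_eq_sym/LclassE.
Qed.

Lemma LreprK : cancel Lrepr Lclass.
Proof. by move=> f; apply/Lspace_eqP/LclassE. Qed.

HB.instance Definition _ := gen_eqMixin Lp.
HB.instance Definition _ := gen_choiceMixin Lp.

Definition Lspace_zero : Lp := Lclass 0.
Definition Lspace_opp (f : Lp) : Lp := Lclass (- Lrepr f).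
Definition Lspace_add (f g : Lp) : Lp := Lclass (Lrepr f + Lrepr g).
Definition Lspace_scale (a : R) (f : Lp) : Lp := Lclass (a *: Lrepr f).
Definition Lspace_norm (f : Lp) : R := fine 'N[mu]_p[EFin \o f]%E.

Lemma LclassN f : Lspace_opp (Lclass f) = Lclass (- f).
Proof.
apply: Lclass_eq; apply: filterS (LclassE f) => x /= fx _.
by congr (- _); exact: fx.
Qed.

Lemma LclassD f g : Lspace_add (Lclass f) (Lclass g) = Lclass (f + g).
Proof.
apply: Lclass_eq; apply: filterS2 (LclassE f) (LclassE g) => x /= fx gx _.
by congr (_ + _); [exact: fx|exact: gx].
Qed.

Lemma LclassZ a f : Lspace_scale a (Lclass f) = Lclass (a *: f).
Proof.
apply: Lclass_eq; apply: filterS (LclassE f) => x /= fx _.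
by congr (_ *: _); exact: fx.
Qed.

Lemma Lclass_norm (f : Lf) : Lspace_norm (Lclass f) = fine 'N[mu]_p[EFin \o f]%E.
Proof.
congr fine; apply: ae_eq_Lnorm; last exact: (LclassE f).
- exact: (@measurable_funPT _ _ _ _ (Lrepr (Lclass f) : {mfun T >-> R})).
- exact: (@measurable_funPT _ _ _ _ (f : {mfun T >-> R})).
Qed.

Let addA : associative Lspace_add.
Proof.
move=> f g h; rewrite -(LreprK f) -(LreprK g) -(LreprK h) !LclassD.
by rewrite addrA.
Qed.

Let addC : commutative Lspace_add.
Proof. by move=> f g; rewrite /Lspace_add addrC. Qed.

Let add0 : left_id Lspace_zero Lspace_add.
Proof. by move=> f; rewrite -(LreprK f) LclassD add0r. Qed.

Let addN : left_inverse Lspace_zero Lspace_opp Lspace_add.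
Proof. by move=> f; rewrite -(LreprK f) LclassN LclassD addNr. Qed.

HB.instance Definition _ := GRing.isZmodule.Build Lp addA addC add0 addN.

Let scaleA a b f : Lspace_scale a (Lspace_scale b f) = Lspace_scale (a * b) f.
Proof. by rewrite -(LreprK f) !LclassZ scalerA. Qed.

Let scale1 : left_id 1 Lspace_scale.
Proof. by move=> f; rewrite -(LreprK f) LclassZ scale1r. Qed.

Let scaleDr : right_distributive Lspace_scale +%R.
Proof.
move=> a f g; rewrite -(LreprK f) -(LreprK g).
by rewrite [X in Lspace_scale _ X]LclassD !LclassZ [RHS]LclassD scalerDr.
Qed.

Let scaleDl f : {morph Lspace_scale^~ f : a b / a + b}.
Proof.
by move=> a b; rewrite -(LreprK f) !LclassZ [RHS]LclassD scalerDl.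
Qed.

HB.instance Definition _ :=
  GRing.Zmodule_isLmodule.Build R Lp scaleA scale1 scaleDr scaleDl.

Let normD (f g : Lp) : Lspace_norm (f + g) <= Lspace_norm f + Lspace_norm g.
Proof.
rewrite -(LreprK f) -(LreprK g) [X in Lspace_norm X]LclassD !Lclass_norm.
exact: ler_LnormD.
Qed.

Let normZ a (f : Lp) : Lspace_norm (a *: f) = `|a| * Lspace_norm f.
Proof.
rewrite -(LreprK f) [X in Lspace_norm X]LclassZ !Lclass_norm.
by apply: EFin_inj; rewrite EFinM !finite_norm_fine LnormZ.
Qed.

Let norm0_eq0 (f : Lp) : Lspace_norm f = 0 -> f = 0.
Proof.
rewrite -(LreprK f) Lclass_norm => /fine_Lnormr_eq0 f0.
exact: Lclass_eq.
Qed.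

HB.instance Definition _ :=
  Lmodule_isNormed.Build R Lp normD normZ norm0_eq0.

End Lspace_normedMod.

(* L_r[0, 1]: the restriction to [0, 1] makes ]-oo, 0[ and ]1, +oo[ null      *)
(* sets, so the classes are those of functions on [0, 1].                     *)
Definition lebesgue01 (R : realType) :
    {measure set (measurableTypeR R) -> \bar R} :=
  mrestr lebesgue_measure (measurable_itv `[0 : R, 1]).

Definition L01 (R : realType) (r : R) (r1 : 1 <= r) : normedModType R :=
  @LspaceType _ (measurableTypeR R) R (lebesgue01 R) r%:E r1.

Definition borel_fun (X Y : topologicalType) (theta : X -> Y) : Prop :=
  forall B : set Y, <<s @open Y >> B -> <<s @open X >> (theta @^-1` B).

Definition borel_reducible (X Y : topologicalType)
    (E : X -> X -> Prop) (F : Y -> Y -> Prop) : Prop :=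
  exists2 theta : X -> Y, borel_fun theta &
    forall x y, E x y <-> F (theta x) (theta y).

(* [{ptws nat -> X}] is X^N with the product topology.                        *)
Definition Erel (R : realType) (X : normedModType R) (p : R)
    (x y : {ptws nat -> X}) : Prop :=
  (\sum_(0 <= n <oo) (`|x n - y n| `^ p)%:E < +oo)%E.
Arguments Erel {R} X p x y.

(* Main.v *)
From HB Require Import structures.
Require Import Defs.
From mathcomp Require Import all_boot all_order all_algebra.
From mathcomp Require Import all_classical all_reals all_analysis.
From mathcomp Require Import measurable_realfun ring lra.

Set Implicit Arguments.
Unset Strict Implicit.
Unset Printing Implicit Defensive.

Import Order.TTheory GRing.Theory Num.Theory.
Import numFieldNormedType.Exports.

Local Open Scope classical_set_scope.
Local Open Scope ring_scope.

(* Sufficiency.  Put b = s p / q, so that b <= r and b <= s.  A map T : L_r -> L_s for which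
   |T f - T g|^s is comparable to |f - g|^b reduces E(L_r, p) to E(L_s, q) when it is applied
   coordinatewise.  For b < r < 2, the LePage series with coefficients j^(-1/r) f(U_j), the U_j
   being independent and uniform, has squares whose sum has a (b/2)-moment comparable to |f|^b;
   for r = 2 Haar coefficients do the same.  By Khintchine's inequality, randomizing the signs
   gives S f with the integral of |S f - S g|^b comparable to |f - g|^b.  Finally the scalars
   with the distance |x - y|^b embed into (l_s, |.|^s) by lacunary trigonometric functions.

   Necessity.  Along a product of finite sets, a Borel reduction can be made additive by a Baire
   category fusion: the sums of |x_k - x'_k|^p and of |T_k x_k - T_k x'_k|_(l_q(L_s))^q converge
   for the same x, x', for suitable maps T_k.  This is impossible if L_r contains finite metric
   spaces that l_q(L_s) distorts too much.  Segments of length 2^n give p <= q, by the triangle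
   inequality.  The cubes {0, 1}^(2^n) of l_r give p / r <= q / s: their edges have length 1 and
   their diagonals 2^(n/r), but the inequality
   |a + b|^q + |a - b|^q <= 2 (|a|^s + K |b|^s)^(q/s) of L_s forces the q-th power of the distance
   to be at most C 2^(n q / s) times larger on some diagonal than on some edge. *)

(** A reduction compares the convergence of two series and carries no constants. For sufficiency,
    constants uniform in [f] and [g] are therefore enough, and every estimate is two-sided and
    homogeneous. As b may be less than 1, the integral of [|.| ^ b] need not come from a norm: an
    inequality for sums of three terms and a direct proof of completeness replace the theory of L_b.
    The target is L_s[0, 1] itself, so all auxiliary randomness (the U_j, the signs, the index of a
    trigonometric function) is extracted from the binary digits of one point of [0, 1]. For
    necessity, [theta] is only Borel: genericity supplies the uniformity on finite sets that
    continuity would give. The missing constants are then replaced by counting. A finite space is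
    repeated [2 ^ i] times at level [i]; if all copies have a finite total cost in the image, one of
    them is cheap, and there a long pair may be placed. The hypothesis [s <= q] enters through the
    exponent [q / s >= 1], for which Minkowski's inequality holds. *)

Section L01_interface.
Context {R : realType}.

Lemma lebesgue01_setT : lebesgue01 R setT = 1%E.
Proof.
transitivity (lebesgue_measure ([set: R] `&` `[0 : R, 1])); first by [].
rewrite setTI.
by rewrite lebesgue_measure_itv /= lte_fin ltr01 oppr0 adde0.
Qed.

End L01_interface.

(** The function underlying [lebesgue01], named so that the structure of a probability measure can
    be attached to it. *)
Definition unif01 (R : realType) : set (measurableTypeR R) -> \bar R :=
  mrestr lebesgue_measure (measurable_itv `[0 : R, 1]).

HB.instance Definition _ (R : realType) := Measure.on (@unif01 R).

HB.instance Definition _ (R : realType) :=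
  Measure_isProbability.Build _ _ _ (@unif01 R) (@lebesgue01_setT R).

(** * Functions representing the elements of L_r[0, 1] *)

Section L01_representatives.
Context {R : realType}.

Definition P01 : probability (measurableTypeR R) R := @unif01 R.

Context (r : R) (r1 : 1 <= r).
Let X := L01 r1.

Definition L01fun (f : X) : R -> R := Lrepr f.

Lemma measurable_L01fun (f : X) : measurable_fun setT (L01fun f).
Proof.
exact: (@measurable_funPT _ _ _ _ (Lrepr f : {mfun (measurableTypeR R) >-> R})).
Qed.

Lemma L01_normE (f g : X) :
  (`|f - g| `^ r)%:E = (\int[P01]_x (`|L01fun f x - L01fun g x| `^ r)%:E)%E.
Proof.
have r0 : r != 0 by rewrite gt_eqF// (lt_le_trans ltr01).
transitivity ((Lnorm P01 r%:E (fun x => (L01fun f x - L01fun g x)%:E) `^ r)%E);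
  last by rewrite powR_Lnorm//; apply: eq_integral => x _.
rewrite -{1}(LreprK f) -{1}(LreprK g).
have -> : (Lclass (Lrepr f) - Lclass (Lrepr g) : X) = Lclass (Lrepr f - Lrepr g).
  rewrite -[RHS]LclassD; congr (_ + _); exact: LclassN.
rewrite [X in X `^ r](Lclass_norm (Lrepr f - Lrepr g)).
by rewrite -poweR_EFin finite_norm_fine.
Qed.

(** A sigma type rather than an existential statement: the class is data, so a map into [L01] can be
    defined from a map into functions. *)
Lemma L01_mk (F : R -> R) : measurable_fun setT F ->
  (\int[P01]_x (`|F x| `^ r)%:E < +oo)%E ->
  {f : X | ae_eq P01 setT (L01fun f) F}.
Proof.
move=> mF Foo.
have r0 : r != 0 by rewrite gt_eqF// (lt_le_trans ltr01).
have FL : F \in Lfun P01 r%:E.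
  rewrite inE; apply/andP; split; apply/mem_set => //=.
  rewrite /finite_norm.
  have : (Lnorm P01 r%:E (EFin \o F) `^ r = \int[P01]_x (`|F x| `^ r)%:E)%E.
    by rewrite powR_Lnorm//; apply: eq_integral => x _.
  move: (Lnorm_ge0 P01 r%:E (EFin \o F)).
  case: (Lnorm _ _ _) => [a|_|//]; first by rewrite ltry.
  rewrite poweRyr // => /esym h; move: Foo.
  by rewrite (_ : (\int[P01]_x (`|F x| `^ r)%:E)%E = +oo%E).
exists (Lclass (@Lfun_Sub _ _ _ P01 r%:E r1 F FL)).
exact: LclassE.
Qed.

End L01_representatives.

Definition push d d' (T1 : measurableType d) (T2 : measurableType d')
    (R : realType) (m : {measure set T1 -> \bar R}) (f : T1 -> T2)
    (mf : measurable_fun setT f) : {measure set T2 -> \bar R} :=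
  measure_function_pushforward__canonical__measure_function_Measure m mf.

(** * Self-similarity of the uniform measure *)

Section splitting.
Context {R : realType}.

(** Rays are stable under intersection and generate the Borel sets; this reduces the identities in
    law below to distribution functions. *)
Lemma ray_measure_unique (m1 m2 : {measure set (measurableTypeR R) -> \bar R}) :
  (m1 setT < +oo)%E ->
  (forall a, m1 `]a, +oo[%classic = m2 `]a, +oo[%classic) ->
  forall A, measurable A -> m1 A = m2 A.
Proof.
move=> m1oo m12 A mA.
apply: (@measure_unique _ R (measurableTypeR R) (@RGenOInfty.G R)
  (fun n => `](- n%:R), +oo[%classic) _ _ _ _ m1 m2) => //.
- exact: RGenOInfty.measurableE.
- move=> _ _ [a ->] [b ->]; exists (Num.max a b); apply/seteqP; split => x /=;
    by rewrite !in_itv/= !andbT gt_max => /andP.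
- by move=> i; exists (- i%:R).
- apply/seteqP; split => // x _; exists (Num.trunc `|x|).+1 => //=.
  rewrite in_itv/= andbT ltrNl; apply: le_lt_trans (ler_norm _) _.
  by rewrite normrN; exact: truncnS_gt.
- by move=> _ [a ->].
- move=> n; apply: le_lt_trans m1oo; apply: le_measure => //; rewrite inE//.
Qed.

(** As a function of [a], [clamp01 (1 - a)] is the probability that a uniform variable exceeds
    [a]. *)
Definition clamp01 (x : R) : R := Num.max 0 (Num.min x 1).

Lemma P01_ray (a : R) : P01 `]a, +oo[%classic = (clamp01 (1 - a))%:E.
Proof.
transitivity (lebesgue_measure (`]a, +oo[ `&` `[0 : R, 1])); first by [].
rewrite /clamp01; have [a0|a0] := ltP a 0.
  rewrite setIidr ?lebesgue_measure_itv/= ?lte_fin ?ltr01 ?oppr0 ?adde0.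
    by congr EFin; rewrite min_r ?max_r//; lra.
  by move=> x /=; rewrite !in_itv/= andbT => /andP[? _]; lra.
have -> : `]a, +oo[ `&` `[0, 1] = `]a, 1]%classic.
  apply/seteqP; split => x /=; rewrite !in_itv/= ?andbT; first by case=> -> /andP[].
  by move=> /andP[ax ->]; split => //; rewrite andbT; lra.
rewrite lebesgue_measure_itv/= lte_fin; case: ltP => a1.
  by rewrite -EFinB; congr EFin; rewrite min_l ?max_r//; lra.
by congr EFin; rewrite min_l ?max_l//; lra.
Qed.

Lemma P01_le1 : {ae @P01 R, forall x : R, 0 <= x < 1}.
Proof.
exists (~` `[0, 1[); split.
- by apply: measurableC.
- transitivity (lebesgue_measure (~` `[0, 1[ `&` `[0 : R, 1])); first by [].
  apply/eqP; rewrite -measure_le0 -(lebesgue_measure_set1 (1 : R)).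
  apply: le_measure; rewrite ?inE//.
    by apply: measurableI => //; exact: measurableC.
  move=> x /=; rewrite !in_itv/= => -[+ /andP[x0 x1]]; rewrite x0/= => /negP.
  by rewrite -leNgt => ?; apply/eqP; rewrite eq_le x1.
- by apply: subsetC => x /=; rewrite in_itv.
Qed.

Let half0 (x : R) := x / 2.
Let half1 (x : R) := (1 + x) / 2.
Let mh0 : measurable_fun setT (half0 : measurableTypeR R -> measurableTypeR R).
Proof. by apply: measurable_funM. Qed.
Let mh1 : measurable_fun setT (half1 : measurableTypeR R -> measurableTypeR R).
Proof. by apply: measurable_funM => //; apply: measurable_funD. Qed.

Lemma P01_split (A : set (measurableTypeR R)) : measurable A ->
  P01 A = mscale (2^-1)%:nng
    (measure_add (push P01 mh0) (push P01 mh1)) A.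
Proof.
apply: ray_measure_unique => [|a].
  by rewrite [X in (X < _)%E]probability_setT ltry.
transitivity ((clamp01 (1 - a))%:E); first exact: P01_ray.
transitivity ((2^-1)%:E * ((@P01 R) (half0 @^-1` `]a, +oo[)
   + (@P01 R) (half1 @^-1` `]a, +oo[)))%E; last first.
  transitivity ((2^-1)%:E * measure_add (push (@P01 R) mh0) (push (@P01 R) mh1)
    `]a, +oo[%classic)%E; last by [].
  by rewrite measure_addE.
have -> : half0 @^-1` `]a, +oo[ = `](2 * a), +oo[%classic.
  by apply/seteqP; split => x /=; rewrite !in_itv/= !andbT /half0; lra.
have -> : half1 @^-1` `]a, +oo[ = `](2 * a - 1), +oo[%classic.
  by apply/seteqP; split => x /=; rewrite !in_itv/= !andbT /half1; lra.
rewrite [in RHS](P01_ray (2 * a)) [in RHS](P01_ray (2 * a - 1)) -EFinD -EFinM.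
congr EFin; rewrite /clamp01 /Num.max /Num.min.
by repeat case: ifP; lra.
Qed.

Lemma integral_P01_split (h : R -> \bar R) :
  measurable_fun setT h -> (forall x, 0 <= h x)%E ->
  (\int[@P01 R]_x h x = (2^-1)%:E *
    (\int[@P01 R]_x h (x / 2)%R + \int[@P01 R]_x h ((1 + x) / 2)%R))%E.
Proof.
move=> mh h0.
rewrite (@eq_measure_integral _ _ _ _ (mscale (2^-1)%:nng
    (measure_add (push P01 mh0) (push P01 mh1))));
  last by move=> A mA _; exact: P01_split.
rewrite ge0_integral_mscale//; congr (_ * _)%E.
rewrite ge0_integral_measure_add//.
by congr (_ + _)%E; rewrite ge0_integral_pushforward.
Qed.

(** On [0, 1[, [bit] is the first binary digit and [dbl] shifts the digits by one place. *)
Definition bit (t : R) : R := ((2^-1 <= t)%R)%:R.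
Definition dbl (t : R) : R := 2 * t - bit t.

Lemma measurable_bit : measurable_fun setT (bit : measurableTypeR R -> measurableTypeR R).
Proof.
have -> : bit = \1_(`[2^-1, +oo[).
  by apply/funext => x; rewrite /bit indicE mem_setE in_itv/= andbT.
exact: measurable_indic.
Qed.

Lemma measurable_dbl : measurable_fun setT (dbl : measurableTypeR R -> measurableTypeR R).
Proof.
by apply: measurable_funB; [apply: measurable_funM|exact: measurable_bit].
Qed.

(** The first digit is a fair coin, independent of the digits after it, and these are again the
    digits of a uniform point. *)
Lemma integral_bit_dbl (H : R -> R -> \bar R) :
  measurable_fun setT (H 0) -> measurable_fun setT (H 1) ->
  (forall b x, 0 <= H b x)%E ->
  (\int[@P01 R]_x H (bit x) (dbl x) = (2^-1)%:E *
    (\int[@P01 R]_x H 0%R x + \int[@P01 R]_x H 1%R x))%E.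
Proof.
move=> m0 m1 H0.
have HE t : H (bit t) (dbl t) = if 2^-1 <= t then H 1 (2 * t - 1) else H 0 (2 * t).
  by rewrite /dbl /bit; case: ifP => //=; rewrite subr0.
have mH : measurable_fun setT (fun t => H (bit t) (dbl t)).
  under eq_fun do rewrite HE.
  apply: measurable_fun_ifT.
  - by apply: measurable_fun_ler.
  - by apply: measurableT_comp => //; apply: measurable_funB => //; apply: measurable_funM.
  - by apply: measurableT_comp => //; apply: measurable_funM.
rewrite integral_P01_split//; congr (_ * _)%E; congr (_ + _)%E.
- apply: ge0_ae_eq_integral => //; [exact: (measurableT_comp mH mh0)|].
  case: P01_le1 => N [mN N0 sN]; exists N; split => //.
  apply: subset_trans sN; apply: subsetC => x /= /andP[x0 x1] _.
  by rewrite HE ifF; [congr H; field|apply/negbTE; rewrite -ltNge; lra].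
- apply: ge0_ae_eq_integral => //; [exact: (measurableT_comp mH mh1)|].
  case: P01_le1 => N [mN N0 sN]; exists N; split => //.
  apply: subset_trans sN; apply: subsetC => x /= /andP[x0 x1] _.
  by rewrite HE ifT; [congr H; field|lra].
Qed.

End splitting.

(** * Independence of binary digits *)

Section digit_interleaving.
Context {R : realType}.
Notation P := (@P01 R).
Local Arguments P01 : simpl never.

(** Ranks start at 0, so [bit t] is the first digit kept; [dbl (dbl t)] then skips one digit. *)
Fixpoint evd_approx (n : nat) (t : R) : R :=
  if n is n'.+1 then (bit t + evd_approx n' (dbl (dbl t))) / 2 else 0.

Lemma bit01 (t : R) : 0 <= bit t <= 1.
Proof. by rewrite /bit; case: (2^-1 <= t); rewrite /= ?lexx ler01. Qed.

Lemma evd_approx01 n t : 0 <= evd_approx n t <= 1.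
Proof.
elim: n t => [|n IH] t /=; first by rewrite lexx ler01.
by have := bit01 t; have := IH (dbl (dbl t)); lra.
Qed.

Lemma evd_approx_nd t : nondecreasing_seq (evd_approx ^~ t).
Proof.
apply/nondecreasing_seqP => n; elim: n t => [|n IH] t.
  by case/andP: (evd_approx01 1 t).
rewrite [in leRHS]/= [in leLHS]/=; have := IH (dbl (dbl t)); set x := evd_approx n.+1 _.
by move=> h; rewrite ler_pM2r ?lerD2l.
Qed.

Lemma evd_approx_cvg t : cvgn (evd_approx ^~ t).
Proof.
apply: nondecreasing_is_cvgn; first exact: evd_approx_nd.
by exists 1 => _ [n _ <-]; case/andP: (evd_approx01 n t).
Qed.

(* the number whose binary digits are the digits of even rank of [t] *)
Definition evd (t : R) : R := limn (evd_approx ^~ t).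

Lemma evdE t : evd t = (bit t + evd (dbl (dbl t))) / 2.
Proof.
rewrite /evd; apply/cvg_lim => //.
rewrite -(cvg_shiftS (evd_approx ^~ t)) /=.
apply: cvgMl; apply: cvgD; first exact: cvg_cst.
exact: evd_approx_cvg.
Qed.

Lemma evd01 t : 0 <= evd t <= 1.
Proof.
apply/andP; split.
  apply: limr_ge; first exact: evd_approx_cvg.
  by apply: nearW => n; case/andP: (evd_approx01 n t).
apply: limr_le; first exact: evd_approx_cvg.
by apply: nearW => n; case/andP: (evd_approx01 n t).
Qed.

Lemma measurable_evd : measurable_fun setT (evd : measurableTypeR R -> measurableTypeR R).
Proof.
apply: (measurable_fun_cvg (h := evd_approx)) => [n|t _]; last exact: evd_approx_cvg.
elim: n => [|n IH] //=.
apply: measurable_funM => //; apply: measurable_funD; first exact: measurable_bit.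
apply: measurableT_comp => //.
by apply: measurableT_comp; exact: measurable_dbl.
Qed.

Definition odd_digits (t : R) : R := evd (dbl t).

Lemma measurable_odd_digits :
  measurable_fun setT (odd_digits : measurableTypeR R -> measurableTypeR R).
Proof. by apply: measurableT_comp; [exact: measurable_evd|exact: measurable_dbl]. Qed.

(** The joint tail function of [evd] and [odd_digits]; it is to be identified with the product [p]
    of two uniform tails. *)
Let q (a b : R) : R := fine (P [set t | a < evd t /\ b < odd_digits t]).

Let mset a b : measurable ([set t | a < evd t /\ b < odd_digits t] : set (measurableTypeR R)).
Proof.
have -> : [set t | a < evd t /\ b < odd_digits t] =
    evd @^-1` `]a, +oo[ `&` odd_digits @^-1` `]b, +oo[.
  by apply/seteqP; split => t /=; rewrite !in_itv/= !andbT.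
apply: measurableI; rewrite -[X in measurable X]setTI.
  by apply: measurable_evd => //; exact: measurable_itv.
by apply: measurable_odd_digits => //; exact: measurable_itv.
Qed.

Let qE a b : (q a b)%:E = P [set t | a < evd t /\ b < odd_digits t].
Proof. by rewrite /q fineK// fin_num_measure. Qed.

Let dbl_split (A : R -> set R) :
  (forall d, measurable (A d : set (measurableTypeR R))) ->
  P [set t | A (bit t) (dbl t)] = ((2^-1)%:E * (P (A 0%R) + P (A 1%R)))%E.
Proof.
move=> mA.
have mA' d : measurable_fun setT (fun x => (\1_(A d) x)%:E : \bar R).
  by apply/measurable_EFinP; apply: measurable_indic; exact: mA.
have := @integral_bit_dbl R (fun d x => (\1_(A d) x)%:E) (mA' 0) (mA' 1).
have iE (C : set R) : measurable (C : set (measurableTypeR R)) ->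
    (\int[P]_x (\1_C x)%:E)%E = P C.
  by move=> mC; rewrite integral_indic// setIT.
rewrite (iE _ (mA 0)) (iE _ (mA 1)) => <-; last by move=> d x; rewrite lee_fin.
have mS : measurable ([set t | A (bit t) (dbl t)] : set (measurableTypeR R)).
  have -> : [set t | A (bit t) (dbl t)] =
     (bit @^-1` [set 1] `&` dbl @^-1` (A 1)) `|` (bit @^-1` [set 0] `&` dbl @^-1` (A 0)).
    apply/seteqP; split => t /=.
      by rewrite /bit; case: (2^-1 <= t) => /= ?; [left|right].
    by move=> [[<-]|[<-]].
  by apply: measurableU; apply: measurableI; rewrite -[X in measurable X]setTI;
    [exact: measurable_bit|exact: measurable_dbl|exact: measurable_bit|exact: measurable_dbl].
by rewrite -iE.
Qed.

(** Dropping the first digit exchanges the two subsequences: [evd t] is the average of [bit t] and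
    [odd_digits (dbl t)], while [odd_digits t] is [evd (dbl t)]. Hence the exchanged arguments. *)
Let q_rec a b : q a b = (q b (2 * a) + q b (2 * a - 1)) / 2.
Proof.
apply: EFin_inj; rewrite qE mulrC EFinM EFinD !qE.
pose A d := [set t | b < evd t /\ 2 * a - d < odd_digits t].
have -> : [set t | a < evd t /\ b < odd_digits t] = [set t | A (bit t) (dbl t)].
  apply/seteqP; split => t /=; rewrite /A /= /odd_digits (evdE t) => -[? ?]; split => //; lra.
by rewrite (dbl_split (A := A)) /A ?subr0.
Qed.

Let p a b : R := clamp01 (1 - a) * clamp01 (1 - b).

Let clamp_rec (a : R) : clamp01 (1 - a) = (clamp01 (1 - 2 * a) + clamp01 (1 - (2 * a - 1))) / 2.
Proof.
rewrite /clamp01; have := lexx a; rewrite /Num.max /Num.min.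
by repeat case: ifP; lra.
Qed.

Let p_rec a b : p a b = (p b (2 * a) + p b (2 * a - 1)) / 2.
Proof. by rewrite /p {1}clamp_rec; ring. Qed.

Let q1 (a : R) : R := fine (P [set t | a < evd t]).

Let mset1 a : measurable ([set t | a < evd t] : set (measurableTypeR R)).
Proof.
have -> : [set t | a < evd t] = evd @^-1` `]a, +oo[.
  by apply/seteqP; split => t /=; rewrite !in_itv/= !andbT.
rewrite -[X in measurable X]setTI.
by apply: measurable_evd => //; exact: measurable_itv.
Qed.

Let q1E a : (q1 a)%:E = P [set t | a < evd t].
Proof. by rewrite /q1 fineK// fin_num_measure. Qed.

Let q_lt0l a b : a < 0 -> q a b = q1 b.
Proof.
move=> a0; apply: EFin_inj; rewrite qE q1E.
have -> : [set t | a < evd t /\ b < odd_digits t] = [set t | [set x | b < evd x] (dbl t)].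
  apply/seteqP; split => t /=; first by case.
  by move=> ?; split => //; have := evd01 t; lra.
rewrite (dbl_split (A := fun=> [set x | b < evd x]))//.
by rewrite -q1E -EFinD -EFinM; congr EFin; field.
Qed.

Let q_lt0r a b : b < 0 -> q a b = q1 a.
Proof.
move=> b0; apply: EFin_inj; rewrite qE q1E; congr (P _).
apply/seteqP; split => t /=; first by case.
by move=> ?; split => //; have := evd01 (dbl t); rewrite /odd_digits; lra.
Qed.

Let q_ge1l a b : 1 <= a -> q a b = 0.
Proof.
move=> a0; apply: EFin_inj; rewrite qE; transitivity (P set0); last by rewrite measure0.
congr (P _); by apply/seteqP; split => t //= [? _]; have := evd01 t; lra.
Qed.

Let q_ge1r a b : 1 <= b -> q a b = 0.
Proof.
move=> a0; apply: EFin_inj; rewrite qE; transitivity (P set0); last by rewrite measure0.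
congr (P _); by apply/seteqP; split => t //= [_ h]; have := evd01 (dbl t); rewrite /odd_digits in h; lra.
Qed.

Let clamp1 (a : R) : a < 0 -> clamp01 (1 - a) = 1.
Proof. by move=> a0; rewrite /clamp01 min_r ?max_r//; lra. Qed.

Let clamp0 (a : R) : 1 <= a -> clamp01 (1 - a) = 0.
Proof. by move=> a0; rewrite /clamp01 max_l// ge_min; lra. Qed.

Let clampb (a : R) : 0 <= clamp01 a <= 1.
Proof. by rewrite /clamp01 /Num.max /Num.min; repeat case: ifP; lra. Qed.

Let qb a b : 0 <= q a b <= 1.
Proof.
rewrite -!lee_fin qE; apply/andP; split; first exact: measure_ge0.
exact: probability_le1.
Qed.

Let small_eq0 (x : R) : (forall n : nat, `|x| <= 2^-1 ^+ n) -> x = 0.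
Proof.
move=> h; apply/eqP; rewrite -normr_le0.
have h0 : (fun n => 2^-1 ^+ n : R) @ \oo --> (0 : R).
  by apply: cvg_expr; rewrite ger0_norm//; lra.
apply: (ler_cvg_to (cvg_cst `|x|) h0); exact: nearW.
Qed.

(* Outside [0, 1[ both sides agree, so only one term of the recursion can differ: each use of it
   halves the gap. *)
Let q1_clamp a : q1 a = clamp01 (1 - a).
Proof.
have m1 : (-1 : R) < 0 by lra.
apply/eqP; rewrite -subr_eq0; apply/eqP; apply: small_eq0 => n; elim: n a => [|n IH] a.
  rewrite expr0 -(q_lt0r a m1).
  by have := qb a (-1); have := clampb (1 - a); rewrite ler_norml; lra.
have [a0|a0] := ltP a 0.
  have -> : q1 a = 1.
    apply: EFin_inj; rewrite q1E -(probability_setT P); congr (P _).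
    by apply/seteqP; split => t //= _; have := evd01 t; lra.
  by rewrite clamp1// subrr normr0 exprn_ge0//; lra.
have [a1|a1] := ltP a 1; last first.
  by rewrite -(q_lt0r a m1) ?q_ge1l ?clamp0// ?subrr ?normr0 ?exprn_ge0//; lra.
have -> : q1 a = (q1 (2 * a) + q1 (2 * a - 1)) / 2.
  by rewrite -(q_lt0r a m1) q_rec (q_lt0l (2 * a) m1) (q_lt0l (2 * a - 1) m1).
rewrite clamp_rec exprS.
have [h|h] := ltP a 2^-1.
  have -> : q1 (2 * a - 1) = clamp01 (1 - (2 * a - 1)).
    rewrite clamp1; last lra.
    apply: EFin_inj; rewrite q1E -(probability_setT P); congr (P _).
    by apply/seteqP; split => t //= _; have := evd01 t; lra.
  rewrite -mulrBl normrM mulrC (_ : `|2^-1| = 2^-1 :> R); last by rewrite ger0_norm.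
  rewrite ler_pM2l//; apply: le_trans (IH (2 * a)); rewrite le_eqVlt; apply/orP; left.
  by apply/eqP; congr `|_|; ring.
have -> : q1 (2 * a) = clamp01 (1 - 2 * a).
  by rewrite clamp0 -?(q_lt0r (2 * a) m1) ?q_ge1l//; lra.
rewrite -mulrBl normrM mulrC (_ : `|2^-1| = 2^-1 :> R); last by rewrite ger0_norm.
rewrite ler_pM2l//; apply: le_trans (IH (2 * a - 1)); rewrite le_eqVlt; apply/orP; left.
by apply/eqP; congr `|_|; ring.
Qed.

Let q_p a b : q a b = p a b.
Proof.
apply/eqP; rewrite -subr_eq0; apply/eqP; apply: small_eq0 => n; elim: n a b => [|n IH] a b.
  rewrite expr0 /p; have := qb a b; have /andP[h1 h2] := clampb (1 - a).
  have /andP[h3 h4] := clampb (1 - b); rewrite ler_norml.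
  have : clamp01 (1 - a) * clamp01 (1 - b) <= 1 * 1 by apply: ler_pM.
  by have := mulr_ge0 h1 h3; lra.
have e0 : (0 : R) <= 2^-1 ^+ n.+1 by rewrite exprn_ge0//; lra.
have edge x y : (x < 0) || (1 <= x) -> q y x = p y x.
  rewrite /p; case/orP => h; first by rewrite (q_lt0r _ h) (clamp1 h) mulr1 q1_clamp.
  by rewrite (q_ge1r _ h) (clamp0 h) mulr0.
have [a0|a0] := ltP a 0.
  by rewrite (q_lt0l _ a0) /p (clamp1 a0) mul1r q1_clamp subrr normr0.
have [a1|a1] := ltP a 1; last by rewrite (q_ge1l _ a1) /p (clamp0 a1) mul0r subrr normr0.
rewrite q_rec p_rec exprS -mulrBl.
rewrite normrM mulrC (_ : `|2^-1| = 2^-1 :> R); last by rewrite ger0_norm.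
rewrite ler_pM2l//.
have [h|h] := ltP a 2^-1.
  rewrite (edge (2 * a - 1)); last by apply/orP; left; lra.
  apply: le_trans (IH b (2 * a)); rewrite le_eqVlt; apply/orP; left.
  by apply/eqP; congr `|_|; ring.
rewrite (edge (2 * a)); last by apply/orP; right; lra.
apply: le_trans (IH b (2 * a - 1)); rewrite le_eqVlt; apply/orP; left.
by apply/eqP; congr `|_|; ring.
Qed.

Let interleave (t : measurableTypeR R) : measurableTypeR R * measurableTypeR R :=
  (evd t, odd_digits t).

Let minter : measurable_fun setT interleave.
Proof.
apply/measurable_fun_pairP; split; [exact: measurable_evd|exact: measurable_odd_digits].
Qed.

Let law_rays a b :
  P (evd @^-1` `]a, +oo[ `&` odd_digits @^-1` `]b, +oo[) = (P `]a, +oo[%classic * P `]b, +oo[%classic)%E.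
Proof.
rewrite !P01_ray -EFinM -[X in _ = X%:E]/(p a b) -q_p qE; congr (P _).
by apply/seteqP; split => t /=; rewrite !in_itv/= !andbT.
Qed.

Let mP (A : set R) : measurable (A : set (measurableTypeR R)) ->
  measurable (evd @^-1` A : set (measurableTypeR R)).
Proof. by move=> mA; rewrite -[X in measurable X]setTI; exact: measurable_evd. Qed.

Let mQ (A : set R) : measurable (A : set (measurableTypeR R)) ->
  measurable (odd_digits @^-1` A : set (measurableTypeR R)).
Proof. by move=> mA; rewrite -[X in measurable X]setTI; exact: measurable_odd_digits. Qed.

Let fin_mes_oo (A : set R) : measurable (A : set (measurableTypeR R)) -> (P A < +oo)%E.
Proof. by move=> mA; rewrite -ge0_fin_numE// fin_num_measure. Qed.

(** Uniqueness of measures on rays extends the product formula to Borel sets one factor at a time: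
    here the second, in [P01_interleave] the first. *)
Let law_half a B : measurable (B : set (measurableTypeR R)) ->
  P (evd @^-1` `]a, +oo[ `&` odd_digits @^-1` B) = (P `]a, +oo[%classic * P B)%E.
Proof.
move=> mB.
have mI := mP (@measurable_itv R `]a, +oo[).
pose m1 := push (mrestr P mI) measurable_odd_digits.
have k0 : 0 <= fine (P `]a, +oo[%classic) by rewrite fine_ge0.
pose m2 := mscale (NngNum k0) P.
have e A : m2 A = (P `]a, +oo[%classic * P A)%E.
  by rewrite /m2 /= /mscale /= fineK// fin_num_measure.
transitivity (m1 B); first by rewrite /m1 /push /= /pushforward /= /mrestr setIC.
transitivity (m2 B); last by rewrite e.
apply: ray_measure_unique mB => [|b].
  by apply: fin_mes_oo; apply: measurableI => //; exact: mQ.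
transitivity (P `]a, +oo[%classic * P `]b, +oo[%classic)%E; last exact/esym/e.
by rewrite -law_rays setIC.
Qed.

Lemma P01_interleave A B : measurable (A : set (measurableTypeR R)) ->
  measurable (B : set (measurableTypeR R)) ->
  P (evd @^-1` A `&` odd_digits @^-1` B) = (P A * P B)%E.
Proof.
move=> mA mB.
pose m1 := push (mrestr P (mQ mB)) measurable_evd.
have k0 : 0 <= fine (P B) by rewrite fine_ge0.
pose m2 := mscale (NngNum k0) P.
have e C : m2 C = (P B * P C)%E.
  by rewrite /m2 /= /mscale /= fineK// fin_num_measure.
transitivity (m1 A); first by [].
transitivity (m2 A); last by rewrite e muleC.
apply: ray_measure_unique mA => [|a].
  by apply: fin_mes_oo; apply: measurableI; [exact: mP|exact: mQ].
transitivity (P B * P `]a, +oo[%classic)%E; last exact/esym/e.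
by rewrite muleC -law_half.
Qed.

(** One uniform point stands for two independent ones: a double integral becomes an integral over
    [0, 1], and constructions that need extra randomness do not leave L_s[0, 1]. *)
Lemma integral_interleave (F : R * R -> \bar R) :
  measurable_fun setT (F : measurableTypeR R * measurableTypeR R -> _) ->
  (forall z, 0 <= F z)%E ->
  (\int[P]_t F (evd t, odd_digits t) = \int[P]_x \int[P]_y F (x, y))%E.
Proof.
move=> mF F0.
have := @fubini_tonelli1 _ _ (measurableTypeR R) (measurableTypeR R) R P P F mF F0; rewrite /fubini_F => <-.
rewrite (@eq_measure_integral _ _ _ _ (push P minter)); last first.
  by move=> A mA _; apply: product_measure_unique => // C D mC mD; exact: P01_interleave.
by rewrite ge0_integral_pushforward.
Qed.

Lemma integral_P01_cst (k : \bar R) : (\int[P]_x k = k)%E.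
Proof. transitivity (k * P setT)%E; last by rewrite probability_setT mule1.
exact: (integral_cst P measurableT). Qed.

Lemma integral_evd (h : R -> \bar R) :
  measurable_fun setT h -> (forall x, 0 <= h x)%E ->
  (\int[P]_t h (evd t) = \int[P]_x h x)%E.
Proof.
move=> mh h0; transitivity (\int[P]_x \int[P]_y h x)%E.
  apply: (integral_interleave (F := fun z => h z.1)) => //.
  exact: (measurableT_comp mh measurable_fst).
by apply: eq_integral => x _; exact: integral_P01_cst.
Qed.

Lemma integral_odd_digits (h : R -> \bar R) :
  measurable_fun setT h -> (forall x, 0 <= h x)%E ->
  (\int[P]_t h (odd_digits t) = \int[P]_x h x)%E.
Proof.
move=> mh h0; transitivity (\int[P]_x \int[P]_y h y)%E; last exact: integral_P01_cst.
apply: (integral_interleave (F := fun z => h z.2)) => //.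
exact: (measurableT_comp mh measurable_snd).
Qed.

End digit_interleaving.

(** * Integrals of nonnegative functions over [0, 1] *)

Definition mf01 {R : realType} (f : R -> R) :=
  measurable_fun setT (f : measurableTypeR R -> measurableTypeR R).

(** Extended-real valued, so that integrals of nonnegative functions can be handled before they are
    known to be finite. *)
Definition int01 {R : realType} (f : R -> R) : \bar R := (\int[@P01 R]_x (f x)%:E)%E.


Section int01.
Context {R : realType}.
Implicit Types f g : R -> R.

Lemma mf01E f : mf01 f -> measurable_fun setT (fun x => (f x)%:E).
Proof. by move=> mf; apply/measurable_EFinP. Qed.

Lemma int01_ge0 f : (forall x, 0 <= f x) -> (0 <= int01 f)%E.
Proof. by move=> f0; apply: integral_ge0 => x _; rewrite lee_fin. Qed.

Lemma int01_le f g : mf01 f -> mf01 g -> (forall x, 0 <= f x) ->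
  (forall x, f x <= g x) -> (int01 f <= int01 g)%E.
Proof.
move=> mf mg f0 fg; apply: ge0_le_integral => //.
- by move=> x _; rewrite lee_fin.
- exact: mf01E.
- exact: mf01E.
- by move=> x _; rewrite lee_fin.
Qed.

Lemma int01D f g : mf01 f -> mf01 g -> (forall x, 0 <= f x) -> (forall x, 0 <= g x) ->
  int01 (fun x => f x + g x)%R = (int01 f + int01 g)%E.
Proof.
move=> mf mg f0 g0; rewrite /int01 -ge0_integralD//.
- by move=> x _; rewrite lee_fin.
- exact: mf01E.
- by move=> x _; rewrite lee_fin.
- exact: mf01E.
Qed.

Lemma int01Z (k : R) f : mf01 f -> (forall x, 0 <= f x) -> 0 <= k ->
  int01 (fun x => k * f x)%R = (k%:E * int01 f)%E.
Proof.
move=> mf f0 k0; rewrite /int01 -ge0_integralZl_EFin//.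
- by move=> x _; rewrite lee_fin.
- exact: mf01E.
Qed.

Lemma int01_cst (k : R) : int01 (fun=> k)%R = k%:E.
Proof. exact: integral_P01_cst. Qed.

Lemma int01_ae f g : mf01 f -> mf01 g -> (forall x, 0 <= f x) -> (forall x, 0 <= g x) ->
  {ae @P01 R, forall x, f x = g x} -> int01 f = int01 g.
Proof.
move=> mf mg f0 g0 [N [mN N0 sN]]; apply: ge0_ae_eq_integral => //.
- exact: mf01E.
- exact: mf01E.
- by move=> x _; rewrite lee_fin.
- by move=> x _; rewrite lee_fin.
- exists N; split => //; apply: subset_trans sN; apply: subsetC => x /= + _; by move=> ->.
Qed.

Lemma int01_interleave (F : R -> R -> R) :
  measurable_fun setT (fun z : measurableTypeR R * measurableTypeR R => F z.1 z.2) ->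
  (forall x y, 0 <= F x y) ->
  int01 (fun t => F (evd t) (odd_digits t))%R = (\int[@P01 R]_x int01 (F x))%E.
Proof.
move=> mF F0; rewrite /int01 (integral_interleave (F := fun z => (F z.1 z.2)%:E))//.
- exact/measurable_EFinP.
- by move=> z; rewrite lee_fin.
Qed.

Lemma int01_evd f : mf01 f -> (forall x, 0 <= f x) -> int01 (fun t => f (evd t))%R = int01 f.
Proof.
move=> mf f0; apply: (integral_evd (h := fun x => (f x)%:E)); first exact: mf01E.
by move=> x; rewrite lee_fin.
Qed.

Lemma int01_odd f : mf01 f -> (forall x, 0 <= f x) ->
  int01 (fun t => f (odd_digits t))%R = int01 f.
Proof.
move=> mf f0; apply: (integral_odd_digits (h := fun x => (f x)%:E)); first exact: mf01E.
by move=> x; rewrite lee_fin.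
Qed.

Lemma mf01_powR (f : R -> R) (b : R) : mf01 f -> mf01 (fun x => `|f x| `^ b).
Proof.
move=> mf; apply: (measurableT_comp (measurable_powR _)).
by apply: measurableT_comp => //; exact: measurable_normr.
Qed.

Lemma mf01_sub f g : mf01 f -> mf01 g -> mf01 (fun x => f x - g x).
Proof. by move=> mf mg; apply: measurable_funB. Qed.

Lemma mf01_add f g : mf01 f -> mf01 g -> mf01 (fun x => f x + g x).
Proof. by move=> mf mg; apply: measurable_funD. Qed.

Lemma mf01_mul f g : mf01 f -> mf01 g -> mf01 (fun x => f x * g x).
Proof. by move=> mf mg; apply: measurable_funM. Qed.

Lemma mf01_cst (k : R) : mf01 (fun=> k).
Proof. exact: measurable_cst. Qed.

Lemma mf01_comp f g : mf01 f -> mf01 g -> mf01 (fun x => f (g x)).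
Proof. by move=> mf mg; apply: (measurableT_comp mf mg). Qed.

Lemma mf01_sum (I : Type) (s : seq I) (h : I -> R -> R) :
  (forall i, mf01 (h i)) -> mf01 (fun x => \sum_(i <- s) h i x).
Proof. by move=> mh; apply: measurable_sum. Qed.

End int01.

(** * Rademacher sums *)

Section rademacher.
Context {R : realType}.

(* under [P01], the [iid j] are independent and uniform *)
Definition iid (j : nat) (t : R) : R := evd (iter j odd_digits t).

Lemma measurable_iter_odd j : mf01 (iter j (@odd_digits R)).
Proof.
elim: j => [|j IH] /=; first exact: measurable_id.
exact: (mf01_comp (f := odd_digits) (@measurable_odd_digits R) IH).
Qed.

Lemma measurable_iid j : mf01 (iid j).
Proof. exact: (mf01_comp (@measurable_evd R) (measurable_iter_odd j)). Qed.

Lemma iidS j t : iid j.+1 t = iid j (odd_digits t).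
Proof. by rewrite /iid iterSr. Qed.

Lemma int01_iid j (f : R -> R) : mf01 f -> (forall x, 0 <= f x) ->
  int01 (fun t => f (iid j t))%R = int01 f.
Proof.
move=> mf f0; elim: j => [|j IH]; first exact: int01_evd.
rewrite -IH -(int01_odd (f := fun t => f (iid j t)))//.
  by rewrite /int01; apply: eq_integral => x _; rewrite iidS.
exact: mf01_comp mf (measurable_iid j).
Qed.

(** The variable of index 0 is read from [evd] and all later ones from [odd_digits], so pairwise
    independence follows by induction. It serves the second moment in [lepage_lower]. *)
Lemma int01_iid2 (j k : nat) (f g : R -> R) : (j < k)%N -> mf01 f -> mf01 g ->
  (forall x, 0 <= f x) -> (forall x, 0 <= g x) ->
  int01 (fun t => f (iid j t) * g (iid k t))%R = (int01 f * int01 g)%E.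
Proof.
move=> + mf mg f0 g0; elim: j k => [|j IH] [|k]// jk.
  have mh : mf01 (fun y => g (iid k y)) by exact: mf01_comp mg (measurable_iid k).
  transitivity (int01 (fun t => f (evd t) * g (iid k (odd_digits t)))%R).
    by rewrite /int01; apply: eq_integral => x _; rewrite iidS.
  rewrite (int01_interleave (F := fun x y => f x * g (iid k y))); last 2 first.
  - apply: measurable_funM.
      exact: (measurableT_comp mf measurable_fst).
    exact: (measurableT_comp mh measurable_snd).
  - by move=> x y; exact: mulr_ge0.
  transitivity (\int[@P01 R]_x ((f x)%:E * int01 g))%E.
    apply: eq_integral => x _; rewrite int01Z//.
    by rewrite int01_iid.
  rewrite ge0_integralZr//.
  - exact: mf01E.
  - by move=> x _; rewrite lee_fin.
  - exact: int01_ge0.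
rewrite -(IH k)//.
rewrite -[RHS](int01_odd (f := fun t => f (iid j t) * g (iid k t))).
- by rewrite /int01; apply: eq_integral => x _; rewrite !iidS.
- by apply: mf01_mul; [exact: mf01_comp mf (measurable_iid j)|exact: mf01_comp mg (measurable_iid k)].
- by move=> x; exact: mulr_ge0.
Qed.

Definition sgn01 (x : R) : R := 2 * bit x - 1.

Lemma mf01_sgn : mf01 sgn01.
Proof.
apply: mf01_sub; last exact: mf01_cst.
by apply: mf01_mul; [exact: mf01_cst|exact: measurable_bit].
Qed.

Definition rademacher (j : nat) (t : R) : R := sgn01 (iid j t).

Lemma mf01_rademacher j : mf01 (rademacher j).
Proof. exact: mf01_comp mf01_sgn (measurable_iid j). Qed.

Definition radsum (a : nat -> R) (n : nat) (t : R) : R := \sum_(j < n) a j * rademacher j t.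

Lemma mf01_radsum a n : mf01 (radsum a n).
Proof.
apply: mf01_sum => j; apply: mf01_mul; [exact: mf01_cst|exact: mf01_rademacher].
Qed.

Lemma radsumS a n t :
  radsum a n.+1 t = a 0%N * sgn01 (evd t) + radsum (fun j => a j.+1) n (odd_digits t).
Proof.
rewrite /radsum big_ord_recl; congr (_ + _).
by apply: eq_bigr => j _; rewrite /rademacher lift0 iidS.
Qed.

(** Conditioning on the first sign; the two moment computations below take a shifted power for
    [H]. *)
Let int01_radsumS (H : R -> R) a n : mf01 H -> (forall x, 0 <= H x) ->
  int01 (fun t => H (radsum a n.+1 t))%R =
  ((2^-1)%:E * (int01 (fun t => H (radsum (fun j => a j.+1) n t - a 0%N))%R
   + int01 (fun t => H (radsum (fun j => a j.+1) n t + a 0%N))%R))%E.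
Proof.
move=> mH H0.
pose Y := radsum (fun j => a j.+1) n.
have mY : mf01 Y by exact: mf01_radsum.
transitivity (\int[@P01 R]_x int01 (fun y => H (a 0%N * sgn01 x + Y y))%R)%E.
  rewrite -(int01_interleave (F := fun x y => H (a 0%N * sgn01 x + Y y)))//.
    by rewrite /int01; apply: eq_integral => x _; rewrite radsumS.
  apply: (measurableT_comp mH); apply: measurable_funD.
    apply: measurable_funM => //; exact: (measurableT_comp mf01_sgn measurable_fst).
  exact: (measurableT_comp mY measurable_snd).
rewrite (@integral_bit_dbl R (fun b _ => int01 (fun y => H (a 0%N * (2 * b - 1) + Y y))%R))//; last first.
  by move=> b x; exact: int01_ge0.
rewrite !integral_P01_cst; congr (_ * (_ + _))%E; rewrite /int01;
  by apply: eq_integral => x _; congr (H _)%:E; rewrite /Y; ring.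
Qed.

Let sq (a : nat -> R) n := \sum_(j < n) a j ^+ 2.

Let sqS a n : sq a n.+1 = a 0%N ^+ 2 + sq (fun j => a j.+1) n.
Proof. by rewrite /sq big_ord_recl. Qed.

Let mX k (c : R) : mf01 (fun x => (c + x) ^+ k).
Proof.
apply: measurable_funX; apply: measurable_funD => //; exact: measurable_id.
Qed.

Lemma int01_radsum2 a n (c : R) :
  int01 (fun t => (c + radsum a n t) ^+ 2)%R = (c ^+ 2 + sq a n)%:E.
Proof.
elim: n a c => [|n IH] a c.
  rewrite /sq big_ord0 addr0 -int01_cst /int01; apply: eq_integral => x _.
  by rewrite /radsum big_ord0 addr0.
rewrite (int01_radsumS (H := fun x => (c + x) ^+ 2))//; last by move=> x; exact: sqr_ge0.
have e b : int01 (fun t => (c + (radsum (fun j => a j.+1) n t + b)) ^+ 2)%R =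
    ((c + b) ^+ 2 + sq (fun j => a j.+1) n)%:E.
  by rewrite -IH /int01; apply: eq_integral => x _; congr (_%:E); ring.
rewrite e e -EFinD -EFinM sqS; congr EFin; by field.
Qed.

(** The shift [c] makes the estimate inductive: averaged over the first sign, the bound for the
    remaining terms stays below the claim by exactly twice the fourth power of the first
    coefficient. At [c = 0] the fourth moment is at most three times the square of the second. *)
Lemma int01_radsum4 a n (c : R) :
  (int01 (fun t => (c + radsum a n t) ^+ 4)%R <=
   (c ^+ 4 + 6 * c ^+ 2 * sq a n + 3 * sq a n ^+ 2)%:E)%E.
Proof.
elim: n a c => [|n IH] a c.
  rewrite /sq big_ord0 expr0n /= !mulr0 !addr0 -int01_cst /int01.
  rewrite le_eqVlt; apply/orP; left; apply/eqP; apply: eq_integral => x _.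
  by rewrite /radsum big_ord0 addr0.
rewrite (int01_radsumS (H := fun x => (c + x) ^+ 4))//; last first.
  by move=> x; rewrite exprn_even_ge0.
have e b : (int01 (fun t => ((c + (radsum (fun j => a j.+1) n t + b)) ^+ 4)%R)%R <=
    ((c + b) ^+ 4 + 6 * (c + b) ^+ 2 * sq (fun j => a j.+1) n
      + 3 * sq (fun j => a j.+1) n ^+ 2)%:E)%E.
  rewrite (le_trans _ (IH _ _))// /int01 le_eqVlt; apply/orP; left; apply/eqP.
  by apply: eq_integral => x _; congr (_%:E); ring.
apply: le_trans (lee_wpmul2l _ (leeD (e _) (e _))) _; first by rewrite lee_fin.
rewrite -EFinD -EFinM lee_fin sqS; set s := sq _ n; set b := a 0%N.
rewrite -subr_ge0.
have -> : c ^+ 4 + 6 * c ^+ 2 * (b ^+ 2 + s) + 3 * (b ^+ 2 + s) ^+ 2 - 2^-1 * ((c - b) ^+ 4 +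
   6 * (c - b) ^+ 2 * s + 3 * s ^+ 2 + ((c + b) ^+ 4 + 6 * (c + b) ^+ 2 * s + 3 * s ^+ 2)) = 2 * (b ^+ 2) ^+ 2.
  by field.
by rewrite mulr_ge0// sqr_ge0.
Qed.

(** The parabola lies below 1 and below [y], hence below their minimum, which is at most [y ^ b]. It
    turns second and fourth moments into lower bounds for smaller moments. *)
Lemma min1_le_powR (y b : R) : 0 <= y -> 0 <= b <= 1 -> y - y ^+ 2 / 4 <= y `^ b.
Proof.
move=> y0 /andP[b0 b1]; have [y1|y1] := leP y 1.
  apply: (@le_trans _ _ y); first by rewrite gerBl divr_ge0// sqr_ge0.
  have [->|yn0] := eqVneq y 0; first exact: powR_ge0.
  by apply: ger1_powR => //; rewrite y1 lt_def yn0 y0.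
apply: (@le_trans _ _ 1); first by have := sqr_ge0 (y - 2); nra.
by rewrite -(powRr0 y); apply: ler_powR => //; exact: ltW.
Qed.

Lemma powR_le1D (y b : R) : 0 <= y -> 0 <= b <= 1 -> y `^ b <= 1 + y.
Proof.
move=> y0 /andP[b0 b1]; have [y1|y1] := leP y 1.
  apply: (@le_trans _ _ 1); last by rewrite lerDl.
  by rewrite -[leRHS](congr1 (fun f => f b) (powR1 R)); apply: ge0_ler_powR; rewrite ?nnegrE.
apply: (@le_trans _ _ y); last by rewrite lerDr.
by apply: ler1_powR => //; exact: ltW.
Qed.

Let powR_sq (x b : R) : `|x| `^ b = (x ^+ 2) `^ (b / 2).
Proof.
have -> : x ^+ 2 = `|x| `^ 2 by rewrite powR_mulrn// real_normK ?num_real.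
by rewrite -powRrM; congr (_ `^ _); field.
Qed.

(** Let X be the sum, [s] its second moment and Y = X ^ 2 / s, which has mean 1 and second moment at
    most 3. Integrating Y ^ (b / 2) <= 1 + Y gives the constant 2, and Y ^ (b / 2) >= Y - Y ^ 2 / 4
    gives 1 - 3 / 4. *)
Lemma khintchine (a : nat -> R) n (b : R) : 0 < b <= 2 ->
  ((4^-1 * (\sum_(j < n) a j ^+ 2) `^ (b / 2))%:E <= int01 (fun t => `|radsum a n t| `^ b)%R)%E /\
  (int01 (fun t => `|radsum a n t| `^ b)%R <= (2 * (\sum_(j < n) a j ^+ 2) `^ (b / 2))%:E)%E.
Proof.
move=> /andP[b0 b2]; rewrite -/(sq a n); set s := sq a n.
have hb : 0 <= b / 2 <= 1 by lra.
have s0 : 0 <= s by apply: sumr_ge0 => j _; exact: sqr_ge0.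
set I := int01 _.
have I0 : (0 <= I)%E by apply: int01_ge0 => x; exact: powR_ge0.
have mX' : mf01 (fun t => `|radsum a n t| `^ b) by apply: mf01_powR; exact: mf01_radsum.
have mX2 : mf01 (fun t => radsum a n t ^+ 2).
  by apply: measurable_funX; exact: mf01_radsum.
have mX4 : mf01 (fun t => radsum a n t ^+ 4).
  by apply: measurable_funX; exact: mf01_radsum.
have [s00|sn0] := eqVneq s 0.
  have a0 : forall j : 'I_n, a j = 0.
    move=> j; apply/eqP; rewrite -sqrf_eq0; move/eqP : s00; rewrite /s /sq.
    by rewrite psumr_eq0// => [/allP/(_ j (mem_index_enum _))//|i _]; exact: sqr_ge0.
  have -> : I = 0%E.
    transitivity (int01 (fun=> 0 : R)); last exact: int01_cst.
    rewrite /I /int01; apply: eq_integral => x _; congr EFin.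
    rewrite /radsum big1 ?normr0 ?powR0 ?gt_eqF// => j _.
    by rewrite a0 mul0r.
  by rewrite s00 powR0 ?mulr0 ?lexx// gt_eqF// divr_gt0.
have sp : 0 < s by rewrite lt_def sn0.
set S := s `^ (b / 2).
have Sp : 0 < S by exact: powR_gt0.
have E2 : int01 (fun t => radsum a n t ^+ 2)%R = s%:E.
  have := int01_radsum2 a n 0; rewrite expr0n /= add0r => <-.
  by rewrite /int01; apply: eq_integral => x _; rewrite add0r.
have E4 : (int01 (fun t => (radsum a n t ^+ 4)%R)%R <= (3 * s ^+ 2)%:E)%E.
  have := int01_radsum4 a n 0; rewrite -/s !expr0n /= mulr0 mul0r !add0r.
  apply: le_trans; rewrite /int01 le_eqVlt; apply/orP; left; apply/eqP.
  by apply: eq_integral => x _; rewrite add0r.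
have XE t : `|radsum a n t| `^ b = S * (radsum a n t ^+ 2 / s) `^ (b / 2).
  rewrite powR_sq /S -powRM//; last by rewrite divr_ge0// sqr_ge0.
  by rewrite mulrCA divff// mulr1.
have y0 t : 0 <= radsum a n t ^+ 2 / s by rewrite divr_ge0// sqr_ge0.
split; last first.
  apply: (@le_trans _ _ (int01 (fun t => S + S / s * radsum a n t ^+ 2)%R)).
    apply: int01_le => //.
    - apply: mf01_add; first exact: mf01_cst.
      by apply: mf01_mul => //; exact: mf01_cst.
    - move=> t; rewrite XE -mulrA [s^-1 * _]mulrC -{2}[S]mulr1 -mulrDr ler_pM2l//.
      exact: powR_le1D.
  rewrite int01D//; last 4 first.
  - exact: mf01_cst.
  - by apply: mf01_mul => //; exact: mf01_cst.
  - by move=> _; exact: ltW.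
  - by move=> t; rewrite mulr_ge0 ?sqr_ge0// divr_ge0// ltW.
  rewrite int01_cst int01Z; [|exact: mX2|by move=> x; exact: sqr_ge0|by rewrite divr_ge0// ltW].
  by rewrite E2 -EFinM -EFinD lee_fin divfK// mulr2n mulrDl mul1r.
move: I0; rewrite /I; case EI : (int01 _) => [i|//|//] _; last by rewrite leey.
have : (int01 (fun t => radsum a n t ^+ 2)%R <=
   int01 (fun t => s / S * `|radsum a n t| `^ b + (4 * s)^-1 * radsum a n t ^+ 4)%R)%E.
  apply: int01_le => //.
  - apply: mf01_add; apply: mf01_mul => //; exact: mf01_cst.
  - by move=> x; exact: sqr_ge0.
  - move=> t; rewrite XE mulrA divfK ?gt_eqF//.
    have := min1_le_powR (y0 t) hb; set y := radsum a n t.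
    set z := (_ `^ _) => h.
    have {}h : s * (y ^+ 2 / s - (y ^+ 2 / s) ^+ 2 / 4) <= s * z by rewrite ler_pM2l.
    have e : s * (y ^+ 2 / s - (y ^+ 2 / s) ^+ 2 / 4) = y ^+ 2 - (4 * s)^-1 * y ^+ 4.
      by field; rewrite gt_eqF.
    lra.
rewrite int01D//; last 4 first.
- by apply: mf01_mul => //; exact: mf01_cst.
- by apply: mf01_mul => //; exact: mf01_cst.
- by move=> t; rewrite mulr_ge0 ?powR_ge0// divr_ge0// ltW.
- by move=> t; rewrite mulr_ge0 ?exprn_even_ge0// invr_ge0 mulr_ge0// ltW.
rewrite int01Z; [|exact: mX'|by move=> x; exact: powR_ge0|by rewrite divr_ge0// ltW].
rewrite int01Z; [|exact: mX4|by move=> x; rewrite exprn_even_ge0|by rewrite invr_ge0 mulr_ge0// ltW].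
rewrite EI E2 => h.
have {}h := le_trans h (leeD2l _ (lee_wpmul2l _ E4)).
have {h} : (s%:E <= (s / S)%:E * i%:E + ((4 * s)^-1)%:E * (3 * s ^+ 2)%:E)%E.
  by apply: h; rewrite lee_fin invr_ge0 mulr_ge0// ltW.
rewrite -!EFinM -EFinD !lee_fin => h.
have : s / 4 <= s / S * i.
  have e : (4 * s)^-1 * (3 * s ^+ 2) = 3 / 4 * s by field.
  by rewrite e in h; lra.
rewrite [s / S * i]mulrAC -mulrA ler_pM2l// ler_pdivlMr//.
Qed.

End rademacher.

(** * Completeness of L_b for positive exponents *)

Section riesz_fischer.
Context {R : realType}.

(** A substitute for the triangle inequality that serves exponents below and above 1 alike: the sum
    is at most three times the largest term, and [9 = 3 ^ 2] bounds [3 ^ b]. *)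
Lemma norm_powRD3 (x y z b : R) : 0 <= b <= 2 ->
  `|x + y + z| `^ b <= 9 * (`|x| `^ b + `|y| `^ b + `|z| `^ b).
Proof.
move=> /andP[b0 b2].
pose m : R := Num.max (Num.max `|x| `|y|) `|z|.
have xm : `|x| <= m by rewrite /m !le_max lexx.
have ym : `|y| <= m by rewrite /m !le_max lexx orbT.
have zm : `|z| <= m by rewrite /m !le_max lexx !orbT.
have m0 : 0 <= m by exact: le_trans xm.
have h1 : `|x + y + z| `^ b <= (3 * m) `^ b.
  apply: ge0_ler_powR; rewrite ?nnegrE ?mulr_ge0//.
  by have := ler_normD (x + y) z; have := ler_normD x y; lra.
apply: (le_trans h1); rewrite powRM//.
have h2 : (3 : R) `^ b <= 9.
  have -> : (9 : R) = 3 `^ 2 by rewrite powR_mulrn//; ring.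
  by apply: ler_powR => //; lra.
apply: ler_pM; rewrite ?powR_ge0//.
have hx := powR_ge0 `|x| b; have hy := powR_ge0 `|y| b; have hz := powR_ge0 `|z| b.
rewrite /m /Num.max; case: ifP => _; [lra|case: ifP => _; lra].
Qed.

Lemma cvg_norm_powR (T : Type) (F : set_system T) (FF : Filter F) (u : T -> R) (l b : R) :
  0 < b -> u @ F --> l -> (fun x => `|u x| `^ b) @ F --> `|l| `^ b.
Proof.
move=> b0 ul; have [l0|l0] := eqVneq l 0; last first.
  apply: (@cvg_comp _ _ _ (fun x => `|u x|) (fun y => y `^ b) _ (nbhs `|l|)).
    exact: cvg_norm ul.
  have : {for `|l|, continuous (fun y => y `^ b)} => //.
  apply: differentiable_continuous; apply/derivable1_diffP; apply: derivable_powR.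
  by rewrite in_itv /= andbT normr_gt0.
rewrite l0 in ul *; rewrite normr0 powR0 ?gt_eqF//; apply/cvgrPdist_lt => e e0.
have eb : 0 < e `^ b^-1 by exact: powR_gt0.
move/cvgrPdist_lt : ul => /(_ _ eb); apply: filterS => x.
rewrite !sub0r !normrN norm_powR// normr_id => h.
rewrite -[ltRHS](powRr1 (ltW e0)) -(@mulVf _ b) ?gt_eqF// powRrM.
by apply: gt0_ltr_powR; rewrite ?nnegrE ?powR_ge0.
Qed.

Lemma sum_half_pow (n : nat) : \sum_(k < n) (2 : R)^-1 ^+ k <= 2.
Proof.
suff -> : \sum_(k < n) (2 : R)^-1 ^+ k = 2 - 2 * 2^-1 ^+ n.
  by rewrite gerBl mulr_ge0// exprn_ge0// invr_ge0.
elim: n => [|n IH]; first by rewrite big_ord0 expr0; ring.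
by rewrite big_ord_recr /= IH exprS; field.
Qed.

(** The argument of Riesz and Fischer for [|.| ^ b]: a rapidly Cauchy subsequence converges almost
    everywhere, and Fatou's lemma controls the distance to its limit. *)
Lemma int01_cauchy_cvg (F : nat -> R -> R) (b : R) : 0 < b ->
  (forall n, mf01 (F n)) ->
  (forall e : R, 0 < e -> exists N, forall m n, (N <= m)%N -> (N <= n)%N ->
     (int01 (fun x => `|F m x - F n x| `^ b)%R <= e%:E)%E) ->
  exists2 G : R -> R, mf01 G &
  forall e : R, 0 < e -> exists N, forall n, (N <= n)%N ->
     (int01 (fun x => `|G x - F n x| `^ b)%R <= e%:E)%E.
Proof.
move=> b0 mF FC.
have q0 k : 0 < (4 : R)^-1 ^+ k by rewrite exprn_gt0.
pose N k := projT1 (cid (FC _ (q0 k))).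
have NP k : forall m n, (N k <= m)%N -> (N k <= n)%N ->
    (int01 (fun x => `|F m x - F n x| `^ b)%R <= ((4 : R)^-1 ^+ k)%:E)%E.
  exact: (projT2 (cid (FC _ (q0 k)))).
(* Adding [k] makes the subsequence pass every threshold, as the final Fatou argument requires. *)
pose M k := (\sum_(i < k.+1) N i + k)%N.
have NM k : (N k <= M k)%N by rewrite /M big_ord_recr /= addnAC leq_addl.
have MS k : (M k <= M k.+1)%N by rewrite /M [in leqRHS]big_ord_recr /= leq_add// leq_addr.
pose H k := F (M k).
have HC k : (int01 (fun x => `|H k.+1 x - H k x| `^ b)%R <= ((4 : R)^-1 ^+ k)%:E)%E.
  by apply: NP => //; exact: leq_trans (NM k) (MS k).
(* Increments of size [4 ^ - k] against weights [2 ^ k] leave a convergent series of integrals.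
   Where [W] is finite, the increments of [H] decay geometrically. *)
pose W x := (\sum_(k <oo) (2 ^+ k * `|H k.+1 x - H k x| `^ b)%:E)%E.
have W0 n x : (0 <= (2 ^+ n * `|H n.+1 x - H n x| `^ b)%:E)%E.
  by rewrite lee_fin mulr_ge0// ?exprn_ge0// powR_ge0.
have mD k : mf01 (fun x => 2 ^+ k * `|H k.+1 x - H k x| `^ b).
  by apply: mf01_mul; [exact: mf01_cst|apply: mf01_powR; apply: mf01_sub; exact: mF].
have mW : measurable_fun setT (W : measurableTypeR R -> \bar R).
  apply: ge0_emeasurable_sum => [k x _ _|k _]; first exact: W0.
  exact: mf01E.
have IW : (\int[@P01 R]_x W x <= 2%:E)%E.
  rewrite /W integral_nneseries//; last by move=> k; exact: mf01E.
  apply: lime_le.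
    by apply: is_cvg_nneseries => n _ _; apply: integral_ge0 => x _; exact: W0.
  apply: nearW => n; rewrite big_mkord.
  apply: (@le_trans _ _ (\sum_(k < n) (((2 : R)^-1 ^+ k)%:E))%E); last first.
    by rewrite sumEFin lee_fin; exact: sum_half_pow.
  apply: lee_sum => k _.
  rewrite -/(int01 (fun x => 2 ^+ k * `|H k.+1 x - H k x| `^ b)%R) int01Z; [|
    by apply: mf01_powR; apply: mf01_sub; exact: mF|by move=> x; exact: powR_ge0|exact: exprn_ge0].
  apply: le_trans (lee_wpmul2l _ (HC k)) _; first by rewrite lee_fin exprn_ge0.
  rewrite -EFinM lee_fin -exprMn.
  by rewrite (_ : 2 * 4^-1 = 2^-1 :> R)//; field.
pose E := [set x | W x < +oo]%E.
have mE : measurable (E : set (measurableTypeR R)).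
  have -> : E = W @^-1` [set y | y < +oo]%E by [].
  rewrite -[X in measurable X]setTI; apply: mW => //.
  have -> : [set y : \bar R | y < +oo]%E = ~` [set +oo%E].
    by apply/seteqP; split => y /=; rewrite ltey => /eqP.
  by apply: measurableC; exact: emeasurable_set1.
have WE0 x : (0 <= W x)%E by apply: nneseries_ge0 => n _ _; exact: W0.
have aeE : {ae @P01 R, forall x, E x}.
  have iW : (@P01 R).-integrable setT W.
    apply/integrableP; split => //.
    under eq_integral do rewrite gee0_abs//.
    by apply: le_lt_trans IW _; rewrite ltry.
  have := integrable_ae measurableT iW => -[Z [mZ Z0 sZ]]; exists Z; split => //.
  apply: subset_trans sZ; apply: subsetC => x /= /(_ Logic.I).
  by rewrite ge0_fin_numE.
(* Setting the functions to 0 off [E] makes them converge at every point, so that the limit is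
   measurable. *)
pose H' k x := H k x * \1_E x.
have mH' k : mf01 (H' k).
  by apply: mf01_mul; [exact: mF|exact: measurable_indic].
have cH x : cvgn (H' ^~ x).
  have [xE|xE] := pselect (E x); last first.
    have -> : H' ^~ x = (fun=> 0).
      by apply/funext => k; rewrite /H' indicE memNset// mulr0.
    exact: is_cvg_cst.
  have -> : H' ^~ x = H ^~ x.
    by apply/funext => k; rewrite /H' indicE mem_set// mulr1.
  pose d k := H k.+1 x - H k x.
  have Wfin : W x \is a fin_num by rewrite ge0_fin_numE.
  set w := fine (W x).
  have dw k : 2 ^+ k * `|d k| `^ b <= w.
    rewrite -lee_fin /w fineK// /W.
    apply: (@le_trans _ _ (\sum_(0 <= i < k.+1) (2 ^+ i * `|H i.+1 x - H i x| `^ b)%:E)%E).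
      rewrite big_nat_recr//= leeDr// sume_ge0// => i _; exact: W0.
    by apply: nneseries_lim_ge => i _ _; exact: W0.
  have w0 : 0 <= w by rewrite /w fine_ge0.
  have bn0 : b != 0 by rewrite gt_eqF.
  pose rho := (2 : R)^-1 `^ b^-1.
  have rho01 : 0 <= rho < 1.
    rewrite powR_ge0 /=.
    have -> : (1 : R) = 1 `^ b^-1 by rewrite (congr1 (fun f => f b^-1) (powR1 R)).
    by apply: gt0_ltr_powR; rewrite ?nnegrE ?invr_gt0//; lra.
  have db k : `|d k| <= geometric (w `^ b^-1) rho k.
    have -> : geometric (w `^ b^-1) rho k = (w * 2^-1 ^+ k) `^ b^-1.
      rewrite powRM ?exprn_ge0 ?invr_ge0//=; congr (_ * _).
      have h2 : (0 : R) <= 2^-1 by rewrite invr_ge0.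
      by rewrite /rho -(powR_mulrn k (powR_ge0 _ _)) -(powR_mulrn k h2) powRAC.
    have -> : `|d k| = (`|d k| `^ b) `^ b^-1 by rewrite -powRrM mulfV// powRr1.
    apply: ge0_ler_powR; rewrite ?nnegrE ?powR_ge0 ?invr_ge0 ?(ltW b0)//.
      by rewrite mulr_ge0// exprn_ge0// invr_ge0.
    rewrite exprVn mulrC -ler_pdivrMl ?invr_gt0 ?exprn_gt0// invrK.
    exact: dw.
  have cd : cvgn (series d).
    apply: normed_cvg; apply: (series_le_cvg _ _ db) => //.
    - by move=> n; rewrite /= mulr_ge0 ?powR_ge0// exprn_ge0// powR_ge0.
    - by apply: is_cvg_geometric_series; rewrite ger0_norm; case/andP: rho01.
  have -> : H ^~ x = (fun k => H 0%N x + series d k).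
    apply/funext => k; rewrite seriesEnat /= /d telescope_sumr//.
    by rewrite addrC subrK.
  by apply: is_cvgD => //; exact: is_cvg_cst.
exists (fun x => limn (H' ^~ x)).
  by apply: (measurable_fun_cvg (h := H')) => // x _; exact: cH.
move=> e e0; have [K FK] := FC e e0; exists K => n Kn.
pose f k x := (`|H' k x - F n x| `^ b)%:E.
have mf k : measurable_fun setT (f k : measurableTypeR R -> \bar R).
  by apply: mf01E; apply: mf01_powR; apply: mf01_sub.
have f0 k x : setT x -> (0 <= f k x)%E by move=> _; rewrite lee_fin powR_ge0.
have fE x : limn_einf (f ^~ x) = (`|limn (H' ^~ x) - F n x| `^ b)%:E.
  have [] // := @cvg_limn_einf_sup R (f ^~ x) (`|limn (H' ^~ x) - F n x| `^ b)%:E.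
  apply: cvg_EFin; first exact: nearW.
  apply: cvg_norm_powR => //.
  by apply: cvgB; [exact: cH|exact: cvg_cst].
have -> : int01 (fun x => `|limn (H' ^~ x) - F n x| `^ b)%R = (\int[@P01 R]_x limn_einf (f ^~ x))%E.
  by rewrite /int01; apply: eq_integral => x _; rewrite fE.
apply: (@le_trans _ _ (limn_einf (fun k => \int[@P01 R]_x f k x)%E)).
  by apply: fatou.
rewrite limn_einf_lim; apply: lime_le; first exact: is_cvg_einfs.
apply: nearW => k; apply: (@le_trans _ _ (\int[@P01 R]_x f (maxn k K) x)%E).
  by apply: ereal_inf_lbound; exists (maxn k K) => //=; exact: leq_maxl.
rewrite -[X in (X <= _)%E]/(int01 (fun x => `|H' (maxn k K) x - F n x| `^ b)%R).
rewrite (@int01_ae _ _ (fun x => `|H (maxn k K) x - F n x| `^ b)) //.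
- by apply: FK => //; rewrite /M; apply: leq_trans (leq_addl _ _); exact: leq_maxr.
- by apply: mf01_powR; apply: mf01_sub.
- by apply: mf01_powR; apply: mf01_sub; exact: mF.
- case: aeE => Z [mZ Z0 sZ]; exists Z; split => //; apply: subset_trans sZ.
  apply: subsetC => x /= xE; by rewrite /H' indicE mem_set// mulr1.
Qed.

End riesz_fischer.

(** * Snowflakes of the line *)

Section snowflake.
Context {R : realType}.

(** Up to sign, [y] will be the binary logarithm of a size and [k] a dyadic scale; what matters is
    that the bound does not depend on the size. *)
Lemma two_sided_geometric (rho y : R) (m : nat) : 0 < rho < 1 ->
  \sum_(k < m) rho `^ `|k%:R + y| <= 2 / (1 - rho).
Proof.
move=> /andP[r0 r1].
have d0 : 0 < 1 - rho by lra.
(* the summand is dominated by the increments of a bounded nondecreasing function *)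
pose Phi x := if x <= 0 then rho `^ (- x) / (1 - rho) else (2 - rho `^ x) / (1 - rho).
have rle (x : R) : 0 <= x -> rho `^ x <= 1.
  by move=> x0; rewrite -(powRr0 rho); apply: ger_powR => //; rewrite r0 ltW.
have PhiB x : 0 <= Phi x <= 2 / (1 - rho).
  rewrite /Phi; case: ifPn => [x0|]; last rewrite -ltNge => x0.
    have h := rle (- x); have h' := powR_ge0 rho (- x).
    rewrite divr_ge0//; last lra.
    by rewrite ler_pM2r ?invr_gt0//; apply: (@le_trans _ _ 1); [apply: h; lra|lra].
  have h := rle x; have h' := powR_ge0 rho x.
  rewrite divr_ge0//; [|by have := h (ltW x0); lra|by lra].
  by rewrite ler_pM2r ?invr_gt0//; lra.
have rn0 : rho != 0 by rewrite gt_eqF.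
have PhiS x : rho `^ `|x| <= Phi (x + 1) - Phi x.
  have [x1|x1] := leP (x + 1) 0.
    have x0 : x <= 0 by lra.
    rewrite /Phi x1 x0 ler0_norm// -mulrBl ler_pdivlMr//.
    have -> : rho `^ (- x) = rho `^ (- (x + 1)) * rho.
      by rewrite -{3}(powRr1 (ltW r0)) -powRD; [congr (_ `^ _); ring|rewrite rn0 implybT].
    have h := rle (- (x + 1)); have h' := powR_ge0 rho (- (x + 1)).
    set p := _ `^ _ in h h' *; have {}h : p <= 1 by apply: h; lra.
    rewrite -mulrA -[X in _ <= X - _]mulr1 -mulrBr ler_wpM2l//.
    by nra.
  have [x0|x0] := leP x 0; last first.
    rewrite /Phi (leNgt _ 0) (leNgt _ 0) x1 x0 /= gtr0_norm// -mulrBl ler_pdivlMr//.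
    have -> : rho `^ (x + 1) = rho `^ x * rho.
      by rewrite -{3}(powRr1 (ltW r0)) -powRD// rn0 implybT.
    by have h' := powR_ge0 rho x; lra.
  rewrite /Phi x0 (leNgt _ 0) x1 /= ler0_norm// -mulrBl ler_pdivlMr//.
  set p := rho `^ (- x).
  have p0 : 0 < p by exact: powR_gt0.
  have p1 : p <= 1 by apply: rle; lra.
  have pr : rho <= p.
    by rewrite -{1}(powRr1 (ltW r0)) /p; apply: ger_powR; [rewrite r0 ltW|lra].
  have e : rho `^ (x + 1) * p = rho.
    by rewrite /p -powRD ?rn0 ?implybT// addrAC subrr add0r powRr1// ltW.
  rewrite -(ler_pM2r p0) !mulrBl -addrA -opprD e.
  have h1 : 0 <= (2 - rho) * p - rho by nra.
  have h2 : 0 <= 1 - p by lra.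
  by have := mulr_ge0 h2 h1; nra.
apply: (@le_trans _ _ (Phi (m%:R + y) - Phi y)); last first.
  by have /andP[? ?] := PhiB (m%:R + y); have /andP[? ?] := PhiB y; lra.
elim: m => [|m IH]; first by rewrite big_ord0 add0r subrr.
rewrite big_ord_recr /=; have := PhiS (m%:R + y).
have -> : m%:R + y + 1 = m.+1%:R + y by rewrite -natr1; ring.
by lra.
Qed.

Lemma cos_sin_dist (x y : R) :
  (cos x - cos y) ^+ 2 + (sin x - sin y) ^+ 2 = 2 - 2 * cos (x - y).
Proof.
rewrite cosB; have := cos2Dsin2 x; have := cos2Dsin2 y; nra.
Qed.

Lemma trig_lip (f df : R -> R) : (forall x : R, is_derive x (1 : R) f (df x)) ->
  (forall x, `|df x| <= 1) -> forall x y, `|f x - f y| <= `|x - y|.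
Proof.
move=> fd df1.
have main x y : x < y -> `|f x - f y| <= `|x - y|.
  move=> xy; have fc : {within `[x, y], continuous f}.
    by apply: derivable_within_continuous => z _; case: (fd z).
  have [z _ e] := MVT xy (fun z _ => fd z) fc.
  by rewrite distrC e normrM (distrC x) ler_piMl.
move=> x y; have [xy|xy|->] := ltgtP x y; [exact: main| |by rewrite !subrr].
by rewrite distrC (distrC x); exact: main.
Qed.

Let log2 (d : R) : R := ln d / ln 2.

Let ln2 : 0 < ln (2 : R).
Proof. by apply: ln_gt0; lra. Qed.

Let pow_log2 d : 0 < d -> 2 `^ log2 d = d.
Proof.
move=> d0; rewrite /powR gt_eqF// /log2 divfK ?gt_eqF//.
by rewrite lnK// posrE.
Qed.

Lemma nneseries_term_le (u : nat -> R) k : (forall n, 0 <= u n) ->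
  ((u k)%:E <= \sum_(n <oo) (u n)%:E)%E.
Proof.
move=> u0; apply: (@le_trans _ _ (\sum_(0 <= i < k.+1) (u i)%:E)%E).
  by rewrite big_nat_recr//= leeDr// sume_ge0// => i _; rewrite lee_fin.
by apply: nneseries_lim_ge => i _ _; rewrite lee_fin.
Qed.

Lemma nneseries_partial_le (u : nat -> R) (C : R) : (forall n, 0 <= u n) ->
  (forall n, \sum_(k < n) u k <= C) -> (\sum_(n <oo) (u n)%:E <= C%:E)%E.
Proof.
move=> u0 h; apply: lime_le.
  by apply: is_cvg_nneseries => n _ _; rewrite lee_fin.
by apply: nearW => n; rewrite big_mkord sumEFin lee_fin.
Qed.

Let sum4 (g : nat -> R) M : \sum_(n < 4 * M) g (n %/ 4)%N = 4 * \sum_(k < M) g k.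
Proof.
elim: M => [|M IH]; first by rewrite muln0 !big_ord0 mulr0.
rewrite mulnS addnC 4!addnS addn0 5!big_ord_recr /= IH.
have e j : (j < 4)%N -> ((4 * M + j) %/ 4 = M)%N.
  by move=> j4; rewrite mulnC divnMDl// divn_small// addn0.
have := e 0%N isT; have := e 1%N isT; have := e 2%N isT; have := e 3%N isT.
rewrite addn0 addn1 addn2 addn3 => -> -> -> ->; ring.
Qed.

Let trig (n : nat) : R -> R := if odd n then @sin R else @cos R.

Let trig_dist_lip n x y : `|trig n x - trig n y| <= `|x - y|.
Proof.
rewrite /trig; case: odd.
  exact: (trig_lip (fun z => is_derive_sin z) (@cos_max R)).
apply: (trig_lip (fun z => is_derive_cos z)).
by move=> z; rewrite normrN sin_max.
Qed.

Let trig_dist2 n x y : `|trig n x - trig n y| <= 2.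
Proof.
apply: le_trans (ler_normB _ _) _; rewrite /trig.
by case: odd; [have := sin_max x; have := sin_max y|have := cos_max x; have := cos_max y]; lra.
Qed.

Let mtrig n : mf01 (trig n).
Proof.
by rewrite /trig; case: odd; apply: continuous_measurable_fun;
  [exact: continuous_sin|exact: continuous_cos].
Qed.

(** The four indices of the block [j = n %/ 4] carry cosine and sine at the scale [2 ^ j], then
    cosine and sine at the scale [2 ^ - j]: one sequence runs through the dyadic scales in both
    directions. *)
Let expo (n : nat) : R := if (n %% 4 < 2)%N then (n %/ 4)%:R else - (n %/ 4)%:R.

Lemma normBZ_powR (k u w s : R) : 0 <= k ->
  `|k * u - k * w| `^ s = k `^ s * `|u - w| `^ s.
Proof. by move=> k0; rewrite -mulrBr normrM (ger0_norm k0) powRM. Qed.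

(** Let d be the distance of the two points and [2 ^ t] the product of a scale with d. The term of
    that scale is at most a multiple of [d ^ b * 2 ^ (- b t)] for t >= 0, where boundedness of the
    trigonometric functions is used, and of [d ^ b * 2 ^ ((s - b) t)] for t < 0, where their
    Lipschitz bound is. Both decay when 0 < b < s; for b = s the identity in one coordinate
    serves. *)
Lemma snowflake (b s : R) : 0 < b -> b <= s -> 1 <= s -> s <= 2 ->
  exists v : nat -> R -> R, (forall n, mf01 (v n)) /\
  exists c C : R, [/\ 0 < c, 0 < C & forall x y,
    ((c * `|x - y| `^ b)%:E <= \sum_(n <oo) (`|v n x - v n y| `^ s)%:E)%E /\
    (\sum_(n <oo) (`|v n x - v n y| `^ s)%:E <= (C * `|x - y| `^ b)%:E)%E].
Proof.
move=> b0 bs s1 s2.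
have s0 : 0 < s by lra.
move: bs; rewrite le_eqVlt => /orP[/eqP <-|bs].
  exists (fun n x => if n == 0%N then x else 0); split.
    by move=> [|n] /=; [exact: measurable_id|exact: mf01_cst].
  exists 1, 1; split=> // x y; rewrite mul1r; split.
    have := @nneseries_term_le (fun n => `|(if n == 0%N then x else 0) - (if n == 0%N then y else 0)| `^ b) 0%N.
    by apply => n; exact: powR_ge0.
  apply: nneseries_partial_le => [n|n]; first exact: powR_ge0.
  case: n => [|n]; first by rewrite big_ord0 powR_ge0.
  by rewrite big_ord_recl /= big1 ?addr0// => i _; rewrite subrr normr0 powR0// gt_eqF.
pose sc n := (2 : R) `^ expo n.
have sc0 n : 0 < sc n by exact: powR_gt0.
pose v n x := sc n `^ (- (b / s)) * trig n (sc n * x).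
have vE n x y : `|v n x - v n y| `^ s = sc n `^ (- b) * `|trig n (sc n * x) - trig n (sc n * y)| `^ s.
  rewrite /v (normBZ_powR _ _ _ (powR_ge0 _ _)) -powRrM.
  have -> : - (b / s) * s = - b by rewrite mulNr divfK// gt_eqF.
  by [].
exists v; split.
  move=> n; apply: mf01_mul; first exact: mf01_cst.
  apply: (mf01_comp (f := trig n)); first exact: mtrig.
  by apply: mf01_mul; [exact: mf01_cst|exact: measurable_id].
pose g := Num.min b (s - b).
have g0 : 0 < g by rewrite lt_min b0 subr_gt0.
pose rho := (2 : R) `^ (- g).
have rho01 : 0 < rho < 1.
  apply/andP; split; first exact: powR_gt0.
  have p1 : 1 < (2 : R) `^ g by rewrite /powR gt_eqF// expR_gt1 mulr_gt0.
  by rewrite /rho powRN invf_lt1// (lt_trans _ p1).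
pose kappa := 2 - 2 * cos (1 : R).
have kappa0 : 0 < kappa.
  rewrite /kappa subr_gt0 gtr_pMr// -[ltRHS]cos0 ltr_cos// in_itv/=.
    by have := pi_ge2 R; lra.
  by have := pi_ge2 R; lra.
(* At the scale with 0 <= t <= 1, the squared chord of the cosine-sine pair is at least [kappa], so
   one of the two squares is at least [kappa / 2], and [2 ^ (- b t) >= 2 ^ (- b)]. In [C], 16 is the
   bound 4 for [2 ^ s] times the four terms of a block. *)
pose c := 2 `^ (- b) * (kappa / 2) `^ (s / 2).
pose C := 16 * (4 / (1 - rho)).
have c0 : 0 < c by rewrite mulr_gt0// powR_gt0// divr_gt0.
have C0 : 0 < C by rewrite !mulr_gt0// invr_gt0; lra.
exists c, C; split => // x y.
have [->|xy] := eqVneq x y.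
  rewrite subrr normr0 powR0 ?gt_eqF// !mulr0; split.
    by apply: nneseries_ge0 => n _ _; rewrite lee_fin powR_ge0.
  apply: nneseries_partial_le => [n|n]; first exact: powR_ge0.
  by rewrite big1// => i _; rewrite subrr normr0 powR0// gt_eqF.
set d := `|x - y|.
have d0 : 0 < d by rewrite normr_gt0 subr_eq0.
pose z := log2 d.
have dz : d = 2 `^ z by rewrite pow_log2.
have scd n : sc n * d = 2 `^ (expo n + z).
  by rewrite dz /sc -powRD//; apply/implyP.
have dist n : `|sc n * x - sc n * y| = 2 `^ (expo n + z).
  by rewrite -mulrBr normrM gtr0_norm// scd.
have scb n : sc n `^ (- b) = d `^ b * 2 `^ (- b * (expo n + z)).
  rewrite dz /sc -!powRrM -powRD; first by congr (_ `^ _); ring.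
  by apply/implyP.
split.
  (* choose the scale for which the rescaled distance lies in [1, 2[ *)
  have [k [k1 k2 kk]] : exists k, [/\ 0 <= expo k + z, expo k + z <= 1 &
      expo k.+1 = expo k /\ ~~ odd k].
    have [f1 f2] : (Num.floor z)%:~R <= z /\ z < (Num.floor z + 1)%:~R.
      by have /andP[] := real_floor_itv (num_real z).
    have expoE j i : (i < 4)%N -> expo (4 * j + i)%N = if (i < 2)%N then j%:R else - j%:R.
      by move=> i4; rewrite /expo mulnC modnMDl divnMDl// modn_small// divn_small// addn0.
    have e02 j : expo (4 * j)%N = j%:R /\ expo (4 * j).+1 = j%:R.
      by have := expoE j 0%N isT; have := expoE j 1%N isT; rewrite addn0 addn1 /= => -> ->.
    have e24 j : expo (4 * j + 2)%N = - j%:R /\ expo (4 * j + 2).+1 = - j%:R.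
      by have := expoE j 2%N isT; have := expoE j 3%N isT; rewrite -addnS /= => -> ->.
    rewrite rmorphD /= in f2.
    case: (intP (Num.floor z)) f1 f2 => [|n|n] f1 f2.
    - exists 0%N; have [h1 h2] := e02 0%N; rewrite muln0 in h1 h2.
      by rewrite h1 h2; split => //; rewrite add0r; [exact: f1|move: f2; rewrite add0r; exact: ltW].
    - exists (4 * n.+1 + 2)%N; have [-> ->] := e24 n.+1; split.
      + by move: f1; rewrite -pmulrn; lra.
      + by move: f2; rewrite -pmulrn; lra.
      + by rewrite oddD oddM.
    - exists (4 * n.+1)%N; have [-> ->] := e02 n.+1; split.
      + by move: f1; rewrite mulrNz -pmulrn; lra.
      + by move: f2; rewrite mulrNz -pmulrn; lra.
      + by rewrite oddM.
  case: kk => kS kodd.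
  have scS : sc k.+1 = sc k by rewrite /sc kS.
  set u := 2 `^ (expo k + z).
  have u1 : 1 <= u by rewrite -(powRr0 (2 : R)); apply: ler_powR; lra.
  have u2 : u <= 2 by rewrite -[leRHS](powRr1 (ltW (ltr0Sn _ _))); apply: ler_powR; lra.
  have cd : (trig k (sc k * x) - trig k (sc k * y)) ^+ 2 +
     (trig k.+1 (sc k.+1 * x) - trig k.+1 (sc k.+1 * y)) ^+ 2 >= kappa.
    rewrite scS /trig /= (negbTE kodd) /= cos_sin_dist /kappa lerD2l lerN2 ler_pM2l//.
    rewrite -cos_norm dist -/u le_eqVlt; have [->|u1'] := eqVneq u 1; first by rewrite eqxx.
    apply/orP; right; rewrite ltr_cos ?in_itv/=; last 2 first.
    - by have := pi_ge2 R; lra.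
    - by have := pi_ge2 R; lra.
    - by rewrite lt_def u1' u1.
  have term n : sc n = sc k -> kappa / 2 <= (trig n (sc n * x) - trig n (sc n * y)) ^+ 2 ->
      ((c * d `^ b)%:E <= \sum_(n <oo) (`|v n x - v n y| `^ s)%:E)%E.
    move=> scn h; apply: (@le_trans _ _ (`|v n x - v n y| `^ s)%:E); last first.
      by apply: (@nneseries_term_le (fun n => `|v n x - v n y| `^ s)) => j; exact: powR_ge0.
    rewrite lee_fin vE scn scb /c [d `^ b * _]mulrC mulrAC -!mulrA.
    apply: ler_pM.
    - exact: powR_ge0.
    - by rewrite mulr_ge0 ?powR_ge0.
    - by apply: ler_powR; [lra|nra].
    - rewrite ler_wpM2l ?powR_ge0//.
      rewrite scn in h; set D := trig n _ - _ in h *.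
      have -> : `|D| `^ s = (D ^+ 2) `^ (s / 2).
        rewrite -real_normK ?num_real// -powR_mulrn// -powRrM.
        by congr (_ `^ _); field.
      apply: ge0_ler_powR => //; rewrite ?nnegrE ?sqr_ge0//; first by lra.
      by rewrite divr_ge0// ltW.
  have [h|h] := leP (kappa / 2) ((trig k (sc k * x) - trig k (sc k * y)) ^+ 2).
    exact: (term k).
  by apply: (term k.+1) => //; lra.
apply: nneseries_partial_le => [n|n]; first exact: powR_ge0.
(* Extending the range to whole blocks of four allows [sum4] to collect them. *)
apply: (@le_trans _ _ (\sum_(k < 4 * n) `|v k x - v k y| `^ s)).
  rewrite (big_ord_widen _ (fun k => `|v k x - v k y| `^ s) (_ : n <= 4 * n)%N); last first.
    by rewrite leq_pmull.
  by rewrite big_mkcond /=; apply: ler_sum => k _; case: ifP => // _; rewrite powR_ge0.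
pose h k := 4 * d `^ b * (rho `^ `|k%:R + z| + rho `^ `|k%:R + (- z)|).
apply: (@le_trans _ _ (\sum_(k < 4 * n) h (k %/ 4)%N)).
  apply: ler_sum => k _; rewrite vE scb /h.
  rewrite -mulrA [4 * _]mulrC -mulrA ler_wpM2l ?powR_ge0//.
  have -> : rho `^ `|(k %/ 4)%:R + z| + rho `^ `|(k %/ 4)%:R + - z| =
     rho `^ `|expo k + z| + rho `^ `|expo k - z|.
    rewrite /expo; case: ifP => // _; rewrite addrC; congr (_ `^ _ + _ `^ _).
      by rewrite -normrN; congr `|_|; ring.
    by rewrite -normrN; congr `|_|; ring.
  apply: (@le_trans _ _ (4 * rho `^ `|expo k + z|)); last first.
    by rewrite ler_pM2l// lerDl powR_ge0.
  set t := expo k + z; set T : R := `|_ - _|.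
  pose mn : R := if 0 <= t then 1 else 2 `^ t.
  have mn0 : 0 <= mn by rewrite /mn; case: ifP => // _; exact: powR_ge0.
  have T2 : T <= 2 * mn.
    rewrite /mn; case: ifP => _; first by rewrite mulr1; exact: trig_dist2.
    apply: (@le_trans _ _ (2 `^ t)); first by rewrite -dist; exact: trig_dist_lip.
    by have := powR_ge0 (2 : R) t; lra.
  have T2s : T `^ s <= 4 * mn `^ s.
    apply: (@le_trans _ _ ((2 * mn) `^ s)).
      apply: ge0_ler_powR; rewrite ?nnegrE ?mulr_ge0//; first exact: ltW.
      exact: normr_ge0.
    rewrite powRM// ler_wpM2r ?powR_ge0//.
    have -> : (4 : R) = 2 `^ 2 by rewrite powR_mulrn//; ring.
    by apply: ler_powR => //; lra.
  apply: (@le_trans _ _ (2 `^ (- b * t) * (4 * mn `^ s))).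
    by rewrite ler_wpM2l ?powR_ge0.
  rewrite mulrCA ler_pM2l// /rho -powRrM /mn.
  have [t0|t0] := leP 0 t.
    rewrite (congr1 (fun f => f s) (powR1 R)) mulr1; apply: ler_powR; first lra.
    rewrite ger0_norm// !mulNr lerN2 ler_wpM2r// /g ge_min lexx //.
  rewrite -powRrM -powRD; last by apply/implyP.
  apply: ler_powR; first lra.
  rewrite ltr0_norm//; have : g <= s - b by rewrite /g ge_min lexx orbT.
  by nra.
rewrite sum4 /h -mulr_sumr big_split /=.
have := two_sided_geometric z n rho01; have := two_sided_geometric (- z) n rho01.
set S1 := \sum_(i < n) _; set S2 := \sum_(i < n) _ => h1 h2.
rewrite /C mulrA [leLHS]mulrC [4 * (4 * _)]mulrA [leRHS]mulrAC.
rewrite [leRHS]mulrC.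
have -> : 4 * 4 * d `^ b = 16 * d `^ b by ring.
have X : S2 + S1 <= 4 / (1 - rho).
  have -> : 4 / (1 - rho) = 2 / (1 - rho) + 2 / (1 - rho) by field; lra.
  by rewrite lerD.
have pos : 0 <= 16 * d `^ b by rewrite mulr_ge0// powR_ge0.
by have := ler_wpM2r pos X; rewrite mulrC.
Qed.

End snowflake.

(** * Density of dyadic step functions with rational values *)

Section density.
Context {R : realType}.

Lemma int01_dct (u : nat -> R -> R) (g : R -> R) : (forall n, mf01 (u n)) -> mf01 g ->
  (forall n x, 0 <= u n x <= g x) -> (int01 g < +oo)%E ->
  {ae @P01 R, forall x, u ^~ x @ \oo --> (0 : R)} ->
  forall e : R, 0 < e -> exists N, forall n, (N <= n)%N -> (int01 (u n) <= e%:E)%E.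
Proof.
move=> mu mg u0 goo ucvg e e0.
have g0 x : 0 <= g x by have /andP[h1 h2] := u0 0%N x; exact: le_trans h2.
have ig : (@P01 R).-integrable setT (EFin \o g).
  apply/integrableP; split; first exact: mf01E.
  under eq_integral do rewrite /= ger0_norm//.
  exact: goo.
have uc : {ae @P01 R, forall x, setT x -> (fun n => (u n x)%:E) @ \oo --> 0%E}.
  case: ucvg => Z [mZ Z0 sZ]; exists Z; split => //; apply: subset_trans sZ.
  apply: subsetC => x /= h _.
  by apply: (cvg_EFin (a := 0)); [exact: nearW|exact: h].
have ub : {ae @P01 R, forall x n, setT x -> (`|(u n x)%:E| <= (EFin \o g) x)%E}.
  apply: aeW => x n _.
  by case/andP: (u0 n x) => h1 h2; rewrite lee_fin ger0_norm.
have [_ _] := @dominated_convergence _ _ R (@P01 R) setT measurableT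
  (fun n x => (u n x)%:E) (fun=> 0%E) (EFin \o g) (fun n => mf01E (mu n))
  (measurable_cst _) uc ig ub.
rewrite integral0 => h.
have /fine_cvgP[fu /cvgrPdist_lt/(_ _ e0)[N _ Nh]] :
  (int01 (u n)) @[n --> \oo] --> (0 : R)%:E by exact: h.
case: fu => N' _ fu.
exists (maxn N N') => n; rewrite geq_max => /andP[Nn Nn'].
have := Nh n Nn; rewrite /= sub0r normrN => /ltW/(le_trans (ler_norm _)).
by rewrite -lee_fin fineK//; exact: fu.
Qed.

Definition clip (M x : R) : R := Num.max (- M) (Num.min M x).

Lemma clip_bound (M x : R) : 0 <= M -> `|clip M x| <= M.
Proof. by move=> M0; rewrite /clip ler_norml /Num.max /Num.min; repeat case: ifP; lra. Qed.

Lemma clip_dist (M x y : R) : 0 <= M -> `|clip M x - clip M y| <= `|x - y|.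
Proof.
move=> M0; have := ler_norm (x - y); have := ler_norm (y - x); rewrite (distrC y).
by rewrite /clip ler_norml /Num.max /Num.min; repeat case: ifP; lra.
Qed.

Lemma clip_id (M x : R) : `|x| <= M -> clip M x = x.
Proof. by rewrite ler_norml /clip /Num.max /Num.min; repeat case: ifP; lra. Qed.

Lemma clip_distl (M x : R) : 0 <= M -> `|x - clip M x| <= `|x|.
Proof.
move=> M0; have := ler_norm x; have := ler_norm (- x); rewrite normrN.
by rewrite /clip ler_norml /Num.max /Num.min; repeat case: ifP; lra.
Qed.

Lemma mf01_clip (M : R) (f : R -> R) : mf01 f -> mf01 (fun x => clip M (f x)).
Proof.
move=> mf; apply: measurable_maxr; first exact: mf01_cst.
by apply: measurable_minr => //; exact: mf01_cst.
Qed.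

Definition cell (k i : nat) : set R := `[i%:R / 2 ^+ k, i.+1%:R / 2 ^+ k[%classic.

Definition dstep (k : nat) (c : nat -> R) (x : R) : R := \sum_(i < 2 ^ k) c i * \1_(cell k i) x.

Lemma mf01_cell k i : mf01 (\1_(cell k i) : R -> R).
Proof. by apply: measurable_indic; exact: measurable_itv. Qed.

Lemma mf01_dstep k c : mf01 (dstep k c).
Proof.
apply: mf01_sum => i; apply: mf01_mul; [exact: mf01_cst|exact: mf01_cell].
Qed.

Let pow2 k : 0 < (2 : R) ^+ k. Proof. by rewrite exprn_gt0. Qed.

Lemma cell_trunc k i x : 0 <= x -> cell k i x <-> i = Num.trunc (2 ^+ k * x).
Proof.
move=> x0; rewrite /cell /= in_itv /= ler_pdivrMr// ltr_pdivlMr// mulrC.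
split.
  by move=> h; apply/esym/truncn_def.
move=> ->; apply: truncn_itv; apply: mulr_ge0 => //; exact: ltW.
Qed.

Lemma dstepE k c x : 0 <= x < 1 -> dstep k c x = c (Num.trunc (2 ^+ k * x)).
Proof.
move=> /andP[x0 x1]; set j := Num.trunc _.
have jk : (j < 2 ^ k)%N.
  rewrite -(ltr_nat R) natrX; apply: (@le_lt_trans _ _ (2 ^+ k * x)).
    by rewrite truncn_le; apply: mulr_ge0 => //; exact: ltW.
  by rewrite gtr_pMr.
rewrite /dstep (bigD1 (Ordinal jk))//= big1 ?addr0 => [|i ij].
  by rewrite indicE mem_set ?mulr1//; apply/cell_trunc.
rewrite indicE memNset ?mulr0// => /(cell_trunc _ _ x0) e.
by move: ij; rewrite -val_eqE /= e eqxx.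
Qed.

Lemma P01_integral_itv (h : R -> \bar R) :
  measurable_fun setT h -> (forall x, 0 <= h x)%E ->
  (\int[@P01 R]_x h x = \int[lebesgue_measure]_(x in `[0%R, 1%R]) h x)%E.
Proof.
move=> mh h0.
have mI : measurable (`[0 : R, 1]%classic : set (measurableTypeR R)) by exact: measurable_itv.
have mC : measurable (~` `[0 : R, 1]%classic : set (measurableTypeR R)) by exact: measurableC.
have C0 : (@P01 R) (~` `[0 : R, 1]%classic) = 0%E.
  transitivity (lebesgue_measure (~` `[0 : R, 1]%classic `&` `[0 : R, 1]%classic)); first by [].
  by rewrite setICl measure0.
rewrite (ge0_negligible_integral mC measurableT)//.
rewrite setTD setCK; apply: eq_measure_integral => A mA AI.
transitivity (lebesgue_measure (A `&` `[0 : R, 1]%classic)); first by [].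
by rewrite setIidl.
Qed.

(** Truncation, approximation of the bounded function by a continuous one, then sampling at dyadic
    points with values rounded to rationals. The rational values leave a countable family, from
    which separability follows. *)
Lemma dstep_dense (nu : R) (F : R -> R) : 1 <= nu <= 2 -> mf01 F ->
  (int01 (fun x => `|F x| `^ nu)%R < +oo)%E ->
  forall e : R, 0 < e -> exists k, exists c : seq rat,
    (int01 (fun x => `|F x - dstep k (fun i => ratr (nth 0 c i)) x| `^ nu)%R <= e%:E)%E.
Proof.
move=> /andP[nu1 nu2] mF Foo e e0.
have nu0 : 0 < nu by lra.
(* Three errors of size [e1], multiplied by the factor 9 of [norm_powRD3]. *)
pose e1 := e / 27; have e10 : 0 < e1 by rewrite divr_gt0.
have [M HM] : exists M : nat, (int01 (fun x => `|F x - clip M%:R (F x)| `^ nu)%R <= e1%:E)%E.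
  have ub (n : nat) x : 0 <= `|F x - clip n%:R (F x)| `^ nu <= `|F x| `^ nu.
    rewrite powR_ge0 /=; apply: ge0_ler_powR; rewrite ?nnegrE//; first exact: ltW.
    exact: clip_distl.
  have uc : {ae @P01 R, forall x, (fun n : nat => `|F x - clip n%:R (F x)| `^ nu) @ \oo --> (0 : R)}.
    apply: aeW => x.
    apply/cvgrPdist_le => d d0; exists (Num.trunc `|F x|).+1 => // n /= hn.
    have Fn : `|F x| <= n%:R by apply: ltW; apply: (lt_le_trans (truncnS_gt _)); rewrite ler_nat.
    by rewrite (clip_id Fn) subrr normr0 powR0 ?gt_eqF// subrr normr0 ltW.
  have [N HN] := int01_dct (fun n => mf01_powR nu (mf01_sub mF (mf01_clip n%:R mF)))
    (mf01_powR nu mF) ub Foo uc e10.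
  by exists N; exact: HN.
pose G x := clip M%:R (F x).
have mG : mf01 G by exact: mf01_clip.
have Gb x : `|G x| <= M%:R by exact: clip_bound.
have [h [ch hb Hh]] : exists h : R -> R, [/\ continuous h, (forall x, `|h x| <= M%:R) &
    (int01 (fun x => `|G x - h x| `^ nu)%R <= e1%:E)%E].
  (* Functions bounded by [M] have a difference bounded by [2 * M], on which [|.| ^ nu <= L * |.|]
     since [1 <= nu <= 2]: approximation in L_1 suffices. *)
  pose L := 1 + 2 * M%:R : R.
  have L0 : 0 < L by rewrite ltr_pwDl// mulr_ge0.
  have e2 : 0 < e1 / L by rewrite divr_gt0.
  have iG : lebesgue_measure.-integrable `[0, 1] (EFin \o G).
    apply: measurable_bounded_integrable => //.
    - by rewrite /= lebesgue_measure_itv /= lte_fin ltr01 oppr0 adde0 ltry.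
    - by apply: measurable_funTS.
    - exists M%:R; split; first exact: num_real.
      by move=> y My x _; apply: le_trans (ltW My); exact: Gb.
  have oo01 : (lebesgue_measure [set` `[0%R : R, 1%R]] < +oo)%E.
    by rewrite lebesgue_measure_itv /= lte_fin ltr01 oppr0 adde0 ltry.
  have [g [cg ig gG]] := approximation_continuous_integrable (measurable_itv _) oo01 iG.
  have mg n : mf01 (g n) by apply: continuous_measurable_fun; exact: cg.
  have gG' : int01 (fun x => `|G x - g n x|)%R @[n --> \oo] --> (0 : R)%:E.
    apply: cvg_trans gG; apply: near_eq_cvg; apply: nearW => n.
    rewrite /int01 P01_integral_itv//.
    by apply: mf01E; apply: measurableT_comp => //; apply: mf01_sub.
  have [n Hn] : exists n, (int01 (fun x => `|G x - g n x|)%R <= (e1 / L)%:E)%E.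
    have /fine_cvgP[[N1 _ fu] /cvgrPdist_lt/(_ _ e2)[N2 _ Nh]] := gG'.
    exists (maxn N1 N2); have := Nh _ (leq_maxr N1 N2).
    rewrite /= sub0r normrN => /ltW/(le_trans (ler_norm _)).
    by rewrite -lee_fin fineK//; apply: fu => /=; exact: leq_maxl.
  exists (fun x => clip M%:R (g n x)); split.
  - move=> x; apply: (@continuous_comp _ _ _ (g n) (clip M%:R)); first exact: cg.
    rewrite /clip; apply: continuous_max; first exact: cvg_cst.
    by apply: continuous_min; [exact: cvg_cst|exact: cvg_id].
  - by move=> x; exact: clip_bound.
  - apply: (@le_trans _ _ (int01 (fun x => L * `|G x - g n x|)%R)).
      apply: int01_le.
      + by apply: mf01_powR; apply: mf01_sub => //; exact: mf01_clip.
      + apply: mf01_mul; first exact: mf01_cst.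
        by apply: measurableT_comp => //; apply: mf01_sub.
      + by move=> x; exact: powR_ge0.
      + move=> x; have GE : G x = clip M%:R (G x) by rewrite clip_id.
        have := clip_dist (G x) (g n x) (ler0n R M); rewrite -GE.
        have := clip_bound (g n x) (ler0n R M).
        have := Gb x; set p := clip _ (g n x) => h1 h2 h3.
        apply: (@le_trans _ _ (L * `|G x - p|)); last by rewrite ler_pM2l.
        have a2 : `|G x - p| <= 2 * M%:R by have := ler_normB (G x) p; lra.
        have [a1|a1] := leP `|G x - p| 1.
          have [->|an0] := eqVneq `|G x - p| 0; first by rewrite powR0 ?mulr0// gt_eqF.
          apply: (@le_trans _ _ `|G x - p|); first by apply: ge1r_powR; rewrite // lt_def an0 normr_ge0.
          by rewrite ler_peMl// /L lerDl mulr_ge0.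
        apply: (@le_trans _ _ (`|G x - p| `^ 2)); first by apply: ler_powR => //; exact: ltW.
        by rewrite powR_mulrn// expr2 ler_wpM2r// /L; lra.
    rewrite int01Z//; [|by apply: measurableT_comp => //; apply: mf01_sub|exact: ltW].
    apply: le_trans (lee_wpmul2l _ Hn) _; first by rewrite lee_fin ltW.
    by rewrite -EFinM lee_fin mulrC divfK// gt_eqF.
have mh : mf01 h by exact: continuous_measurable_fun.
have rat_near (y : R) (n : nat) : exists c : rat, `|y - ratr c| <= n.+1%:R^-1.
  set d : R := n.+1%:R^-1; have d0 : 0 < d by rewrite invr_gt0 ltr0n.
  have /rat_in_itvoo[c] : y - d < y + d by lra.
  rewrite inE /= => /andP[]; rewrite ?bnd_simp => c1 c2.
  exists c; rewrite ler_norml; lra.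
pose q (n : nat) (y : R) : rat := projT1 (cid (rat_near y n)).
have qP n y : `|y - ratr (q n y)| <= n.+1%:R^-1 by exact: (projT2 (cid (rat_near y n))).
pose c k : seq rat := mkseq (fun i => q k (h (i%:R / 2 ^+ k))) (2 ^ k).
pose S k := dstep k (fun i => ratr (nth 0 (c k) i)).
have mS k : mf01 (S k) by exact: mf01_dstep.
have SE k x : 0 <= x < 1 -> `|h ((Num.trunc (2 ^+ k * x))%:R / 2 ^+ k) - S k x| <= k.+1%:R^-1.
  move=> x01; rewrite /S dstepE//; set j := Num.trunc _.
  have jk : (j < 2 ^ k)%N.
    rewrite -(ltr_nat R) natrX; have /andP[x0 x1] := x01.
    apply: (@le_lt_trans _ _ (2 ^+ k * x)); last by rewrite gtr_pMr.
    by rewrite truncn_le; apply: mulr_ge0 => //; exact: ltW.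
  by rewrite /c nth_mkseq.
have inv1 k : (k.+1%:R : R)^-1 <= 1 by rewrite invf_le1 ?ltr0n// ler1n.
pose B : R := (2 * M%:R + 1) `^ nu.
(* The minimum with [B] changes nothing on [0, 1[ and provides a dominating constant at every
   point. *)
pose u k x : R := Num.min (`|h x - S k x| `^ nu) B.
have uE k x : 0 <= x < 1 -> u k x = `|h x - S k x| `^ nu.
  move=> x01; rewrite /u min_l// /B; apply: ge0_ler_powR; rewrite ?nnegrE//; first exact: ltW.
  have := SE k x x01; set y := _ / _ => h1; have := hb y; have := hb x; have := inv1 k.
  move=> a1 a2 a3.
  have := ler_normD (h x - h y) (h y - S k x); rewrite subrKA => /le_trans; apply.
  apply: le_trans (lerD (ler_normB _ _) h1) _.
  have -> : 2 * M%:R + 1 = M%:R + M%:R + 1 :> R by ring.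
  by apply: lerD => //; exact: lerD.
have mu k : mf01 (u k).
  apply: measurable_minr; last exact: mf01_cst.
  by apply: mf01_powR; apply: mf01_sub.
have [k Hk] : exists k, (int01 (u k) <= e1%:E)%E.
  have uc : {ae @P01 R, forall x, u ^~ x @ \oo --> (0 : R)}.
    case: (@P01_le1 R) => Z [mZ Z0 sZ]; exists Z; split => //.
    apply: subset_trans sZ; apply: subsetC => x /= x01.
    have -> : u ^~ x = (fun k => `|h x - S k x| `^ nu) by apply/funext => k; exact: uE.
    rewrite -[X in _ --> X](powR0 (x := nu)) ?gt_eqF// -[X in X `^ nu](normr0 R).
    apply: cvg_norm_powR => //.
    have /andP[x0 x1] := x01.
    have dk : (fun k => (Num.trunc (2 ^+ k * x))%:R / 2 ^+ k : R) @ \oo --> x.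
      apply/cvgrPdist_le => d d0.
      have : geometric (1 : R) 2^-1 @ \oo --> (0 : R).
        by apply: cvg_geometric; rewrite ger0_norm ?invr_ge0// invf_lt1// ltr1n.
      move=> /cvgrPdist_le/(_ _ d0)[N _ HN]; exists N => // k /= Nk.
      have := HN k Nk; rewrite /= sub0r normrN mul1r ger0_norm ?exprn_ge0 ?invr_ge0//.
      apply: le_trans; rewrite exprVn.
      have /andP[t1 t2] := truncn_itv (mulr_ge0 (ltW (pow2 k)) x0).
      rewrite -[(Num.trunc _).+1%:R]natr1 in t2.
      have -> : x - (Num.trunc (2 ^+ k * x))%:R / 2 ^+ k =
          (2 ^+ k * x - (Num.trunc (2 ^+ k * x))%:R) / 2 ^+ k.
        by rewrite mulrBl; congr (_ - _); rewrite mulrAC divff ?mul1r// gt_eqF.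
      rewrite normrM normfV [X in _ / X]ger0_norm ?(ltW (pow2 k))// ler_piMl ?invr_ge0 ?(ltW (pow2 k))//.
      by rewrite ger0_norm; lra.
    have hdk : (fun k => h ((Num.trunc (2 ^+ k * x))%:R / 2 ^+ k : R)) @ \oo --> h x.
      by apply: (cvg_comp _ _ dk); exact: ch.
    have c1 : (fun k => h x - h ((Num.trunc (2 ^+ k * x))%:R / 2 ^+ k : R)) @ \oo --> (0 : R).
      by rewrite -(subrr (h x)); apply: cvgB => //; exact: cvg_cst.
    have c2 : (fun k => h ((Num.trunc (2 ^+ k * x))%:R / 2 ^+ k : R) - S k x) @ \oo --> (0 : R).
      apply/cvgr0Pnorm_le => d d0.
      have /cvgr0Pnorm_le/(_ _ d0)[N _ HN] := @cvg_harmonic R.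
      exists N => // k /= Nk; apply: le_trans (SE k x x01) _.
      by have := HN k Nk; rewrite /= ger0_norm// invr_ge0.
    have e3 : (fun k => h x - h ((Num.trunc (2 ^+ k * x))%:R / 2 ^+ k : R)) +
      (fun k => h ((Num.trunc (2 ^+ k * x))%:R / 2 ^+ k : R) - S k x) = (fun k => h x - S k x).
      by apply/funext => k /=; rewrite -[LHS]/(_ - _ + (_ - _)) subrKA.
    have := cvgD c1 c2; rewrite addr0 e3 => X; exact: X.
  have ub k x : 0 <= u k x <= B.
    by rewrite /u ge_min lexx orbT andbT le_min !powR_ge0.
  have Boo : (int01 (fun=> B)%R < +oo)%E by rewrite int01_cst ltry.
  have [N HN] := int01_dct mu (mf01_cst B) ub Boo uc e10.
  by exists N; exact: HN.
exists k, (c k).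
apply: (@le_trans _ _ (int01 (fun x => 9 * (`|F x - G x| `^ nu + `|G x - h x| `^ nu + `|h x - S k x| `^ nu))%R)).
  apply: int01_le.
  - by apply: mf01_powR; apply: mf01_sub => //; exact: mf01_dstep.
  - apply: mf01_mul; first exact: mf01_cst.
    apply: mf01_add; last by apply: mf01_powR; apply: mf01_sub.
    by apply: mf01_add; apply: mf01_powR; apply: mf01_sub.
  - by move=> x; exact: powR_ge0.
  - move=> x; rewrite -/(S k x).
    have -> : F x - S k x = (F x - G x) + (G x - h x) + (h x - S k x) by ring.
    by apply: norm_powRD3; lra.
have m1 : mf01 (fun x => `|F x - G x| `^ nu) by apply: mf01_powR; apply: mf01_sub.
have m2 : mf01 (fun x => `|G x - h x| `^ nu) by apply: mf01_powR; apply: mf01_sub.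
have m3 : mf01 (fun x => `|h x - S k x| `^ nu) by apply: mf01_powR; apply: mf01_sub.
rewrite int01Z; [|by apply: mf01_add => //; exact: mf01_add|by move=> x; rewrite !addr_ge0// powR_ge0|by []].
rewrite int01D; [|exact: mf01_add|exact: m3|by move=> x; rewrite addr_ge0// powR_ge0|by move=> x; exact: powR_ge0].
rewrite int01D; [|exact: m1|exact: m2|by move=> x; exact: powR_ge0|by move=> x; exact: powR_ge0].
have H3 : (int01 (fun x => `|h x - S k x| `^ nu)%R <= e1%:E)%E.
  rewrite (@int01_ae _ _ (u k))//.
  - by move=> x; rewrite /u le_min !powR_ge0.
  - case: (@P01_le1 R) => Z [mZ Z0 sZ]; exists Z; split => //.
    by apply: subset_trans sZ; apply: subsetC => x /= x01; rewrite uE.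
apply: le_trans (lee_wpmul2l _ (leeD (leeD HM Hh) H3)) _; first by rewrite lee_fin.
by rewrite -!EFinD -EFinM lee_fin /e1; lra.
Qed.

End density.

Section int01_more.
Context {R : realType}.

Lemma int01_sum n (h : nat -> R -> R) : (forall i, mf01 (h i)) -> (forall i x, 0 <= h i x) ->
  int01 (fun x => \sum_(i < n) h i x)%R = (\sum_(i < n) int01 (h i))%E.
Proof.
move=> mh h0; elim: n => [|n IH].
  rewrite big_ord0; transitivity (int01 (fun=> 0 : R)%R); last exact: int01_cst.
  by rewrite /int01; apply: eq_integral => x _; rewrite big_ord0.
rewrite big_ord_recr /= -IH -int01D//.
- by rewrite /int01; apply: eq_integral => x _; rewrite big_ord_recr.
- exact: (mf01_sum _ (fun i : 'I_n => mh i)).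
- by move=> x; exact: sumr_ge0.
Qed.

Lemma int01_indic (A : set R) : measurable (A : set (measurableTypeR R)) ->
  int01 (\1_A) = (@P01 R) A.
Proof.
move=> mA; transitivity ((@P01 R) (A `&` setT)); last by rewrite setIT.
by rewrite /int01 integral_indic.
Qed.

Lemma powR_subadd (x y b : R) : 0 <= x -> 0 <= y -> 0 <= b <= 1 ->
  (x + y) `^ b <= x `^ b + y `^ b.
Proof.
move=> x0 y0 /andP[b0 b1].
have [s0|s0] := eqVneq (x + y) 0.
  have -> : x = 0 by lra.
  have -> : y = 0 by lra.
  by rewrite addr0 lerDl powR_ge0.
have sp : 0 < x + y by rewrite lt_def s0 addr_ge0.
have frac z : 0 <= z -> z <= x + y -> z / (x + y) * (x + y) `^ b <= z `^ b.
  move=> z0 zs; have [->|zn] := eqVneq z 0; first by rewrite mul0r mul0r powR_ge0.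
  have h : z / (x + y) <= (z / (x + y)) `^ b.
    apply: ger1_powR => //; apply/andP; split; last by rewrite ler_pdivrMr// mul1r.
    by rewrite divr_gt0// lt_def zn z0.
  apply: le_trans (ler_wpM2r (powR_ge0 _ _) h) _.
  rewrite -powRM; [by rewrite divfK|by rewrite divr_ge0// ltW|exact: ltW].
have := lerD (frac x x0 _) (frac y y0 _); rewrite -mulrDl -mulrDl divff// mul1r.
by apply; lra.
Qed.

End int01_more.

Section levels.

(** Level [i] of a binary tree occupies the [2 ^ i] indices from [2 ^ i - 1] on; [trunc_log 2 j.+1]
    recovers the level of the index [j]. *)
Lemma sum_levels (V : nmodType) (H : nat -> V) L :
  (\sum_(j < (2 ^ L).-1) H j = \sum_(i < L) \sum_(k < 2 ^ i) H ((2 ^ i).-1 + k)%N)%R.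
Proof.
elim: L => [|L IH]; first by rewrite !big_ord0.
rewrite big_ord_recr /= -IH.
have -> : ((2 ^ L.+1).-1 = (2 ^ L).-1 + 2 ^ L)%N.
  by rewrite expnS mul2n -addnn -{1}(prednK (expn_gt0 2 L)) addSn /= .
by rewrite big_split_ord /=.
Qed.

Lemma trunc_log_level i k : (k < 2 ^ i)%N -> trunc_log 2 ((2 ^ i).-1 + k).+1 = i.
Proof.
move=> ki; apply: trunc_log_eq => //.
rewrite -addSn prednK ?expn_gt0// leq_addr /= expnS mul2n -addnn ltn_add2l.
exact: ki.
Qed.

End levels.

(** * LePage series and Haar coefficients *)

Section lepage.
Context {R : realType}.

(* The largest power of two below the index [j + 1] of the LePage series; replacing the index by
   it makes the sums over levels geometric. *)
Definition tau (j : nat) : R := 2 ^+ trunc_log 2 j.+1.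

Lemma tau_gt0 j : 0 < tau j. Proof. by rewrite exprn_gt0. Qed.

Lemma tau_le j : tau j <= j.+1%:R.
Proof. by rewrite /tau -natrX ler_nat trunc_logP. Qed.

(** The Poisson arrival times of the classical LePage series are replaced by deterministic weights:
    only two-sided bounds for moments are wanted, not a stable law. *)
Definition lepage_coef (r : R) (j : nat) (F : R -> R) (t : R) : R :=
  (tau j) `^ (- r^-1) * F (iid j t).

Lemma mf01_lepage r j F : mf01 F -> mf01 (lepage_coef r j F).
Proof.
move=> mF; apply: mf01_mul; first exact: mf01_cst.
exact: mf01_comp mF (measurable_iid j).
Qed.

Variables (b r : R).
Hypotheses (b0 : 0 < b) (br : b < r) (r1 : 1 <= r) (r2 : r < 2).

Let r0 : 0 < r. Proof. by move: (r1) => ?; lra. Qed.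

(** A squared coefficient [y ^ (2 / r)] is counted fully when small and to the power [b / 2] when
    large. As b < r < 2, [psi] is of higher order than [y] at 0 and of lower order at infinity,
    which bounds the sum of the [psi (x / tau j)] by a multiple of [x]. *)
Let psi (y : R) : R := if y <= 1 then y `^ (2 / r) else y `^ (b / r).

Let psi0 y : 0 <= psi y. Proof. by rewrite /psi; case: ifP; rewrite powR_ge0. Qed.

Let mpsi : mf01 psi.
Proof.
rewrite /psi; apply: measurable_fun_ifT.
- by apply: measurable_fun_ler => //; exact: measurable_id.
- exact: measurable_powR.
- exact: measurable_powR.
Qed.

(** Terms are added one at a time: a large one by subadditivity of the power [b / 2], a small one by
    [(1 + v) ^ (b / 2) <= 1 + v]. The initial 1 keeps the running sum [s] at least 1, so that
    [s ^ (b / 2) <= s]. *)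
Let sum_psi (M : nat) (y : nat -> R) : (forall j, 0 <= y j) ->
  (\sum_(j < M) y j `^ (2 / r)) `^ (b / 2) <= 1 + \sum_(j < M) psi (y j).
Proof.
move=> y0.
have hb : 0 <= b / 2 <= 1 by move: (b0) (br) (r2) => *; lra.
have hb0 : 0 <= b / 2 by move: (b0) => *; lra.
have S0 N : 0 <= \sum_(j < N) y j `^ (2 / r) by apply: sumr_ge0 => j _; exact: powR_ge0.
suff : (1 + \sum_(j < M) y j `^ (2 / r)) `^ (b / 2) <= 1 + \sum_(j < M) psi (y j).
  apply: le_trans; apply: ge0_ler_powR; rewrite ?nnegrE ?addr_ge0//.
  by rewrite lerDr.
elim: M => [|M IH].
  by rewrite !big_ord0 addr0 (congr1 (fun f => f (b / 2)) (powR1 R)).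
rewrite 2!big_ord_recr /= 2!addrA; set s := 1 + \sum_(_ < _) _ in IH *.
have s1 : 1 <= s by rewrite lerDl.
apply: (@le_trans _ _ (s `^ (b / 2) + psi (y M))); last by rewrite lerD2r.
rewrite /psi; have [y1|y1] := leP (y M) 1; last first.
  apply: le_trans (powR_subadd _ _ hb) _; rewrite ?powR_ge0//; first lra.
  rewrite lerD2l -powRrM.
  by rewrite (_ : 2 / r * (b / 2) = b / r)//; field; rewrite gt_eqF.
set w := y M `^ (2 / r).
have w0 : 0 <= w by exact: powR_ge0.
have sp : 0 < s by lra.
have -> : s + w = s * (1 + w / s) by rewrite mulrDr mulr1 mulrCA divff ?mulr1// gt_eqF.
rewrite powRM; [|exact: ltW|by rewrite addr_ge0// divr_ge0// ltW].
apply: (@le_trans _ _ (s `^ (b / 2) * (1 + w / s))).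
  rewrite ler_wpM2l ?powR_ge0//; apply: ler1_powR; last by case/andP: hb.
  by rewrite lerDl divr_ge0// ltW.
rewrite mulrDr mulr1 lerD2l mulrA mulrAC ler_piMl//.
rewrite ler_pdivrMr// mul1r.
by apply: ler1_powR => //; case/andP: hb.
Qed.

Let gam : R := Num.min (2 / r - 1) (1 - b / r).
Let gam0 : 0 < gam.
Proof. by rewrite lt_min !subr_gt0 ltr_pdivlMr// mul1r r2 ltr_pdivrMr// mul1r br. Qed.
Let rho : R := 2 `^ (- gam).
Let rho01 : 0 < rho < 1.
Proof.
have p1 : 1 < (2 : R) `^ gam by rewrite /powR gt_eqF// expR_gt1 mulr_gt0// ln_gt0// ltr1n.
by rewrite powR_gt0//= /rho powRN invf_lt1// (lt_trans _ p1).
Qed.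

(** The level where [x / 2 ^ i] is about 1 is the binary logarithm of [x]; in both directions away
    from it, [psi] gains the factor [rho] per level over linear growth. *)
Let psi_level (x : R) i : 0 < x ->
  2 ^+ i * psi (x / 2 ^+ i) <= x * rho `^ `|i%:R + (- (ln x / ln 2))|.
Proof.
move=> x0.
have l2 : 0 < ln (2 : R) by apply: ln_gt0; lra.
set z := ln x / ln 2; set t := z - i%:R.
have xz : x = 2 `^ z by rewrite /powR gt_eqF// /z divfK ?gt_eqF// lnK.
have yt : x / 2 ^+ i = 2 `^ t.
  by rewrite {1}xz -powR_mulrn// -powRB//; apply/implyP.
have nt : `|i%:R + - z| = `|t| by rewrite -normrN /t; congr `|_|; ring.
have e2 : 2 ^+ i = x / 2 `^ t :> R.
  by rewrite -yt invf_div mulrCA divff ?mulr1// gt_eqF.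
rewrite yt nt e2 -mulrA ler_pM2l// /rho -powRrM /psi -powRN.
have [t0|t0] := leP t 0.
  rewrite ifT; last first.
    by rewrite -[leRHS](powRr0 (2 : R)); apply: ler_powR => //; rewrite ler1n.
  rewrite -powRrM -powRD; last by apply/implyP.
  apply: ler_powR; first lra.
  rewrite ler0_norm//.
  have : gam <= 2 / r - 1 by rewrite /gam ge_min lexx.
  by nra.
rewrite ifF; last first.
  apply/negbTE; rewrite -ltNge /powR gt_eqF// expR_gt1 mulr_gt0//.
rewrite -powRrM -powRD; last by apply/implyP.
apply: ler_powR; first lra.
rewrite gtr0_norm//.
have : gam <= 1 - b / r by rewrite /gam ge_min lexx orbT.
by nra.
Qed.

Let sum_psi_tau (x : R) M : 0 <= x ->
  \sum_(j < M) psi (x / tau j) <= 2 / (1 - rho) * x.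
Proof.
rewrite le_eqVlt => /orP[/eqP <-|x0].
  rewrite mulr0 big1// => j _; rewrite mul0r /psi ler01 powR0//.
  by rewrite gt_eqF// divr_gt0.
apply: (@le_trans _ _ (\sum_(j < (2 ^ M).-1) psi (x / tau j))).
  rewrite (big_ord_widen _ (fun j => psi (x / tau j)) (_ : M <= (2 ^ M).-1)%N); last first.
    by rewrite -ltnS prednK ?expn_gt0// ltn_expl.
  by rewrite big_mkcond /=; apply: ler_sum => j _; case: ifP.
rewrite (sum_levels (fun j => psi (x / tau j))).
apply: (@le_trans _ _ (\sum_(i < M) x * rho `^ `|i%:R + (- (ln x / ln 2))|)).
  apply: ler_sum => i _; apply: le_trans (psi_level i x0).
  rewrite (eq_bigr (fun=> psi (x / 2 ^+ i))) => [|k _]; last by rewrite /tau trunc_log_level.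
  by rewrite sumr_const card_ord -[leLHS]mulr_natl natrX.
by rewrite -mulr_sumr mulrC ler_pM2r//; apply: two_sided_geometric.
Qed.

Let coef_sq F j t : lepage_coef r j F t ^+ 2 = (`|F (iid j t)| `^ r / tau j) `^ (2 / r).
Proof.
have tj := tau_gt0 j.
rewrite /lepage_coef exprMn powRM ?powR_ge0 ?invr_ge0 ?ltW//.
rewrite mulrC; congr (_ * _).
  rewrite -powRrM (_ : r * (2 / r) = 2%:R); last by rewrite mulrC divfK// gt_eqF.
  by rewrite powR_mulrn// real_normK// num_real.
rewrite -powR_mulrn ?powR_ge0// -powRrM -(powR_inv1 (ltW tj)) -powRrM.
by congr (_ `^ _); field; rewrite gt_eqF.
Qed.

Variable F : R -> R.
Hypothesis mF : mf01 F.
Let g x := `|F x| `^ r.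
Hypothesis g1 : int01 g = 1%:E.

Let mg : mf01 g. Proof. exact: mf01_powR. Qed.
Let g0 x : 0 <= g x. Proof. exact: powR_ge0. Qed.

Lemma lepage_upper M :
  (int01 (fun t => (\sum_(j < M) lepage_coef r j F t ^+ 2) `^ (b / 2))%R
    <= (1 + 2 / (1 - rho))%:E)%E.
Proof.
have mgt j : mf01 (fun x => psi (g x / tau j)).
  apply: (mf01_comp (f := psi)) => //; apply: mf01_mul => //; exact: mf01_cst.
have mgi j : mf01 (fun t => psi (g (iid j t) / tau j)).
  exact: (mf01_comp (f := fun x => psi (g x / tau j)) (mgt j) (measurable_iid j)).
have ms : mf01 (fun t => \sum_(j < M) psi (g (iid j t) / tau j)).
  exact: (mf01_sum _ (fun i : 'I_M => mgi i)).
apply: (@le_trans _ _ (int01 (fun t => 1 + \sum_(j < M) psi (g (iid j t) / tau j))%R)).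
  apply: int01_le.
  - apply: (measurableT_comp (measurable_powR _)); apply: mf01_sum => j.
    by apply: measurable_funX; exact: mf01_lepage.
  - by apply: mf01_add => //; exact: mf01_cst.
  - by move=> x; exact: powR_ge0.
  - move=> t; rewrite (eq_bigr (fun j : 'I_M => (g (iid j t) / tau j) `^ (2 / r))).
      apply: (sum_psi M (y := fun j => g (iid j t) / tau j)) => j.
      by rewrite divr_ge0// ltW// tau_gt0.
    by move=> j _; rewrite coef_sq.
rewrite int01D//; [|exact: mf01_cst|by move=> x; exact: sumr_ge0].
rewrite int01_cst EFinD leeD2l//.
rewrite (int01_sum M mgi)//.
rewrite (eq_bigr (fun j : 'I_M => int01 (fun x => psi (g x / tau j))%R)); last first.
  by move=> j _; apply: (int01_iid j (mgt j)) => x; exact: psi0.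
rewrite -(int01_sum M mgt)//.
apply: (@le_trans _ _ (int01 (fun x => 2 / (1 - rho) * g x)%R)).
  apply: int01_le.
  - exact: (mf01_sum _ (fun i : 'I_M => mgt i)).
  - by apply: mf01_mul => //; exact: mf01_cst.
  - by move=> x; exact: sumr_ge0.
  - by move=> x; exact: sum_psi_tau.
rewrite int01Z//; first by rewrite g1 mule1.
by rewrite divr_ge0//; case/andP: rho01; lra.
Qed.

Let chi (j : nat) (x : R) : R := \1_[set x | tau j / 4 < g x] x.

Let mset j : measurable ([set x | tau j / 4 < g x] : set (measurableTypeR R)).
Proof.
have -> : [set x | tau j / 4 < g x] = g @^-1` `]tau j / 4, +oo[.
  by apply/seteqP; split => x /=; rewrite in_itv/= andbT.
by rewrite -[X in measurable X]setTI; apply: mg => //; exact: measurable_itv.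
Qed.

Let mchi j : mf01 (chi j). Proof. exact: measurable_indic. Qed.

Let chi01 j x : 0 <= chi j x <= 1.
Proof. by rewrite /chi indicE; case: (_ \in _); rewrite lexx ler01. Qed.

Let p j : R := fine (int01 (chi j)).

Let pE j : int01 (chi j) = (p j)%:E.
Proof.
rewrite /p fineK// (int01_indic (mset j)) fin_num_measure//.
Qed.

Let p0 j : 0 <= p j.
Proof. by rewrite -lee_fin -pE int01_ge0// => x; case/andP: (chi01 j x). Qed.

Let count_min (x : R) M : Num.min M.+1%:R (4 * x) <= \sum_(j < M) (j.+1%:R / 4 < x)%R%:R + 1.
Proof.
elim: M => [|M IH]; first by rewrite big_ord0 add0r ge_min lexx.
rewrite big_ord_recr /=; set S := \sum_(_ < _) _ in IH *.
have [h|h] := ltP (M.+1%:R / 4) x => /=.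
  rewrite ge_min; apply/orP; left.
  have : Num.min M.+1%:R (4 * x) = M.+1%:R by rewrite min_l//; lra.
  by move=> e; rewrite e in IH; rewrite -(natr1 M.+1); lra.
rewrite addr0; apply: le_trans IH; rewrite le_min !ge_min lexx !orbT /=.
by apply/andP; split => //; apply/orP; right; lra.
Qed.

(** The number of [j] with [(j + 1) / 4 < g] is at least [4 * g - 1], up to truncation at [M + 1].
    As [g] has integral 1, the mean number is about 3 or more for large [M]; an error of 2 in the
    truncation still leaves 1. *)
Let mass : exists M, 1 <= \sum_(j < M) p j.
Proof.
pose u (M : nat) x := 4 * g x - Num.min M.+1%:R (4 * g x).
have mm (M : nat) : mf01 (fun x => Num.min M.+1%:R (4 * g x)).
  by apply: measurable_minr; [exact: mf01_cst|apply: mf01_mul => //; exact: mf01_cst].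
have m4 : mf01 (fun x => 4 * g x) by apply: mf01_mul => //; exact: mf01_cst.
have mu M : mf01 (u M) by apply: mf01_sub.
have i4 : int01 (fun x => 4 * g x)%R = 4%:E by rewrite int01Z// g1 mule1.
have ub M x : 0 <= u M x <= 4 * g x.
  rewrite /u subr_ge0 ge_min lexx orbT /= gerBl le_min ler0n mulr_ge0//.
have uc : {ae @P01 R, forall x, u ^~ x @ \oo --> (0 : R)}.
  apply: aeW => x; apply/cvgrPdist_le => d d0.
  exists (Num.trunc (4 * g x)).+1 => // n /= hn.
  rewrite /u min_r ?subrr ?subr0 ?normr0 ?ltW//.
  by apply: (lt_le_trans (truncnS_gt _)); rewrite ler_nat ltnW.
have goo : (int01 (fun x => (4 * g x)%R)%R < +oo)%E by rewrite i4 ltry.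
have [N HN] := int01_dct mu m4 ub goo uc (ltr0Sn R 1).
exists N; have {}HN := HN N (leqnn _).
have mS : mf01 (fun x => \sum_(j < N) chi j x) by exact: (mf01_sum _ (fun i : 'I_N => mchi i)).
have S0 x : 0 <= \sum_(j < N) chi j x by apply: sumr_ge0 => j _; case/andP: (chi01 j x).
have h : (int01 (fun x => (4 * g x)%R)%R <= int01 (u N) + (int01 (fun x => (\sum_(j < N) chi j x)%R)%R + 1%:E))%E.
  rewrite -(int01_cst (1 : R)) -int01D//; [|exact: mf01_cst].
  rewrite -int01D//; first last.
  - by move=> x; rewrite addr_ge0.
  - by move=> x; case/andP: (ub N x).
  - by apply: mf01_add => //; exact: mf01_cst.
  apply: int01_le => //.
  - apply: mf01_add => //; apply: mf01_add => //; exact: mf01_cst.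
  - by move=> x; rewrite mulr_ge0.
  - move=> x; rewrite /u -lerBlDl opprB addrC subrK.
    apply: le_trans (count_min (g x) N) _; rewrite lerD2r; apply: ler_sum => j _.
    rewrite /chi indicE; have [hj|_] := ltP (j.+1%:R / 4) (g x); last by rewrite /= ler0n.
    rewrite mem_set//=; apply: le_lt_trans hj; rewrite ler_pM2r ?invr_gt0//.
    exact: tau_le.
rewrite i4 (int01_sum N mchi) in h; last by move=> i x; case/andP: (chi01 i x).
have {h} := le_trans h (leeD2r _ HN).
rewrite (eq_bigr (fun j : 'I_N => (p j)%:E)); last by move=> j _; rewrite pE.
by rewrite sumEFin -!EFinD lee_fin; lra.
Qed.

(** Second moment method. If some [chi j (iid j t)] is nonzero, the sum of squares is at least
    [4^-1 ^ (2 / r)]; the number [N] of such [j] has mean [lam >= 1] and, by pairwise independence,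
    second moment at most [lam + lam ^ 2]. *)
Lemma lepage_lower : exists M,
  ((4^-1 `^ (b / r) / 2)%:E <=
    int01 (fun t => (\sum_(j < M) lepage_coef r j F t ^+ 2) `^ (b / 2))%R)%E.
Proof.
have [M pM] := mass; exists M; set K := _ `^ _.
have K0 : 0 < K by exact: powR_gt0.
pose lam := \sum_(j < M) p j; pose m := 1 + lam.
have lam0 : 0 <= lam by apply: sumr_ge0.
have m0 : 0 < m by rewrite /m; lra.
pose N t := \sum_(j < M) chi j (iid j t).
have mci j : mf01 (fun t => chi j (iid j t)).
  exact: (mf01_comp (f := chi j) (mchi j) (measurable_iid j)).
have ci0 j t : 0 <= chi j (iid j t) by case/andP: (chi01 j (iid j t)).
have mN : mf01 N by exact: (mf01_sum _ (fun i : 'I_M => mci i)).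
have N0 t : 0 <= N t by apply: sumr_ge0.
have EN : int01 N = lam%:E.
  rewrite /N (int01_sum M mci)// /lam -sumEFin; apply: eq_bigr => j _.
  by rewrite (int01_iid j (mchi j)) ?pE// => x; case/andP: (chi01 j x).
have EN2 : (int01 (fun t => (N t ^+ 2)%R)%R <= (lam + lam ^+ 2)%:E)%E.
  have -> : int01 (fun t => (N t ^+ 2)%R)%R =
     int01 (fun t => (\sum_(j < M) \sum_(k < M) chi j (iid j t) * chi k (iid k t))%R)%R.
    rewrite /int01; apply: eq_integral => t _; congr EFin.
    by rewrite expr2 /N mulr_suml; apply: eq_bigr => j _; rewrite mulr_sumr.
  have mjk j k : mf01 (fun t => chi j (iid j t) * chi k (iid k t)) by exact: mf01_mul.
  have jk0 j k t : 0 <= chi j (iid j t) * chi k (iid k t) by exact: mulr_ge0.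
  have pair (j k : nat) : (int01 (fun t => (chi j (iid j t) * chi k (iid k t))%R)%R
      <= (p j * p k + (j == k)%:R * p j)%:E)%E.
    have ne (j' k' : nat) : (j' < k')%N ->
        (int01 (fun t => (chi j' (iid j' t) * chi k' (iid k' t))%R)%R = (p j' * p k')%:E)%E.
      by move=> jk; rewrite (int01_iid2 jk)// ?pE// => x; case/andP: (chi01 _ x).
    case: (ltngtP j k) => [jk|jk|<-].
    - by rewrite ne// mul0r addr0.
    - rewrite mul0r addr0 (mulrC (p j)) -(ne _ _ jk) le_eqVlt; apply/orP; left; apply/eqP.
      by rewrite /int01; apply: eq_integral => t _; rewrite mulrC.
    - apply: (@le_trans _ _ (p j)%:E); last by rewrite lee_fin mul1r lerDr mulr_ge0.
      rewrite -pE -(int01_iid j (mchi j)); last by move=> x; case/andP: (chi01 j x).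
      apply: int01_le => // t; case/andP: (chi01 j (iid j t)) => h0 h1.
      by rewrite ler_piMr.
  rewrite (int01_sum M (h := fun j t => \sum_(k < M) chi j (iid j t) * chi k (iid k t))); first last.
  - by move=> j t; apply: sumr_ge0.
  - by move=> j; exact: (mf01_sum _ (fun k : 'I_M => mjk j k)).
  apply: (@le_trans _ _ (\sum_(j < M) (p j * lam + p j)%:E)%E).
    apply: lee_sum => j _; rewrite (int01_sum M (mjk j))//.
    apply: (@le_trans _ _ (\sum_(k < M) (p j * p k + (j == k :> nat)%:R * p j)%:E)%E).
      by apply: lee_sum => k _; exact: pair.
    rewrite sumEFin lee_fin big_split /= -mulr_sumr lerD2l -mulr_suml.
    rewrite (bigD1 j)//= eqxx big1 ?addr0 ?mul1r// => k kj.
    by rewrite (negbTE (_ : (j : nat) != k))// eq_sym.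
  by rewrite sumEFin lee_fin big_split /= -mulr_suml; rewrite -/lam; lra.
(* By [0 <= (1 - N / m) ^ 2], the indicator of [N != 0] is at least [2 N / m - (N / m) ^ 2]. For
   [m = 1 + lam] the mean of this is at least [lam / m], hence at least 1 / 2. *)
have main : (int01 (fun t => (K * 2 / m * N t)%R)%R <=
   int01 (fun t => ((\sum_(j < M) lepage_coef r j F t ^+ 2) `^ (b / 2) + K / m ^+ 2 * N t ^+ 2)%R)%R)%E.
  apply: int01_le.
  - by apply: mf01_mul => //; exact: mf01_cst.
  - apply: mf01_add.
      apply: (measurableT_comp (measurable_powR _)); apply: mf01_sum => j.
      by apply: measurable_funX; exact: mf01_lepage.
    by apply: mf01_mul; [exact: mf01_cst|exact: measurable_funX].
  - by move=> t; rewrite mulr_ge0// divr_ge0 ?mulr_ge0 ?ltW.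
  - move=> t; have [N00|Nn0] := eqVneq (N t) 0.
      by rewrite N00 mulr0 expr0n /= mulr0 addr0 powR_ge0.
    have : K <= (\sum_(j < M) lepage_coef r j F t ^+ 2) `^ (b / 2).
      have [j cj] : exists j : 'I_M, chi j (iid j t) != 0.
        apply: contrapT => h; move/eqP: Nn0; apply; rewrite /N big1// => j _.
        by apply: contrapT => hj; apply: h; exists j; apply/eqP.
      have gj : tau j / 4 < g (iid j t).
        move: cj; rewrite /chi indicE; case: (boolP (_ \in _)) => [|_]; last by rewrite eqxx.
        by rewrite inE.
      have -> : K = ((4^-1 : R) `^ (2 / r)) `^ (b / 2).
        by rewrite /K -powRrM; congr (_ `^ _); field; rewrite gt_eqF.
      apply: ge0_ler_powR; rewrite ?nnegrE ?powR_ge0//; first by rewrite divr_ge0// ltW.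
        by apply: sumr_ge0 => i _; exact: sqr_ge0.
      apply: (@le_trans _ _ (lepage_coef r j F t ^+ 2)); last first.
        by rewrite (bigD1 j)//= lerDl sumr_ge0// => i _; exact: sqr_ge0.
      rewrite coef_sq; apply: ge0_ler_powR; rewrite ?nnegrE ?invr_ge0//.
      + by rewrite divr_ge0// ltW.
      + by rewrite divr_ge0 ?powR_ge0// ltW// tau_gt0.
      + rewrite ler_pdivlMr ?tau_gt0// mulrC; exact: ltW.
    set Z := _ `^ _ => KZ.
    apply: (@le_trans _ _ (K + K / m ^+ 2 * N t ^+ 2)); last by rewrite lerD2r.
    have := sqr_ge0 (1 - N t / m); rewrite sqrrB expr1n mul1r => h.
    have := mulr_ge0 (ltW K0) h.
    have -> : K * (1 - N t / m *+ 2 + (N t / m) ^+ 2) =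
       K + K / m ^+ 2 * N t ^+ 2 - K * 2 / m * N t.
      by rewrite exprMn exprVn -mulr_natr; ring.
    by rewrite subr_ge0.
set Z := fun t : R => (\sum_(j < M) lepage_coef r j F t ^+ 2) `^ (b / 2).
have mZ : mf01 Z.
  apply: (measurableT_comp (measurable_powR _)); apply: mf01_sum => j.
  by apply: measurable_funX; exact: mf01_lepage.
have Z0 t : 0 <= Z t by exact: powR_ge0.
have mN2 : mf01 (fun t => N t ^+ 2) by exact: measurable_funX.
have N20 t : 0 <= N t ^+ 2 by exact: sqr_ge0.
have Km0 : 0 <= K / m ^+ 2 by rewrite divr_ge0 ?sqr_ge0// ltW.
move: main; rewrite int01D//; first last.
- by move=> t; rewrite mulr_ge0.
- by apply: mf01_mul => //; exact: mf01_cst.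
rewrite int01Z//; last by rewrite divr_ge0 ?mulr_ge0 ?ltW.
rewrite int01Z// EN => h.
have {h} := le_trans h (leeD2l _ (lee_wpmul2l _ EN2)).
rewrite lee_fin => /(_ Km0).
have := int01_ge0 Z0; rewrite -/Z; case: (int01 Z) => [z|_ _|//]; last by rewrite leey.
rewrite -!EFinM -EFinD !lee_fin => z0 h.
have hm : m != 0 by rewrite gt_eqF.
have e1 : K * 2 / m * lam - K / m ^+ 2 * (lam + lam ^+ 2) = K * (lam / m).
  by rewrite /m in hm *; field.
have : K * (lam / m) <= z by rewrite -e1; lra.
apply: le_trans; rewrite ler_pM2l// ler_pdivlMr// /m.
by rewrite -/lam in pM; lra.
Qed.

End lepage.

Section haar.
Context {R : realType}.

Let ib (f : R -> R) := (@P01 R).-integrable setT (EFin \o f).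
Let E01 (f : R -> R) : R := fine (int01 f).

Let ibP f : ib f <-> mf01 f /\ (int01 (fun x => `|f x|)%R < +oo)%E.
Proof.
split; first by move=> /integrableP[/measurable_EFinP mf foo].
by move=> [mf foo]; apply/integrableP; split => //; apply/measurable_EFinP.
Qed.

Let ib_mf f : ib f -> mf01 f. Proof. by move/ibP => []. Qed.

Let ib_le f g : mf01 f -> ib g -> (forall x, `|f x| <= `|g x|) -> ib f.
Proof.
move=> mf /ibP[mg goo] fg; apply/ibP; split => //; apply: le_lt_trans goo.
by apply: int01_le => //; apply: measurableT_comp => //; exact: measurable_normr.
Qed.

Let ibZ k f : ib f -> ib (fun x => k * f x).
Proof. by move=> h; apply: (@integrableZl _ _ _ (@P01 R) setT measurableT k (EFin \o f)). Qed.

Let ibD f g : ib f -> ib g -> ib (fun x => f x + g x).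
Proof. by move=> hf hg; apply: (@integrableD _ _ _ (@P01 R) setT measurableT (EFin \o f) (EFin \o g)). Qed.

Let E01E f : ib f -> int01 f = (E01 f)%:E.
Proof. by move=> h; rewrite /E01 fineK//; exact: integrable_fin_num. Qed.

Let E01Z k f : ib f -> E01 (fun x => k * f x) = k * E01 f.
Proof. by move=> h; apply: (@RintegralZl _ _ _ (@P01 R) setT f k). Qed.

Let E01D f g : ib f -> ib g -> E01 (fun x => f x + g x) = E01 f + E01 g.
Proof. by move=> hf hg; apply: (@RintegralD _ _ _ (@P01 R) setT f g). Qed.

Let E01_eq f g : f =1 g -> E01 f = E01 g.
Proof. by move=> fg; congr fine; apply: eq_integral => x _; rewrite fg. Qed.

Let ib_sum n (h : nat -> R -> R) : (forall i, ib (h i)) -> ib (fun x => \sum_(i < n) h i x).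
Proof.
move=> hh; elim: n => [|n IH].
  have -> : (fun x => \sum_(i < 0) h i x) = (fun x => 0 * h 0%N x).
    by apply/funext => x; rewrite big_ord0 mul0r.
  exact: ibZ.
rewrite (_ : (fun x => _) = fun x => \sum_(i < n) h i x + h n x); first exact: ibD.
by apply/funext => x; rewrite big_ord_recr.
Qed.

Let E01_sum n (h : nat -> R -> R) : (forall i, ib (h i)) ->
  E01 (fun x => \sum_(i < n) h i x) = \sum_(i < n) E01 (h i).
Proof.
move=> hh; elim: n => [|n IH].
  rewrite big_ord0 (E01_eq (g := fun=> 0)) ?/E01; last by move=> x; rewrite big_ord0.
  by rewrite int01_cst.
rewrite big_ord_recr /= -IH -E01D//; last exact: ib_sum.
by apply: E01_eq => x; rewrite big_ord_recr.
Qed.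

Let ib_cell k i : ib (\1_(cell k i)).
Proof.
apply/ibP; split; first exact: mf01_cell.
apply: le_lt_trans (ltry 1); rewrite -(int01_cst (1 : R)); apply: int01_le => //.
- by apply: measurableT_comp => //; exact: mf01_cell.
- exact: mf01_cst.
- by move=> x; rewrite indicE; case: (_ \in _); rewrite ?normr0 ?normr1.
Qed.

Let ib_mcell k i f : ib f -> ib (fun x => f x * \1_(cell k i) x).
Proof.
move=> hf; apply: (ib_le _ hf).
  by apply: mf01_mul; [exact: ib_mf|exact: mf01_cell].
by move=> x; rewrite normrM ler_piMr// indicE; case: (_ \in _); rewrite ?normr0 ?normr1.
Qed.

Definition cell_int (k i : nat) (f : R -> R) : R := E01 (fun x => f x * \1_(cell k i) x).

Let cell_intB k i f g : ib f -> ib g ->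
  cell_int k i (fun x => f x - g x) = cell_int k i f - cell_int k i g.
Proof.
move=> hf hg; have e : -1 * cell_int k i g = - cell_int k i g by rewrite mulN1r.
rewrite -e -E01Z; last exact: ib_mcell.
rewrite -E01D; [|exact: ib_mcell|by apply: ibZ; exact: ib_mcell].
by apply: E01_eq => x; rewrite mulrBl mulN1r.
Qed.

Let indic_split k i (x : R) : \1_(cell k i) x = \1_(cell k.+1 i.*2) x + \1_(cell k.+1 i.*2.+1) x :> R.
Proof.
have p0 : 0 < (2 : R) ^+ k by rewrite exprn_gt0.
have h l m : \1_(cell l m) x = (m%:R <= x * 2 ^+ l < m.+1%:R)%R%:R :> R.
  by rewrite indicE mem_setE in_itv /= ler_pdivrMr ?exprn_gt0// ltr_pdivlMr ?exprn_gt0.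
rewrite !h exprSr mulrA; set y := x * 2 ^+ k.
rewrite -[i.*2.+2]/(i.+1.*2) -!mul2n !natrM.
rewrite -(natr1 (2 * i)) natrM -(natr1 i).
have -> : (2 * i%:R <= y * 2) = (i%:R <= y) by rewrite mulrC ler_pM2r.
have -> : (y * 2 < 2 * (i%:R + 1)) = (y < i%:R + 1) by rewrite (mulrC 2) ltr_pM2r.
case: (leP (i%:R : R) y) => h1; case: (ltP y (i%:R + 1)) => h2;
  case: (ltP (y * 2) (2 * i%:R + 1)) => h3 /=; rewrite ?addr0 ?add0r//; lra.
Qed.

Let cell_int_split k i f : ib f -> cell_int k i f = cell_int k.+1 i.*2 f + cell_int k.+1 i.*2.+1 f.
Proof.
move=> hf; rewrite /cell_int -E01D; [|exact: ib_mcell..].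
by apply: E01_eq => x; rewrite -mulrDr -indic_split.
Qed.

Let E01_cell k i : (i < 2 ^ k)%N -> E01 (\1_(cell k i)) = (2 ^+ k)^-1.
Proof.
move=> ik; have p0 : 0 < (2 : R) ^+ k by rewrite exprn_gt0.
rewrite /E01 int01_indic; last exact: measurable_itv.
have -> : (@P01 R) (cell k i) = lebesgue_measure (cell k i).
  rewrite /P01 /= /unif01 /mrestr; congr lebesgue_measure; apply: setIidl => x.
  rewrite /cell /= !in_itv /= => /andP[h1 h2]; rewrite (le_trans _ h1) ?divr_ge0//=.
  apply: ltW; apply: (lt_le_trans h2); rewrite ler_pdivrMr// mul1r -natrX ler_nat.
  exact: ik.
rewrite lebesgue_measure_itv /= lte_fin ltr_pM2r ?invr_gt0// ltr_nat ltnSn /=.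
by rewrite -mulrBl -(natr1 i) addrAC subrr add0r mul1r.
Qed.

Let dstep_sqr k c (x : R) : dstep k c x ^+ 2 = dstep k (fun i => c i ^+ 2) x.
Proof.
have p0 : 0 < (2 : R) ^+ k by rewrite exprn_gt0.
have [[i ci]|h] := pselect (exists i : 'I_(2 ^ k), cell k i x).
  have x01 : 0 <= x < 1.
    move: ci; rewrite /cell /= in_itv /= => /andP[h1 h2].
    rewrite (le_trans _ h1) ?divr_ge0//=; apply: (lt_le_trans h2).
    by rewrite ler_pdivrMr// mul1r -natrX ler_nat ltn_ord.
  by rewrite !dstepE.
have z (c' : nat -> R) : dstep k c' x = 0.
  rewrite /dstep big1// => i _; rewrite indicE memNset ?mulr0// => ci; apply: h.
  by exists i.
by rewrite !z expr0n.
Qed.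

Let ib_sq f : mf01 f -> ib (fun x => f x ^+ 2) -> ib f.
Proof.
move=> mf h; apply: (ib_le mf (g := fun x => 1 + f x ^+ 2)).
  by apply: ibD => //; apply: finite_measure_integrable_cst.
move=> x; rewrite [leRHS]ger0_norm ?addr_ge0 ?sqr_ge0//.
rewrite -real_normK ?num_real//; set y := `|f x|; have : 0 <= y by exact: normr_ge0.
by have := sqr_ge0 (y - 1); lra.
Qed.

Let dist_dstep f k c : mf01 f -> ib (fun x => f x ^+ 2) ->
  int01 (fun x => (f x - dstep k c x) ^+ 2)%R =
  (E01 (fun x => f x ^+ 2) - 2 * (\sum_(i < 2 ^ k) c i * cell_int k i f)
    + (2 ^+ k)^-1 * \sum_(i < 2 ^ k) c i ^+ 2)%:E.
Proof.
move=> mf f2; have hf := ib_sq mf f2.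
pose h i x := (- 2 * c i) * (f x * \1_(cell k i) x) + c i ^+ 2 * \1_(cell k i) x.
have ih i : ib (h i) by apply: ibD; apply: ibZ; [exact: ib_mcell|exact: ib_cell].
have e : (fun x => (f x - dstep k c x) ^+ 2) = fun x => f x ^+ 2 + \sum_(i < 2 ^ k) h i x.
  apply/funext => x; rewrite /h big_split /= -[X in _ + (_ + X)]/(dstep k (fun i => c i ^+ 2) x).
  rewrite -dstep_sqr sqrrB addrA; congr (_ + _ + _).
  rewrite -mulr_natr -mulrN /dstep mulr_sumr mulr_suml; apply: eq_bigr => i _.
  by ring.
have is_ := ib_sum (2 ^ k) ih.
rewrite e E01E; last exact: ibD.
rewrite E01D// E01_sum// -addrA; congr (_ + _)%:E; rewrite /h.
rewrite (eq_bigr (fun i : 'I_(2 ^ k) => - 2 * (c i * cell_int k i f) + (2 ^+ k)^-1 * c i ^+ 2)).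
  by rewrite big_split /= -!mulr_sumr mulNr.
move=> i _; rewrite E01D; [|by apply: ibZ; exact: ib_mcell|by apply: ibZ; exact: ib_cell].
rewrite (E01Z (- 2 * c i) (ib_mcell k i hf)) (E01Z (c i ^+ 2) (ib_cell k i)) E01_cell//.
by rewrite -mulrA [in RHS](mulrC (_^-1)).
Qed.

(** The squared L_2 norm of the conditional expectation of [f] on the dyadic cells of generation
    [k]. *)
Let energy k f := 2 ^+ k * \sum_(i < 2 ^ k) cell_int k i f ^+ 2.

Let energy_le f k : mf01 f -> ib (fun x => f x ^+ 2) -> energy k f <= E01 (fun x => f x ^+ 2).
Proof.
move=> mf f2; have p0 : 0 < (2 : R) ^+ k by rewrite exprn_gt0.
have := dist_dstep k (fun i => 2 ^+ k * cell_int k i f) mf f2.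
have := @int01_ge0 _ (fun x => (f x - dstep k (fun i => 2 ^+ k * cell_int k i f) x) ^+ 2)
  (fun=> sqr_ge0 _).
move=> /[swap] ->; rewrite lee_fin.
have -> : \sum_(i < 2 ^ k) 2 ^+ k * cell_int k i f * cell_int k i f = energy k f.
  by rewrite /energy mulr_sumr; apply: eq_bigr => i _; rewrite -mulrA expr2.
have -> : (2 ^+ k)^-1 * \sum_(i < 2 ^ k) (2 ^+ k * cell_int k i f) ^+ 2 = energy k f.
  rewrite /energy !mulr_sumr; apply: eq_bigr => i _; rewrite exprMn expr2 -!mulrA mulKf//.
by lra.
Qed.

(** The conditional expectation is at least as close to [f] in L_2 as the step function supplied by
    density; completing the square expresses this. *)
Let energy_ge f : mf01 f -> ib (fun x => f x ^+ 2) -> 0 < E01 (fun x => f x ^+ 2) ->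
  exists k, E01 (fun x => f x ^+ 2) / 2 <= energy k f.
Proof.
set N := E01 _ => mf f2 N0.
have sqE (h : R -> R) : (fun x => `|h x| `^ 2) = (fun x => h x ^+ 2).
  by apply/funext => x; rewrite powR_mulrn// real_normK// num_real.
have foo : (int01 (fun x => `|f x| `^ 2)%R < +oo)%E by rewrite sqE E01E// ltry.
have i12 : 1 <= (2 : R) <= 2 by rewrite lexx ler1n.
have [k [c]] := dstep_dense i12 mf foo (divr_gt0 N0 (ltr0Sn R 1)).
set d := (fun i : nat => ratr _); rewrite (sqE (fun x => f x - dstep k d x)) (dist_dstep k d mf f2) lee_fin -/N => h.
exists k; have p0 : 0 < (2 : R) ^+ k by rewrite exprn_gt0.
have : 0 <= (2 ^+ k)^-1 * \sum_(i < 2 ^ k) (2 ^+ k * cell_int k i f - d i) ^+ 2.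
  by apply: mulr_ge0; [rewrite invr_ge0 ltW|apply: sumr_ge0 => i _; exact: sqr_ge0].
have -> : (2 ^+ k)^-1 * \sum_(i < 2 ^ k) (2 ^+ k * cell_int k i f - d i) ^+ 2 =
  energy k f - 2 * (\sum_(i < 2 ^ k) d i * cell_int k i f) + (2 ^+ k)^-1 * \sum_(i < 2 ^ k) d i ^+ 2.
  rewrite /energy !mulr_sumr -sumrN -!big_split /=; apply: eq_bigr => i _.
  by field; rewrite gt_eqF.
by move: h; lra.
Qed.

(** The index [2 ^ k + i] stands for the Haar function on [cell k i], normalised in L_2, and the
    index 0 for the mean. *)
Definition haar_coef (j : nat) (f : R -> R) : R :=
  if j is j'.+1 then
    let k := trunc_log 2 j'.+1 in let i := (j'.+1 - 2 ^ k)%N in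
    Num.sqrt (2 ^+ k) * (cell_int k.+1 i.*2 f - cell_int k.+1 i.*2.+1 f)
  else cell_int 0 0 f.

(** By [2 (a ^ 2 + b ^ 2) = (a + b) ^ 2 + (a - b) ^ 2] in each cell, passing to the next generation
    adds exactly the coefficients of one level. *)
Let haar_energy L f : ib f -> \sum_(j < (2 ^ L)) haar_coef j f ^+ 2 = energy L f.
Proof.
move=> hf; have -> : (2 ^ L = (2 ^ L).-1.+1)%N by rewrite prednK// expn_gt0.
rewrite big_ord_recl /= (sum_levels (fun j => haar_coef j.+1 f ^+ 2)).
elim: L => [|L IH]; first by rewrite big_ord0 addr0 /energy expr0 mul1r expn0 big_ord1.
rewrite big_ord_recr addrA IH /energy expnS mul2n -addnn.
rewrite [X in _ + X](eq_bigr (fun k : 'I_(2 ^ L) => 2 ^+ L *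
   (cell_int L.+1 k.*2 f - cell_int L.+1 k.*2.+1 f) ^+ 2)); last first.
  move=> k _; rewrite /haar_coef trunc_log_level// -addSn prednK ?expn_gt0// addKn.
  by rewrite exprMn sqr_sqrtr// exprn_ge0.
have dbl (h : nat -> R) n : \sum_(i < n + n) h i = \sum_(i < n) (h i.*2 + h i.*2.+1).
  elim: n => [|n IHn]; first by rewrite !big_ord0.
  by rewrite addSn addnS !big_ord_recr /= IHn -addnn addrA.
rewrite (dbl (fun i => cell_int L.+1 i f ^+ 2)) !mulr_sumr -big_split /=; apply: eq_bigr => i _.
by rewrite [cell_int L i f](cell_int_split L i hf) (exprS 2 L); ring.
Qed.

Lemma haar_coefB j f g : mf01 f -> mf01 g ->
  (int01 (fun x => f x ^+ 2)%R < +oo)%E -> (int01 (fun x => g x ^+ 2)%R < +oo)%E ->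
  haar_coef j (fun x => f x - g x) = haar_coef j f - haar_coef j g.
Proof.
move=> mf mg foo goo.
have sq h : mf01 h -> (int01 (fun x => h x ^+ 2)%R < +oo)%E -> ib h.
  move=> mh hoo; apply: ib_sq => //; apply/ibP; split; first exact: measurable_funX.
  by rewrite (_ : (fun x => `|_|) = fun x => h x ^+ 2)//; apply/funext => x; rewrite ger0_norm// sqr_ge0.
have hf := sq _ mf foo; have hg := sq _ mg goo.
by case: j => [|j] /=; rewrite !cell_intB//; ring.
Qed.

Lemma haar_bessel f (N : R) M : mf01 f -> int01 (fun x => f x ^+ 2)%R = N%:E ->
  \sum_(j < M) haar_coef j f ^+ 2 <= N.
Proof.
move=> mf fN; have f2 : ib (fun x => f x ^+ 2).
  apply/ibP; split; first exact: measurable_funX.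
  rewrite (_ : (fun x => `|_|) = fun x => f x ^+ 2); first by rewrite fN ltry.
  by apply/funext => x; rewrite ger0_norm// sqr_ge0.
have -> : N = E01 (fun x => f x ^+ 2) by rewrite /E01 fN.
apply: le_trans (energy_le M mf f2); rewrite -(haar_energy M (ib_sq mf f2)).
rewrite (big_ord_widen _ (fun j => haar_coef j f ^+ 2) (ltnW (ltn_expl M (ltnSn 1)))).
by rewrite big_mkcond /=; apply: ler_sum => j _; case: ifP => // _; exact: sqr_ge0.
Qed.

Lemma haar_lower f (N : R) : mf01 f -> 0 < N -> int01 (fun x => f x ^+ 2)%R = N%:E ->
  exists M, N / 2 <= \sum_(j < M) haar_coef j f ^+ 2.
Proof.
move=> mf N0 fN; have f2 : ib (fun x => f x ^+ 2).
  apply/ibP; split; first exact: measurable_funX.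
  rewrite (_ : (fun x => `|_|) = fun x => f x ^+ 2); first by rewrite fN ltry.
  by apply/funext => x; rewrite ger0_norm// sqr_ge0.
have e : N = E01 (fun x => f x ^+ 2) by rewrite /E01 fN.
rewrite e in N0 *; have [k hk] := energy_ge mf f2 N0.
by exists (2 ^ k)%N; rewrite haar_energy//; exact: ib_sq.
Qed.

End haar.

Section coefficients.
Context {R : realType}.

(** A common interface to the two kinds of coefficients; for r = 2 they are constant in [t]. The
    number of terms in the lower bound may depend on [F], since a limit over [M] is taken later. *)
Lemma coef_family (b r : R) : 0 < b -> b < r -> 1 <= r -> r <= 2 ->
  exists a : nat -> (R -> R) -> R -> R,
  [/\ forall j F, mf01 F -> mf01 (a j F),
      forall j F G, mf01 F -> mf01 G -> (int01 (fun x => `|F x| `^ r)%R < +oo)%E ->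
        (int01 (fun x => `|G x| `^ r)%R < +oo)%E ->
        forall t, a j (fun x => F x - G x) t = a j F t - a j G t &
      exists c C : R, [/\ 0 < c, 0 < C & forall (F : R -> R) (n : R), mf01 F -> 0 < n ->
        int01 (fun x => `|F x| `^ r)%R = (n `^ r)%:E ->
        (forall M, int01 (fun t => (\sum_(j < M) a j F t ^+ 2) `^ (b / 2))%R <= (C * n `^ b)%:E)%E /\
        exists M, ((c * n `^ b)%:E <= int01 (fun t => (\sum_(j < M) a j F t ^+ 2) `^ (b / 2))%R)%E]].
Proof.
move=> b0 br r1; have r0 : 0 < r by lra.
rewrite le_eqVlt => /orP[/eqP r2|r2].
  have sqE (h : R -> R) : (fun x => `|h x| `^ r) = (fun x => h x ^+ 2).
    by apply/funext => x; rewrite r2 powR_mulrn// real_normK// num_real.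
  exists (fun j F _ => haar_coef j F); split.
  - by move=> *; exact: mf01_cst.
  - by move=> j F G mF mG; rewrite !sqE => Foo Goo t; exact: haar_coefB.
  have b2 : 0 <= b / 2 by rewrite divr_ge0// ltW.
  have S0 (F : R -> R) M : 0 <= \sum_(j < M) haar_coef j F ^+ 2.
    by apply: sumr_ge0 => j _; exact: sqr_ge0.
  exists (2^-1 `^ (b / 2)), 1; split => // F n mF n0.
  have nb : (n ^+ 2) `^ (b / 2) = n `^ b.
    rewrite -powR_mulrn ?ltW// -powRrM; congr (_ `^ _).
    by field.
  rewrite sqE r2 powR_mulrn ?ltW// => Fn; split => [M|].
    rewrite int01_cst lee_fin mul1r -nb; apply: ge0_ler_powR => //; rewrite ?nnegrE ?sqr_ge0//.
    exact: haar_bessel.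
  have [M hM] := haar_lower mF (exprn_gt0 2 n0) Fn; exists M.
  rewrite int01_cst lee_fin -nb -powRM ?invr_ge0 ?sqr_ge0//.
  have n2 : 0 <= 2^-1 * n ^+ 2 by rewrite mulr_ge0 ?invr_ge0 ?sqr_ge0.
  by apply: ge0_ler_powR => //; [rewrite nnegrE|rewrite [leLHS]mulrC].
exists (lepage_coef r); split.
- by move=> j F; exact: mf01_lepage.
- by move=> j F G *; rewrite /lepage_coef mulrBr.
set gam := Num.min (2 / r - 1) (1 - b / r).
have gam0 : 0 < gam.
  by rewrite lt_min !subr_gt0 ltr_pdivlMr// mul1r r2 ltr_pdivrMr// mul1r br.
have rho1 : 0 < (2 : R) `^ (- gam) < 1.
  have p1 : 1 < (2 : R) `^ gam by rewrite /powR gt_eqF// expR_gt1 mulr_gt0// ln_gt0// ltr1n.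
  by rewrite powR_gt0//= powRN invf_lt1// (lt_trans _ p1).
exists (4^-1 `^ (b / r) / 2), (1 + 2 / (1 - 2 `^ (- gam))); split.
- by rewrite divr_gt0// powR_gt0 ?invr_gt0.
- by rewrite addr_gt0// divr_gt0//; case/andP: rho1; lra.
move=> F n mF n0 Fn; pose G x := n^-1 * F x.
have mG : mf01 G by apply: mf01_mul => //; exact: mf01_cst.
have G1 : int01 (fun x => `|G x| `^ r)%R = 1%:E.
  transitivity (int01 (fun x => n^-1 `^ r * `|F x| `^ r)%R).
    rewrite /int01; apply: eq_integral => x _; congr EFin.
    by rewrite /G normrM gtr0_norm ?invr_gt0// powRM// invr_ge0 ltW.
  rewrite int01Z ?powR_ge0//; last exact: mf01_powR.
  by rewrite Fn -EFinM -powRM ?invr_ge0 ?ltW// mulVf ?gt_eqF// (congr1 (fun f => f r) (powR1 R)).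
have mZ M : mf01 (fun t => (\sum_(j < M) lepage_coef r j G t ^+ 2) `^ (b / 2)).
  apply: (measurableT_comp (measurable_powR _)); apply: mf01_sum => j.
  by apply: measurable_funX; exact: mf01_lepage.
have sc M : int01 (fun t => (\sum_(j < M) lepage_coef r j F t ^+ 2) `^ (b / 2))%R =
   ((n `^ b)%:E * int01 (fun t => (\sum_(j < M) lepage_coef r j G t ^+ 2) `^ (b / 2))%R)%E.
  rewrite -int01Z ?powR_ge0//; last by move=> x; exact: powR_ge0.
  rewrite /int01; apply: eq_integral => t _; congr EFin.
  have -> : n `^ b = (n ^+ 2) `^ (b / 2).
    by rewrite -powR_mulrn ?ltW// -powRrM; congr (_ `^ _); field.
  rewrite -powRM ?sqr_ge0//; last by apply: sumr_ge0 => j _; exact: sqr_ge0.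
  congr (_ `^ _); rewrite mulr_sumr; apply: eq_bigr => j _; rewrite -exprMn.
  by rewrite /lepage_coef /G mulrCA mulVKf ?gt_eqF.
split => [M|].
  rewrite sc [_ * n `^ b]mulrC EFinM; apply: lee_wpmul2l; first by rewrite lee_fin powR_ge0.
  exact: lepage_upper.
have [M hM] := lepage_lower b0 r1 mG G1; exists M.
by rewrite sc [_ * n `^ b]mulrC EFinM; apply: lee_wpmul2l => //; rewrite lee_fin powR_ge0.
Qed.

End coefficients.

(** * Randomised series and their limits *)

Section series_tails.
Context {R : realType}.

Lemma eq_int01 (f g : R -> R) : f =1 g -> int01 f = int01 g.
Proof. by move=> fg; apply: eq_integral => x _; rewrite fg. Qed.

(** Bounded moments of increasing partial sums make the full sum finite almost everywhere with a
    finite moment, and its power dominates the tails. This gives the Cauchy property of the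
    randomised series. *)
Lemma tail_small (h : nat -> R -> R) (b K : R) : 0 < b ->
  (forall j, mf01 (h j)) -> (forall j t, 0 <= h j t) ->
  (forall M, int01 (fun t => (\sum_(j < M) h j t) `^ b)%R <= K%:E)%E ->
  forall e : R, 0 < e -> exists N, forall m n, (N <= m)%N ->
    (int01 (fun t => (\sum_(m <= j < n) h j t) `^ b)%R <= e%:E)%E.
Proof.
move=> b0 mh h0 hK e e0.
have bn0 : b != 0 by rewrite gt_eqF.
pose s (M : nat) t := \sum_(j < M) h j t.
have ms M : mf01 (s M) by exact: (mf01_sum _ (fun i : 'I_M => mh i)).
have s0 M t : 0 <= s M t by exact: sumr_ge0.
have snd t : nondecreasing_seq (s ^~ t).
  by apply/nondecreasing_seqP => n; rewrite /s big_ord_recr /= lerDl.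
pose V (M : nat) t := ((s M t) `^ b)%:E.
have mV M : measurable_fun setT (V M : measurableTypeR R -> \bar R).
  by apply: mf01E; exact: (mf01_comp (f := fun x => x `^ b) (measurable_powR _) (ms M)).
have V0 M t : (0 <= V M t)%E by rewrite lee_fin powR_ge0.
have Vnd t : nondecreasing_seq (V ^~ t).
  move=> m n mn; rewrite lee_fin; apply: ge0_ler_powR; rewrite ?nnegrE ?(ltW b0)//.
  exact: snd.
pose L t := limn (V ^~ t).
have cV t : cvgn (V ^~ t) by exact: ereal_nondecreasing_is_cvgn.
have VL M t : (V M t <= L t)%E.
  rewrite /L (cvg_lim _ (ereal_nondecreasing_cvgn (Vnd t)))//.
  by apply: ereal_sup_ubound; exists M.
have L0 t : (0 <= L t)%E by exact: le_trans (V0 0%N t) (VL 0%N t).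
have mL : measurable_fun setT (L : measurableTypeR R -> \bar R).
  by apply: (emeasurable_fun_cvg V) => // t _; exact: cV.
have IL : (\int[@P01 R]_t L t <= K%:E)%E.
  rewrite /L monotone_convergence//.
  apply: lime_le; last by apply: nearW => n; exact: hK.
  apply: ereal_nondecreasing_is_cvgn => m n mn; apply: ge0_le_integral => //.
  by move=> t _; exact: Vnd.
pose E := [set x | L x < +oo]%E.
have mE : measurable (E : set (measurableTypeR R)).
  have -> : E = L @^-1` [set y | y < +oo]%E by [].
  rewrite -[X in measurable X]setTI; apply: mL => //.
  have -> : [set y : \bar R | y < +oo]%E = ~` [set +oo%E].
    by apply/seteqP; split => y /=; rewrite ltey => /eqP.
  by apply: measurableC; exact: emeasurable_set1.
have aeE : {ae @P01 R, forall x, E x}.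
  have iL : (@P01 R).-integrable setT L.
    apply/integrableP; split => //.
    under eq_integral do rewrite gee0_abs//.
    by apply: le_lt_trans IL _; rewrite ltry.
  have := integrable_ae measurableT iL => -[Z [mZ Z0 sZ]]; exists Z; split => //.
  apply: subset_trans sZ; apply: subsetC => x /= /(_ Logic.I).
  by rewrite ge0_fin_numE.
pose h' j t := h j t * \1_E t.
have mh' j : mf01 (h' j) by apply: mf01_mul => //; exact: measurable_indic.
have h'0 j t : 0 <= h' j t by rewrite mulr_ge0// indicE; case: (_ \in _).
pose s' (M : nat) t := \sum_(j < M) h' j t.
have s'E M t : s' M t = s M t * \1_E t by rewrite /s' mulr_suml.
have ms' M : mf01 (s' M) by exact: (mf01_sum _ (fun i : 'I_M => mh' i)).
have s'0 M t : 0 <= s' M t by exact: sumr_ge0.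
have s'nd t : nondecreasing_seq (s' ^~ t).
  by apply/nondecreasing_seqP => n; rewrite /s' big_ord_recr /= lerDl.
have s'L M t : (((s' M t) `^ b)%:E <= L t)%E.
  by rewrite s'E indicE; case: (_ \in _); rewrite ?mulr1 ?mulr0 ?powR0//; exact: VL.
have s'b M t : s' M t <= (fine (L t)) `^ b^-1.
  have [tE|tE] := pselect (E t); last by rewrite s'E indicE memNset// mulr0 powR_ge0.
  have Lf : L t \is a fin_num by rewrite ge0_fin_numE.
  have := s'L M t; rewrite -(fineK Lf) lee_fin => hL.
  rewrite -[leLHS]powRr1// -(mulfV bn0) powRrM; apply: ge0_ler_powR; rewrite ?nnegrE ?powR_ge0//.
  - by rewrite invr_ge0 ltW.
  - by rewrite /= fine_ge0.
have cs' t : cvgn (s' ^~ t).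
  apply: nondecreasing_is_cvgn => //; exists ((fine (L t)) `^ b^-1) => _ [n _ <-].
  exact: s'b.
pose W t := limn (s' ^~ t).
have mW : mf01 W by apply: (measurable_fun_cvg (h := s')) => // x _; exact: cs'.
have s'W M t : s' M t <= W t by exact: nondecreasing_cvgn_le.
have W0 t : 0 <= W t by exact: le_trans (s'0 0%N t) (s'W _ _).
have WL t : ((W t `^ b)%:E <= L t)%E.
  have Wb : W t <= (fine (L t)) `^ b^-1 by apply: limr_le => //; apply: nearW => n; exact: s'b.
  have [tE|tE] := pselect (E t); last first.
    have -> : W t = 0; last by rewrite powR0.
    rewrite /W (_ : s' ^~ t = fun=> 0) ?lim_cst//.
    by apply/funext => n; rewrite s'E indicE memNset// mulr0.
  have Lf : L t \is a fin_num by rewrite ge0_fin_numE.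
  rewrite -(fineK Lf) lee_fin -[leRHS]powRr1 ?fine_ge0// -(mulVf bn0) powRrM.
  by apply: ge0_ler_powR; rewrite ?nnegrE ?powR_ge0// ltW.
pose u m t := (W t - s' m t) `^ b.
have mu m : mf01 (u m).
  apply: (mf01_comp (f := fun x => x `^ b) (measurable_powR _)).
  by apply: mf01_sub.
have mWb : mf01 (fun t => W t `^ b).
  exact: (mf01_comp (f := fun x => x `^ b) (measurable_powR _) mW).
have uW m t : 0 <= u m t <= W t `^ b.
  rewrite powR_ge0 /=; apply: ge0_ler_powR; rewrite ?nnegrE ?(ltW b0) ?subr_ge0//.
  by rewrite gerBl.
have Woo : (int01 (fun t => W t `^ b)%R < +oo)%E.
  apply: le_lt_trans (ltry K); apply: le_trans IL; apply: ge0_le_integral => //.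
  - by move=> t _; rewrite lee_fin powR_ge0.
  - exact: mf01E.
have uc : {ae @P01 R, forall x, u ^~ x @ \oo --> (0 : R)}.
  apply: aeW => t.
  have hc : (fun m => W t - s' m t) @ \oo --> (0 : R).
    by rewrite -(subrr (W t)); apply: cvgB; [exact: cvg_cst|exact: cs'].
  have : (fun m => `|W t - s' m t| `^ b) @ \oo --> `|0 : R| `^ b by exact: cvg_norm_powR.
  rewrite normr0 powR0//.
  by under eq_fun do rewrite ger0_norm ?subr_ge0//.
have [N HN] := int01_dct mu mWb uW Woo uc e0; exists N => m n Nm.
apply: le_trans (HN m Nm).
have mt (g : nat -> R -> R) : (forall j, mf01 (g j)) -> mf01 (fun t => (\sum_(m <= j < n) g j t) `^ b).
  move=> mg; apply: (mf01_comp (f := fun x => x `^ b) (measurable_powR _)).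
  exact: mf01_sum.
have -> : int01 (fun t => (\sum_(m <= j < n) h j t) `^ b)%R =
          int01 (fun t => (\sum_(m <= j < n) h' j t) `^ b)%R.
  apply: int01_ae; [exact: mt|exact: mt|by move=> t; exact: powR_ge0|by move=> t; exact: powR_ge0|].
  case: aeE => Z [mZ Z0 sZ]; exists Z; split => //; apply: subset_trans sZ.
  apply: subsetC => x /= xE; congr (_ `^ _); apply: eq_bigr => j _.
  by rewrite /h' indicE mem_set// mulr1.
apply: int01_le => //; first exact: mt.
  by move=> t; exact: powR_ge0.
move=> t; apply: ge0_ler_powR; rewrite ?nnegrE ?(ltW b0) ?subr_ge0//.
  by apply: sumr_ge0.
have [mn|nm] := leqP m n; last by rewrite big_geq ?subr_ge0// ltnW.
rewrite lerBrDr; apply: le_trans (s'W n t).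
rewrite /s' -!(big_mkord xpredT (fun j => h' j t)) addrC.
by rewrite [leRHS](big_cat_nat (n := m)).
Qed.

(** Khintchine's inequality for fixed [evd t], then integrated: one point [t] supplies the
    coefficients through [evd] and independent signs through [odd_digits]. *)
Lemma int01_radmix (d : nat -> R -> R) n (b : R) : 0 < b <= 2 -> (forall j, mf01 (d j)) ->
  ((4^-1)%:E * int01 (fun t => (\sum_(j < n) d j t ^+ 2) `^ (b / 2))%R <=
     int01 (fun t => `|radsum (fun j => d j (evd t)) n (odd_digits t)| `^ b)%R)%E /\
  (int01 (fun t => `|radsum (fun j => d j (evd t)) n (odd_digits t)| `^ b)%R <=
     2%:E * int01 (fun t => (\sum_(j < n) d j t ^+ 2) `^ (b / 2))%R)%E.
Proof.
move=> b02 md.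
pose F x y := `|radsum (fun j => d j x) n y| `^ b.
have F0 x y : 0 <= F x y by exact: powR_ge0.
have mF : measurable_fun setT (fun z : measurableTypeR R * measurableTypeR R => F z.1 z.2).
  apply: (measurableT_comp (measurable_powR _)); apply: measurableT_comp => //.
  apply: measurable_sum => j; apply: measurable_funM.
    exact: (measurableT_comp (md j) measurable_fst).
  exact: (measurableT_comp (mf01_rademacher j) measurable_snd).
have mI : measurable_fun setT (fun x : measurableTypeR R => int01 (F x)).
  apply: (@measurable_fun_fubini_tonelli_F _ _ _ _ _ (@P01 R) (fun z => (F z.1 z.2)%:E)).
    exact/measurable_EFinP.
  by move=> z; rewrite lee_fin.
rewrite (int01_interleave mF F0).
pose G t := (\sum_(j < n) d j t ^+ 2) `^ (b / 2).
have mG : mf01 G.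
  apply: (mf01_comp (f := fun x => x `^ (b / 2)) (measurable_powR _)).
  by apply: mf01_sum => j; apply: measurable_funX; exact: md.
have G0 t : 0 <= G t by exact: powR_ge0.
have Fk x := khintchine (fun j => d j x) n b02.
rewrite -!int01Z//; split; apply: ge0_le_integral => //.
- by move=> x _; rewrite lee_fin mulr_ge0 ?powR_ge0 ?invr_ge0.
- by apply: mf01E; apply: mf01_mul => //; exact: mf01_cst.
- by move=> x _; case: (Fk x).
- by move=> x _; exact: int01_ge0.
- by apply: mf01E; apply: mf01_mul => //; exact: mf01_cst.
- by move=> x _; case: (Fk x).
Qed.

Lemma int01_powRD3 (x y z : R -> R) (b : R) : 0 <= b <= 2 -> mf01 x -> mf01 y -> mf01 z ->
  (int01 (fun t => `|x t + y t + z t| `^ b)%R <=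
   9%:E * (int01 (fun t => `|x t| `^ b)%R + int01 (fun t => `|y t| `^ b)%R + int01 (fun t => `|z t| `^ b)%R))%E.
Proof.
move=> b02 mx my mz.
have p w : forall t : R, 0 <= `|w t : R| `^ b by move=> t; exact: powR_ge0.
have mp w : mf01 w -> mf01 (fun t => `|w t| `^ b) by exact: mf01_powR.
rewrite -int01D; [|exact: mp|exact: mp|exact: p|exact: p].
rewrite -int01D; [|apply: mf01_add; exact: mp|exact: mp|by move=> t; rewrite addr_ge0|exact: p].
have mxyz : mf01 (fun t => `|x t| `^ b + `|y t| `^ b + `|z t| `^ b).
  by apply: mf01_add; [apply: mf01_add|]; exact: mp.
rewrite -int01Z; [|exact: mxyz|by move=> t; rewrite !addr_ge0|by []].
apply: int01_le.
- by apply: mp; apply: mf01_add => //; exact: mf01_add.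
- by apply: mf01_mul => //; exact: mf01_cst.
- exact: p.
- by move=> t; exact: norm_powRD3.
Qed.

(** With the factor 9 of [int01_powRD3], two errors of [k / 36] take away [k / 2] and leave 9 times
    [k / 18]; two errors of [K] give 9 times [3 K]. *)
Lemma int01_two_sided_lim (b k K : R) (S1 S2 : nat -> R -> R) (T1 T2 : R -> R) :
  0 <= b <= 2 -> (forall n, mf01 (S1 n)) -> (forall n, mf01 (S2 n)) -> mf01 T1 -> mf01 T2 ->
  (forall e : R, 0 < e -> exists N, forall n, (N <= n)%N ->
     (int01 (fun x => `|T1 x - S1 n x| `^ b)%R <= e%:E)%E) ->
  (forall e : R, 0 < e -> exists N, forall n, (N <= n)%N ->
     (int01 (fun x => `|T2 x - S2 n x| `^ b)%R <= e%:E)%E) ->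
  0 < k -> 0 < K ->
  (exists N, forall n, (N <= n)%N -> (k%:E <= int01 (fun t => `|S1 n t - S2 n t| `^ b)%R)%E) ->
  (forall n, (int01 (fun t => `|S1 n t - S2 n t| `^ b)%R <= K%:E)%E) ->
  ((k / 18)%:E <= int01 (fun t => `|T1 t - T2 t| `^ b)%R)%E /\
  (int01 (fun t => `|T1 t - T2 t| `^ b)%R <= (27 * K)%:E)%E.
Proof.
move=> b02 mS1 mS2 mT1 mT2 H1 H2 k0 K0 [N3 H3] H4.
have I0 (f g : R -> R) : (0 <= int01 (fun t => `|f t - g t| `^ b)%R)%E.
  by apply: int01_ge0 => t; exact: powR_ge0.
have sym (f g : R -> R) : int01 (fun t => `|f t - g t| `^ b)%R = int01 (fun t => `|g t - f t| `^ b)%R.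
  by apply: eq_int01 => t; rewrite distrC.
split.
  have e0 : 0 < k / 36 by rewrite divr_gt0.
  have [N1 {}H1] := H1 _ e0; have [N2 {}H2] := H2 _ e0.
  pose N := (N1 + N2 + N3)%N.
  have {}H1 := H1 N (leq_trans (leq_addr _ _) (leq_addr _ _)).
  have {}H2 := H2 N (leq_trans (leq_addl _ _) (leq_addr _ _)).
  have {}H3 := H3 N (leq_addl _ _).
  have := int01_powRD3 b02 (mf01_sub (mS1 N) mT1) (mf01_sub mT1 mT2) (mf01_sub mT2 (mS2 N)).
  rewrite (eq_int01 (g := fun t => `|S1 N t - S2 N t| `^ b)); last first.
    by move=> t; congr (`|_| `^ _); ring.
  move/(le_trans H3); rewrite (sym (S1 N)).
  move: H1 H2 (I0 T1 (S1 N)) (I0 T2 (S2 N)) (I0 T1 T2).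
  move: (int01 (fun t => `|T1 t - S1 N t| `^ b)%R) (int01 (fun t => `|T2 t - S2 N t| `^ b)%R)
    (int01 (fun t => `|T1 t - T2 t| `^ b)%R) => [A| |] [B| |] [I| |] //; last by move=> *; exact: leey.
  by rewrite -!EFinD -EFinM !lee_fin => *; lra.
have [N1 {}H1] := H1 _ K0; have [N2 {}H2] := H2 _ K0.
pose N := (N1 + N2)%N.
have {}H1 := H1 N (leq_addr _ _); have {}H2 := H2 N (leq_addl _ _).
have {}H4 := H4 N.
have := int01_powRD3 b02 (mf01_sub mT1 (mS1 N)) (mf01_sub (mS1 N) (mS2 N)) (mf01_sub (mS2 N) mT2).
rewrite (eq_int01 (g := fun t => `|T1 t - T2 t| `^ b)); last first.
  by move=> t; congr (`|_| `^ _); ring.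
rewrite (sym (S2 N)).
move: H1 H2 H4 (I0 T1 (S1 N)) (I0 T2 (S2 N)) (I0 (S1 N) (S2 N)).
move: (int01 (fun t => `|T1 t - S1 N t| `^ b)%R) (int01 (fun t => `|T2 t - S2 N t| `^ b)%R)
  (int01 (fun t => `|S1 N t - S2 N t| `^ b)%R) => [A| |] [B| |] [I| |] //.
rewrite -!EFinD -EFinM !lee_fin => *.
apply: le_trans (_ : (9 * (A + I + B))%:E <= _)%E => //.
by rewrite lee_fin; lra.
Qed.

End series_tails.

Section L01_to_mixture.
Context {R : realType} (r : R) (r1 : 1 <= r) (r2 : r <= 2).
(* [V] stands for [L01 r1]: keeping it abstract prevents costly unfolding *)
Context (V : normedModType R) (Lf : V -> R -> R) (mL : forall f, mf01 (Lf f))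
  (hn : forall f g, int01 (fun x => `|Lf f x - Lf g x| `^ r)%R = (`|f - g| `^ r)%:E).

Lemma norm_mixture (b : R) : 0 < b -> b <= r -> exists S : V -> R -> R,
  (forall f, mf01 (S f)) /\ exists c C : R, [/\ 0 < c, 0 < C & forall f g,
    ((c * `|f - g| `^ b)%:E <= int01 (fun x => `|S f x - S g x| `^ b)%R)%E /\
    (int01 (fun x => `|S f x - S g x| `^ b)%R <= (C * `|f - g| `^ b)%:E)%E].
Proof.
move=> b0; rewrite le_eqVlt => /orP[/eqP br|br].
  by exists Lf; split => //; exists 1, 1; split => // f g; rewrite mul1r br hn.
have b2 : b <= 2 by exact: le_trans (ltW br) r2.
have b02 : 0 < b <= 2 by rewrite b0.
have b20 : 0 < b / 2 by rewrite divr_gt0.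
have [a [ma aB [c [C [c0 C0 aP]]]]] := coef_family b0 br r1 r2.
(* The hypotheses on [Lf] concern differences only, so [Lf 0] is subtracted before coefficients are
   taken. *)
pose D f x := Lf f x - Lf 0 x.
have mD f : mf01 (D f) by exact: mf01_sub.
have Doo f : (int01 (fun x => `|D f x| `^ r)%R < +oo)%E by rewrite hn ltry.
pose d f g x := Lf f x - Lf g x.
have md f g : mf01 (d f g) by exact: mf01_sub.
have aD j f g t : a j (D f) t - a j (D g) t = a j (d f g) t.
  rewrite -aB//; congr (a j _ t); apply/funext => x; rewrite /D /d; ring.
pose W f g (M : nat) := int01 (fun t => (\sum_(j < M) a j (d f g) t ^+ 2) `^ (b / 2))%R.
have nP (f g : V) : f != g -> 0 < `|f - g| by rewrite normr_gt0 subr_eq0.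
have Vle (f g : V) M : f != g -> (W f g M <= (C * `|f - g| `^ b)%:E)%E.
  by move=> /nP fg; have [h _] := aP _ _ (md f g) fg (hn f g); exact: h.
have Vge (f g : V) : f != g -> exists M, ((c * `|f - g| `^ b)%:E <= W f g M)%E.
  by move=> /nP fg; have [_ h] := aP _ _ (md f g) fg (hn f g).
pose S (n : nat) f t := radsum (fun j => a j (D f) (evd t)) n (odd_digits t).
have mS n f : mf01 (S n f).
  apply: mf01_sum => j; apply: mf01_mul.
    exact: (mf01_comp (ma j _ (mD f)) (@measurable_evd R)).
  exact: (mf01_comp (mf01_rademacher j) (@measurable_odd_digits R)).
have SB n f g t : S n f t - S n g t = radsum (fun j => a j (d f g) (evd t)) n (odd_digits t).
  by rewrite /S /radsum -sumrB; apply: eq_bigr => j _; rewrite -mulrBl aD.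
have Sle (f g : V) n : f != g -> (int01 (fun t => `|S n f t - S n g t| `^ b)%R <= (2 * C * `|f - g| `^ b)%:E)%E.
  move=> fg; rewrite (eq_int01 (fun t => congr1 (fun y => `|y| `^ b) (SB n f g t))%R).
  apply: le_trans (int01_radmix n b02 (fun j => ma j _ (md f g))).2 _.
  by rewrite -mulrA EFinM; apply: lee_wpmul2l => //; exact: Vle.
have Sge (f g : V) : f != g -> exists N, forall n, (N <= n)%N ->
    ((4^-1 * (c * `|f - g| `^ b))%:E <= int01 (fun t => `|S n f t - S n g t| `^ b)%R)%E.
  move=> fg; have [M hM] := Vge f g fg; exists M => n Mn.
  rewrite (eq_int01 (fun t => congr1 (fun y => `|y| `^ b) (SB n f g t))%R).
  apply: le_trans (int01_radmix n b02 (fun j => ma j _ (md f g))).1.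
  rewrite EFinM; apply: lee_wpmul2l; first by rewrite lee_fin invr_ge0.
  apply: (le_trans hM); apply: int01_le.
  - apply: (mf01_comp (f := fun x => x `^ (b / 2)) (measurable_powR _)).
    by apply: mf01_sum => j; apply: measurable_funX; exact: ma.
  - apply: (mf01_comp (f := fun x => x `^ (b / 2)) (measurable_powR _)).
    by apply: mf01_sum => j; apply: measurable_funX; exact: ma.
  - by move=> x; exact: powR_ge0.
  - move=> x; have sq0 m : 0 <= \sum_(j < m) a j (d f g) x ^+ 2.
      by apply: sumr_ge0 => j _; exact: sqr_ge0.
    apply: ge0_ler_powR; rewrite ?nnegrE ?(ltW b20)//.
    rewrite (big_ord_widen _ (fun j => a j (d f g) x ^+ 2) Mn) big_mkcond /=.
    by apply: ler_sum => j _; case: ifP => // _; exact: sqr_ge0.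
have SC f : forall e : R, 0 < e -> exists N, forall m n, (N <= m)%N -> (N <= n)%N ->
     (int01 (fun x => `|S m f x - S n f x| `^ b)%R <= e%:E)%E.
  move=> e e0.
  pose h j t := a j (D f) t ^+ 2.
  have mh j : mf01 (h j) by apply: measurable_funX; exact: ma.
  have h0 j t : 0 <= h j t by exact: sqr_ge0.
  pose K : R := C * `|f| `^ b.
  have hK M : (int01 (fun t => (\sum_(j < M) h j t) `^ (b / 2))%R <= K%:E)%E.
    have [f0|f0] := eqVneq f 0; last by have := Vle _ _ M f0; rewrite /K subr0.
    rewrite (eq_int01 (g := fun=> 0)).
      by rewrite int01_cst lee_fin mulr_ge0 ?powR_ge0// ltW.
    move=> t; rewrite big1 ?powR0 ?gt_eqF// => j _.
    by rewrite /h f0 -aD !subrr expr0n.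
  have e2 : 0 < e / 2 by exact: divr_gt0.
  have [N HN] := tail_small b20 mh h0 hK e2; exists N.
  have step m n : (N <= m)%N -> (m <= n)%N ->
     (int01 (fun x => `|S n f x - S m f x| `^ b)%R <= e%:E)%E.
    move=> Nm mn.
    (* Zero coefficients below [m] turn the difference of two partial sums into a Rademacher sum of
       length [n]. *)
    pose d' j t := if (m <= j)%N then a j (D f) t else 0.
    have md' j : mf01 (d' j).
      by rewrite /d'; case: (m <= j)%N; [exact: ma|exact: mf01_cst].
    have e1 t : S n f t - S m f t = radsum (fun j => d' j (evd t)) n (odd_digits t).
      rewrite /S /radsum [X in _ - X](big_ord_widen _ (fun j => a j (D f) (evd t) * rademacher j (odd_digits t)) mn).
      rewrite [X in _ - X]big_mkcond /= -sumrB; apply: eq_bigr => j _; rewrite /d'.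
      by case: (leqP m j) => h1; rewrite ?subr0// subrr mul0r.
    rewrite (eq_int01 (fun t => congr1 (fun y => `|y| `^ b) (e1 t))%R).
    apply: le_trans (int01_radmix n b02 md').2 _.
    have -> : e = 2 * (e / 2) by field.
    rewrite EFinM; apply: lee_wpmul2l => //.
    rewrite (eq_int01 (g := fun t => (\sum_(m <= j < n) h j t) `^ (b / 2))); first exact: HN.
    move=> t; congr (_ `^ _).
    rewrite -(big_mkord xpredT (fun j => d' j t ^+ 2)) (big_cat_nat (n := m))//=.
    rewrite big_nat big1 ?add0r.
      by apply: eq_big_nat => j /andP[mj _]; rewrite /d' mj.
    by move=> j /andP[_ jm]; rewrite /d' leqNgt jm /= expr0n.
  move=> m n Nm Nn; case: (leqP m n) => mn; last exact: step (ltnW mn).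
  rewrite (eq_int01 (fun t => congr1 (fun y => y `^ b) (distrC (S m f t) (S n f t)))%R).
  exact: step.
pose T f := s2val (cid2 (int01_cauchy_cvg b0 (mS ^~ f) (SC f))).
have mT f : mf01 (T f) by exact: (s2valP (cid2 (int01_cauchy_cvg b0 (mS ^~ f) (SC f)))).
have TP f : forall e : R, 0 < e -> exists N, forall n, (N <= n)%N ->
     (int01 (fun x => `|T f x - S n f x| `^ b)%R <= e%:E)%E.
  exact: (s2valP' (cid2 (int01_cauchy_cvg b0 (mS ^~ f) (SC f)))).
exists T; split => //; exists (4^-1 * c / 18), (27 * (2 * C)); split.
- by rewrite divr_gt0// mulr_gt0.
- by rewrite !mulr_gt0.
move=> f g; have [->|fg] := eqVneq f g.
  rewrite subrr normr0 powR0 ?gt_eqF// !mulr0 (eq_int01 (g := fun=> 0)).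
    by rewrite int01_cst.
  by move=> t; rewrite subrr normr0 powR0 ?gt_eqF.
have n0 : 0 < `|f - g| `^ b by apply: powR_gt0; exact: nP.
have b02' : 0 <= b <= 2 by rewrite (ltW b0).
have k0 : 0 < 4^-1 * (c * `|f - g| `^ b) by rewrite !mulr_gt0.
have K0 : 0 < 2 * C * `|f - g| `^ b by rewrite !mulr_gt0.
have := int01_two_sided_lim b02' (mS ^~ f) (mS ^~ g) (mT f) (mT g) (TP f) (TP g) k0 K0
  (Sge f g fg) (fun n => Sle f g n fg).
by rewrite -!mulrA !(mulrC _ 18^-1) !mulrA.
Qed.

End L01_to_mixture.

(** * A sequence of functions as a single function *)

Section slices.
Context {R : realType}.

Let J (n : nat) : set R := `[(2 ^+ n.+1)^-1, (2 ^+ n)^-1[%classic.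

Let mJ n : measurable (J n : set (measurableTypeR R)).
Proof. exact: measurable_itv. Qed.

Let J_disj m n y : J m y -> J n y -> m = n.
Proof.
wlog mn : m n / (m <= n)%N => [hw|].
  by case/orP: (leq_total m n) => mn hm hn; [exact: hw|rewrite (hw n m)].
rewrite /J /= !in_itv /= => /andP[h1 _] /andP[_ h2].
apply/eqP; rewrite eqn_leq mn /= leqNgt; apply/negP => nm.
have : (2 ^+ n)^-1 <= (2 ^+ m.+1)^-1 :> R.
  by rewrite lef_pV2 ?posrE ?exprn_gt0// ler_eXn2l// ltr1n.
lra.
Qed.

Let P_J n : (@P01 R) (J n) = ((2 ^+ n.+1)^-1)%:E.
Proof.
have p0 k : 0 < (2 : R) ^+ k by rewrite exprn_gt0.
have -> : (@P01 R) (J n) = lebesgue_measure (J n).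
  rewrite /P01 /= /unif01 /mrestr; congr lebesgue_measure; apply: setIidl => x.
  rewrite /J /= !in_itv /= => /andP[h1 h2]; rewrite (le_trans _ h1) ?invr_ge0 ?ltW//=.
  by rewrite (lt_le_trans h2)// invf_le1// exprn_ege1// ler1n.
rewrite lebesgue_measure_itv /= lte_fin ltf_pV2 ?posrE// ltr_eXn2l ?ltr1n// ltnSn.
rewrite -EFinB; congr EFin; rewrite exprS; field.
by rewrite gt_eqF.
Qed.

(* [slice w x y] is [w n x] for [y] in the [n]-th dyadic interval *)
Definition slice (w : nat -> R -> R) (x y : R) : R :=
  limn (fun N => \sum_(n < N) w n x * \1_(J n) y).

Let slice_cvg (w : nat -> R -> R) (x y : R) : cvgn (fun N => \sum_(n < N) w n x * \1_(J n) y) /\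
  (forall m, J m y -> slice w x y = w m x) /\ ((forall m, ~ J m y) -> slice w x y = 0).
Proof.
have [[m hm]|h] := pselect (exists m, J m y).
  have e N : (m < N)%N -> \sum_(n < N) w n x * \1_(J n) y = w m x.
    move=> mN; rewrite (bigD1 (Ordinal mN))//= big1 ?addr0.
      by rewrite indicE mem_set// mulr1.
    move=> i im; rewrite indicE memNset ?mulr0// => hi; move/eqP: im; apply.
    by apply: val_inj => /=; exact: J_disj hi hm.
  have c : (fun N => \sum_(n < N) w n x * \1_(J n) y) @ \oo --> w m x.
    by apply: cvg_near_cst; exists m.+1 => // N /= mN; exact/e.
  split; first by apply/cvg_ex; exists (w m x).
  split; last by move/(_ m).
  by move=> m' hm'; rewrite -(J_disj hm hm'); exact/cvg_lim.
have e : (fun N => \sum_(n < N) w n x * \1_(J n) y) = fun=> 0.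
  apply/funext => N; rewrite big1// => i _; rewrite indicE memNset ?mulr0// => hi.
  by apply: h; exists i.
rewrite /slice e; split; first exact: is_cvg_cst.
by split => [m hm|_]; [exfalso; apply: h; exists m|rewrite lim_cst].
Qed.

Let slice_in w x y m : J m y -> slice w x y = w m x.
Proof. by have [_ [h _]] := slice_cvg w x y; exact: h. Qed.

Let slice_out w x y : (forall m, ~ J m y) -> slice w x y = 0.
Proof. by have [_ [_ h]] := slice_cvg w x y; exact: h. Qed.

Lemma sliceB w1 w2 x y :
  slice w1 x y - slice w2 x y = slice (fun n x => w1 n x - w2 n x) x y.
Proof.
have [[m hm]|h] := pselect (exists m, J m y); first by rewrite !(slice_in _ _ hm).
have h' m : ~ J m y by move=> hm; apply: h; exists m.
by rewrite !slice_out// subrr.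
Qed.

Lemma measurable_slice w : (forall n, mf01 (w n)) ->
  measurable_fun setT (fun z : measurableTypeR R * measurableTypeR R => slice w z.1 z.2).
Proof.
move=> mw.
apply: (measurable_fun_cvg (h := fun N z => \sum_(n < N) w n z.1 * \1_(J n) z.2)).
- move=> N; apply: measurable_sum => n; apply: measurable_funM.
    exact: (measurableT_comp (mw n) measurable_fst).
  exact: (measurableT_comp (measurable_indic (mJ n)) measurable_snd).
- by move=> z _; have [h _] := slice_cvg w z.1 z.2; exact: h.
Qed.

Lemma mf01_slice w : (forall n, mf01 (w n)) -> mf01 (fun t => slice w (evd t) (odd_digits t)).
Proof.
move=> mw; apply: (@measurableT_comp _ _ _ _ _ _ (fun z : measurableTypeR R * measurableTypeR R => slice w z.1 z.2)
  _ (fun t => (evd t, odd_digits t)) (measurable_slice mw)).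
by apply/measurable_fun_pairP; split; [exact: measurable_evd|exact: measurable_odd_digits].
Qed.

(** This places L_s(l_s) in L_s[0, 1]: [odd_digits t] selects the coordinate [n] with probability
    [2 ^ - (n + 1)], independently of the point [evd t]. *)
Lemma int01_slice w (s : R) : 0 < s -> (forall n, mf01 (w n)) ->
  int01 (fun t => `|slice w (evd t) (odd_digits t)| `^ s)%R =
  (\int[@P01 R]_x (\sum_(n <oo) ((2 ^+ n.+1)^-1 * `|w n x| `^ s)%:E))%E.
Proof.
move=> s0 mw.
rewrite (int01_interleave (F := fun x y => `|slice w x y| `^ s)); first last.
- by move=> x y; exact: powR_ge0.
- apply: (measurableT_comp (measurable_powR _)); apply: measurableT_comp => //.
  exact: measurable_slice.
apply: eq_integral => x _.
transitivity (\int[@P01 R]_y (\sum_(n <oo) (`|w n x| `^ s * \1_(J n) y)%:E))%E.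
  apply: eq_integral => y _.
  have [[m hm]|h] := pselect (exists m, J m y).
    have p0 n : (0 <= (`|w n x| `^ s * \1_(J n) y)%:E)%E.
      by rewrite lee_fin mulr_ge0 ?powR_ge0// indicE.
    rewrite (slice_in _ _ hm) (@nneseriesD1 _ _ m (fun=> true) (fun n _ => p0 n) isT).
    rewrite indicE mem_set// mulr1 eseries0 ?adde0// => n _ /= nm.
    rewrite indicE memNset ?mulr0// => hn; move/eqP: nm; apply; exact: J_disj hn hm.
  have h' m : ~ J m y by move=> hm; apply: h; exists m.
  rewrite slice_out// normr0 powR0 ?gt_eqF// eseries0// => n _ _.
  by rewrite indicE memNset ?mulr0.
rewrite integral_nneseries//; [|by move=> n; apply: mf01E; apply: mf01_mul;
  [exact: mf01_cst|exact: measurable_indic]].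
apply: eq_eseriesr => n _.
rewrite -/(int01 (fun y => `|w n x| `^ s * \1_(J n) y)%R) int01Z ?powR_ge0//.
- by rewrite int01_indic// P_J -EFinM mulrC.
- exact: measurable_indic.
Qed.

End slices.

Section snowflake_L01.
Context {R : realType} (r : R) (r2 : r <= 2) (r1 : 1 <= r).
Context (V : normedModType R) (Lf : V -> R -> R) (mL : forall f, mf01 (Lf f))
  (hn : forall f g, int01 (fun x => `|Lf f x - Lf g x| `^ r)%R = (`|f - g| `^ r)%:E).

(** The functions of [snowflake] are applied pointwise to the values of [norm_mixture], and the two
    bounds are integrated. That [T 0 = 0] makes every [T f] have a finite norm in L_s. *)
Lemma norm_snowflake (b s : R) : 0 < b -> b <= r -> b <= s -> 1 <= s -> s <= 2 ->
  exists T : V -> R -> R, (forall f, mf01 (T f)) /\ T 0 = (fun=> 0) /\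
  exists c C : R, [/\ 0 < c, 0 < C & forall f g,
    ((c * `|f - g| `^ b)%:E <= int01 (fun x => `|T f x - T g x| `^ s)%R)%E /\
    (int01 (fun x => `|T f x - T g x| `^ s)%R <= (C * `|f - g| `^ b)%:E)%E].
Proof.
move=> b0 br bs s1 s2; have s0 : 0 < s by lra.
have [S [mS [c1 [C1 [c10 C10 SP]]]]] := norm_mixture r1 r2 mL hn b0 br.
have [v [mv [c2 [C2 [c20 C20 vP]]]]] := snowflake b0 bs s1 s2.
(* The [s]-th power of this factor cancels the length [2 ^ - (n + 1)] of the [n]-th interval. *)
pose k (n : nat) : R := (2 ^+ n.+1) `^ s^-1.
have k0 n : 0 <= k n by exact: powR_ge0.
pose w f n x := k n * (v n (S f x) - v n (S 0 x)).
have mw f n : mf01 (w f n).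
  apply: mf01_mul; first exact: mf01_cst.
  by apply: mf01_sub; exact: (mf01_comp (mv n)).
pose T f t := slice (w f) (evd t) (odd_digits t).
exists T; split; first by move=> f; exact: mf01_slice.
split.
  apply/funext => t; have := sliceB (w 0) (w 0) (evd t) (odd_digits t); rewrite subrr => h.
  rewrite /T [RHS]h; congr slice; apply/funext => n; apply/funext => x.
  by rewrite /w subrr mulr0 subr0.
exists (c2 * c1), (C2 * C1); split; [exact: mulr_gt0|exact: mulr_gt0|move=> f g].
have -> : int01 (fun x => `|T f x - T g x| `^ s)%R =
    (\int[@P01 R]_x (\sum_(n <oo) (`|v n (S f x) - v n (S g x)| `^ s)%:E))%E.
  rewrite (eq_int01 (fun t => congr1 (fun y => `|y| `^ s) (sliceB (w f) (w g) (evd t) (odd_digits t)))%R).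
  rewrite int01_slice//; last by move=> n; exact: mf01_sub.
  apply: eq_integral => x _; apply: eq_eseriesr => n _; congr EFin.
  rewrite /w -mulrBr opprB addrA subrK normrM (ger0_norm (k0 n)) powRM//.
  by rewrite /k -powRrM mulVf ?gt_eqF// powRr1 ?exprn_ge0// mulKf// gt_eqF// exprn_gt0.
have mW : measurable_fun setT
    (fun x : measurableTypeR R => \sum_(n <oo) (`|v n (S f x) - v n (S g x)| `^ s)%:E)%E.
  apply: ge0_emeasurable_sum => [n x _ _|n _]; first by rewrite lee_fin powR_ge0.
  apply: mf01E; apply: mf01_powR; apply: mf01_sub; exact: (mf01_comp (mv n)).
have W0 (x : R) : (0 <= \sum_(n <oo) (`|v n (S f x) - v n (S g x)| `^ s)%:E)%E.
  by apply: nneseries_ge0 => n _ _; rewrite lee_fin powR_ge0.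
have mD (K : R) : mf01 (fun x => K * `|S f x - S g x| `^ b).
  by apply: mf01_mul; [exact: mf01_cst|apply: mf01_powR; exact: mf01_sub].
have [S1 S2] := SP f g.
have mSb : mf01 (fun x => `|S f x - S g x| `^ b) by apply: mf01_powR; exact: mf01_sub.
split.
  rewrite -mulrA EFinM.
  apply: (@le_trans _ _ (c2%:E * int01 (fun x => `|S f x - S g x| `^ b)%R)%E).
    by apply: lee_wpmul2l; [rewrite lee_fin ltW|exact: S1].
  rewrite -int01Z ?(ltW c20)//.
  apply: ge0_le_integral => //.
  - by move=> x _; rewrite lee_fin mulr_ge0 ?powR_ge0// ltW.
  - exact: mf01E.
  - by move=> x _; case: (vP (S f x) (S g x)).
rewrite -mulrA EFinM.
apply: (@le_trans _ _ (C2%:E * int01 (fun x => `|S f x - S g x| `^ b)%R)%E); last first.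
  by apply: lee_wpmul2l; [rewrite lee_fin ltW|exact: S2].
rewrite -int01Z ?(ltW C20)//.
apply: ge0_le_integral => //.
- exact: mf01E.
- by move=> x _; case: (vP (S f x) (S g x)).
Qed.

End snowflake_L01.

(** * Coordinatewise reductions *)

Section continuous_reduction.
Context {R : realType}.

Lemma continuous_borel (X Y : topologicalType) (theta : X -> Y) :
  continuous theta -> borel_fun theta.
Proof.
move=> ct B; apply: (@smallest_sub _ _ _ [set A | <<s @open X >> (theta @^-1` A)]).
  have [h0 hC hU] := smallest_sigma_algebra setT (@open X).
  split.
  - by rewrite /= preimage_set0.
  - by move=> A hA; rewrite /= setTD preimage_setC -setTD; exact: hC.
  - by move=> F hF; rewrite /= preimage_bigcup; exact: hU.
by move=> A oA; apply: sub_sigma_algebra; exact: open_comp.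
Qed.

Lemma pseries_transfer (a d : R ^nat) (c C : R) : 0 < c -> (forall n, 0 <= a n) -> (forall n, 0 <= d n) ->
  (forall n, c * a n <= d n) -> (forall n, d n <= C * a n) ->
  (\sum_(0 <= n <oo) (a n)%:E < +oo)%E <-> (\sum_(0 <= n <oo) (d n)%:E < +oo)%E.
Proof.
move=> c0 a0 d0 ca dC; split => h.
  apply: (@le_lt_trans _ _ (\sum_(0 <= n <oo) (C%:E * (a n)%:E))%E).
    by apply: lee_nneseries => [n _ _|n _]; rewrite ?lee_fin// -EFinM lee_fin.
  have C0 : 0 <= `|C| by [].
  apply: (@le_lt_trans _ _ (\sum_(0 <= n <oo) (`|C|%:E * (a n)%:E))%E).
    apply: lee_nneseries => [n _ _|n _]; rewrite -EFinM lee_fin.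
      exact: le_trans (d0 n) (dC n).
    by rewrite ler_wpM2r// ler_norm.
  by rewrite nneseriesZl// ?lte_mul_pinfty// => n _; rewrite lee_fin.
apply: (@le_lt_trans _ _ (\sum_(0 <= n <oo) (c^-1%:E * (d n)%:E))%E).
  apply: lee_nneseries => [n _ _|n _]; first by rewrite lee_fin.
  by rewrite -EFinM lee_fin ler_pdivlMl.
by rewrite nneseriesZl// ?lte_mul_pinfty ?lee_fin ?invr_ge0 ?(ltW c0)// => n _; rewrite lee_fin.
Qed.

Lemma ptws_map_continuous (V W : uniformType) (T : V -> W) : continuous T ->
  continuous (fun x : {ptws nat -> V} => (fun n => T (x n)) : {ptws nat -> W}).
Proof.
move=> cT x.
have FF : Filter ((fun (x : {ptws nat -> V}) n => T (x n)) @ nbhs x).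
  by apply: fmap_filter; exact: nbhs_filter.
apply: (@pointwise_cvgP nat W _ (fun n => T (x n)) FF).2 => n.
apply: (@continuous_comp _ _ _ (fun x : {ptws nat -> V} => x n) T x); last exact: cT.
exact: (@proj_continuous nat (fun _ => V) n x).
Qed.

Lemma holder_reduction (V W : normedModType R) (p q a c C : R) (T : V -> W) :
  0 < a -> 0 < p -> 0 < q -> p = a * q -> 0 < c -> 0 < C ->
  (forall f g, c * `|f - g| `^ a <= `|T f - T g| <= C * `|f - g| `^ a) ->
  borel_reducible (Erel V p) (Erel W q).
Proof.
move=> a0 p0 q0 pq c0 C0 HT.
have cT : continuous T.
  move=> f; apply/cvgrPdist_lt => e e0.
  have eC1 : 0 < (e / C) `^ a^-1 by rewrite powR_gt0// divr_gt0.
  have : \forall g \near f, `|f - g| < (e / C) `^ a^-1.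
    by apply/nbhs_ballP; exists ((e / C) `^ a^-1) => //= g; rewrite -ball_normE.
  apply: filterS => g h2.
  case/andP: (HT f g) => _ h; apply: (le_lt_trans h).
  rewrite mulrC -ltr_pdivlMr//.
  have eC : 0 <= e / C by rewrite divr_ge0 ?ltW.
  rewrite -[ltRHS](powRr1 eC) -(mulVf (lt0r_neq0 a0)) powRrM.
  by apply: gt0_ltr_powR => //; rewrite ?nnegrE ?powR_ge0.
exists (fun x : {ptws nat -> V} => (fun n => T (x n)) : {ptws nat -> W}).
  by apply: continuous_borel; exact: ptws_map_continuous.
move=> x y; rewrite /Erel; apply: (pseries_transfer (c := c `^ q) (C := C `^ q)).
- exact: powR_gt0.
- by move=> n; exact: powR_ge0.
- by move=> n; exact: powR_ge0.
- move=> n; rewrite pq powRrM -powRM ?powR_ge0 ?(ltW c0) ?(ltW C0)//.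
  case/andP: (HT (x n) (y n)) => h _; apply: ge0_ler_powR; rewrite ?nnegrE ?(ltW q0)//.
  by rewrite mulr_ge0 ?powR_ge0 ?(ltW c0) ?(ltW C0).
- move=> n; rewrite pq powRrM -powRM ?powR_ge0 ?(ltW c0) ?(ltW C0)//.
  case/andP: (HT (x n) (y n)) => _ h; apply: ge0_ler_powR; rewrite ?nnegrE ?(ltW q0)//.
  by rewrite mulr_ge0 ?powR_ge0 ?(ltW c0) ?(ltW C0).
Qed.

Lemma L01_reduction (r s p q : R) (r1 : 1 <= r) (r2 : r <= 2) (s1 : 1 <= s) (s2 : s <= 2)
    (p1 : 1 <= p) (q1 : 1 <= q) : p <= q -> s / q <= r / p ->
  borel_reducible (Erel (L01 r1) p) (Erel (L01 s1) q).
Proof.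
move=> pq srpq.
have p0 : 0 < p by lra. have q0 : 0 < q by lra. have s0 : 0 < s by lra.
(* The exponent [a * s = s p / q] is at most [s] because [p <= q], and at most [r] by the condition
   on the quotients. *)
pose a := p / q; have a0 : 0 < a by rewrite divr_gt0.
have b0 : 0 < a * s by exact: mulr_gt0.
have bs : a * s <= s by rewrite ler_piMl ?(ltW s0)// ler_pdivrMr// mul1r.
have br : a * s <= r.
  move: srpq; rewrite ler_pdivlMr// => h; apply: le_trans h.
  by rewrite /a mulrAC [p * s]mulrC mulrAC.
have [T [mT [T0 [c [C [c0 C0 HT]]]]]] :=
  norm_snowflake r2 r1 (@measurable_L01fun R r r1) (fun f g => esym (L01_normE f g)) b0 br bs s1 s2.
have Too f : (int01 (fun x => `|T f x| `^ s)%R < +oo)%E.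
  have [_ h] := HT f 0; apply: le_lt_trans (ltry (C * `|f - 0| `^ (a * s))).
  apply: le_trans h; rewrite T0; apply: int01_le.
  - exact: mf01_powR.
  - by apply: mf01_powR; apply: mf01_sub => //; exact: mf01_cst.
  - by move=> x; exact: powR_ge0.
  - by move=> x; rewrite subr0.
pose TT (f : L01 r1) : L01 s1 := sval (L01_mk s1 (mT f) (Too f)).
have TTE f : ae_eq (@P01 R) setT (L01fun (TT f)) (T f) := svalP (L01_mk s1 (mT f) (Too f)).
have TTn f g : (`|TT f - TT g| `^ s)%:E = int01 (fun x => `|T f x - T g x| `^ s)%R.
  rewrite L01_normE; apply: int01_ae.
  - by apply: mf01_powR; apply: mf01_sub; exact: measurable_L01fun.
  - by apply: mf01_powR; exact: mf01_sub.
  - by move=> x; exact: powR_ge0.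
  - by move=> x; exact: powR_ge0.
  - apply: filterS2 (TTE f) (TTE g) => x /= hf hg.
    by rewrite hf// hg.
apply: (@holder_reduction _ _ p q a (c `^ s^-1) (C `^ s^-1) TT) => //.
- by rewrite /a divfK// gt_eqF.
- exact: powR_gt0.
- exact: powR_gt0.
move=> f g; have [] := HT f g; rewrite -TTn !lee_fin => h1 h2.
have e (x : R) : 0 <= x -> x = (x `^ s) `^ s^-1.
  by move=> x0; rewrite -powRrM mulfV ?gt_eqF// powRr1.
have n0 := powR_ge0 `|f - g| a.
rewrite (e (`|TT f - TT g|))// (e (`|f - g| `^ a))// -!powRM ?powR_ge0 ?(ltW c0) ?(ltW C0)//.
rewrite -powRrM; apply/andP; split; apply: ge0_ler_powR; rewrite ?nnegrE ?invr_ge0 ?powR_ge0 ?(ltW s0)//.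
- by rewrite mulr_ge0 ?powR_ge0 ?(ltW c0) ?(ltW C0).
- by rewrite mulr_ge0 ?powR_ge0 ?(ltW c0) ?(ltW C0).
Qed.

End continuous_reduction.

(** * Baire category *)

Section category_forcing.

Definition in_cyl (s : seq nat) (x : nat -> nat) := mkseq x (size s) = s.

Definition meets (D : seq nat -> Prop) (x : nat -> nat) := exists n, D (mkseq x n).

(* [forces s P]: the set [P] is comeager in the cylinder of [s] *)
Definition forces (s : seq nat) (P : set (nat -> nat)) := exists D : nat -> seq nat -> Prop,
  (forall i v, exists w, D i (s ++ v ++ w)) /\
  forall x, in_cyl s x -> (forall i, meets (D i) x) -> P x.

(** The property of Baire: below every cylinder there is one in which [P] is comeager or meager. *)
Definition baire (P : set (nat -> nat)) :=
  forall s, exists v, forces (s ++ v) P \/ forces (s ++ v) (~` P).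

Lemma in_cyl_cat s v x : in_cyl (s ++ v) x -> in_cyl s x.
Proof.
rewrite /in_cyl size_cat => h; apply: (@eq_from_nth _ 0%N); rewrite size_mkseq// => i si.
move/(congr1 (fun t => nth 0%N t i)): h.
by rewrite !nth_mkseq ?ltn_addr// nth_cat si.
Qed.

Lemma in_cyl_mkseq (x : nat -> nat) n : in_cyl (mkseq x n) x.
Proof. by rewrite /in_cyl size_mkseq. Qed.

Lemma forces_cat s v P : forces s P -> forces (s ++ v) P.
Proof.
move=> [D [dD hD]]; exists D; split => [i w|x /in_cyl_cat]; last exact: hD.
by have [w' h] := dD i (v ++ w); exists w'; move: h; rewrite !catA.
Qed.

Lemma forces_sub s (P Q : set (nat -> nat)) : P `<=` Q -> forces s P -> forces s Q.
Proof. by move=> PQ [D [dD hD]]; exists D; split => // x xs xD; apply: PQ; exact: hD. Qed.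

Lemma forces_all s (P : set (nat -> nat)) : (forall x, in_cyl s x -> P x) -> forces s P.
Proof. by move=> h; exists (fun _ _ => True); split => [i v|x xs _]; [exists [::]|exact: h]. Qed.

Lemma mkseq_prefix (x : nat -> nat) m n : (m <= n)%N -> exists w, mkseq x n = mkseq x m ++ w.
Proof.
move=> mn; exists (drop m (mkseq x n)); rewrite -[LHS](cat_take_drop m); congr (_ ++ _).
apply: (@eq_from_nth _ 0%N); rewrite size_takel ?size_mkseq// => i im.
by rewrite nth_take// !nth_mkseq// (leq_trans im).
Qed.

Lemma in_cyl_prefix s x n : in_cyl s x -> (size s <= n)%N -> exists w, mkseq x n = s ++ w.
Proof. by move=> {2}<- sn; exact: mkseq_prefix. Qed.

Lemma chain_limit (S : nat -> seq nat) : (forall n, exists v, S n.+1 = S n ++ v) ->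
  (forall n, n <= size (S n))%N -> exists x, forall n, in_cyl (S n) x.
Proof.
move=> Sc Sn.
have Sle m n : (m <= n)%N -> exists v, S n = S m ++ v.
  move=> /subnK <-; elim: (n - m)%N => [|k [v IH]]; first by exists [::]; rewrite cats0.
  by have [w e] := Sc (k + m)%N; exists (v ++ w); rewrite addSn e IH catA.
exists (fun n => nth 0%N (S n.+1) n) => n.
apply: (@eq_from_nth _ 0%N); rewrite size_mkseq// => i isn; rewrite nth_mkseq//.
have [ni|ni] := leqP n i.+1.
  by have [v ->] := Sle _ _ ni; rewrite nth_cat isn.
have [v ->] := Sle _ _ (ltnW ni); rewrite nth_cat ifT//; exact: Sn.
Qed.

(** The Baire category theorem. Each step also appends a 0, so that lengths grow and the chain of
    prefixes determines a point. *)
Lemma forces_nonempty s P : forces s P -> exists2 x, in_cyl s x & P x.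
Proof.
move=> [D [dD hD]].
have step i t : exists t', (exists v, t' = t ++ v) /\
    ((exists v, t = s ++ v) -> exists n, D i (take n t')) /\ (size t < size t')%N.
  have [[v ->]|h] := pselect (exists v, t = s ++ v).
    have [w hw] := dD i v; exists (s ++ v ++ w ++ [:: 0%N]); split.
      by exists (w ++ [:: 0%N]); rewrite catA.
    split; last by rewrite !size_cat /= ltn_add2l addnA addn1 ltnS leq_addr.
    by move=> _; exists (size (s ++ v ++ w)); rewrite !catA -catA take_size_cat// !catA.
  exists (rcons t 0%N); split; first by exists [:: 0%N]; rewrite cats1.
  by split; [|rewrite size_rcons].
pose f i t := sval (cid (step i t)).
have fP i t := svalP (cid (step i t)).
pose S := fix S n := if n is m.+1 then f m (S m) else s.
have Sc n : exists v, S n.+1 = S n ++ v by have [h _] := fP n (S n).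
have Sn n : (n <= size (S n))%N.
  elim: n => // n IH; have [_ [_ h]] := fP n (S n); exact: leq_ltn_trans IH h.
have Ss n : exists v, S n = s ++ v.
  elim: n => [|n [v IH]]; first by exists [::]; rewrite cats0.
  by have [w e] := Sc n; exists (v ++ w); rewrite e IH catA.
have [x xS] := chain_limit Sc Sn; exists x; first exact: (xS 0%N).
apply: hD; first exact: (xS 0%N).
move=> i; have [_ [h _]] := fP i (S i); have [n hn] := h (Ss i).
rewrite -/(f i (S i)) -[f _ _]/(S i.+1) -(xS i.+1) in hn.
exists (minn n (size (S i.+1))); move: hn.
have [w] := mkseq_prefix x (geq_minr n (size (S i.+1))).
set m := minn _ _ => e; congr (D i _).
case: (leqP n (size (S i.+1))) => h1.
  have en : m = n by apply/minn_idPl.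
  by rewrite e en take_size_cat// size_mkseq.
have en : m = size (S i.+1) by apply/minn_idPr/ltnW.
by rewrite en take_oversize// size_mkseq ltnW.
Qed.

(* the dense sets attached to all pairs [(i, t)] such that [t] forces [P i] *)
Lemma generic_family (I : countType) (P : I -> set (nat -> nat)) :
  exists G : nat -> seq nat -> Prop, (forall m v, exists w, G m (v ++ w)) /\
  forall x, (forall m, meets (G m) x) -> forall i t, in_cyl t x -> forces t (P i) -> P i x.
Proof.
pose D i t j u := if pselect (forces t (P i)) is left h then sval (cid h) j u else True.
pose E (z : I * seq nat * nat) u :=
  (size z.1.2 <= size u)%N /\ ((exists w, u = z.1.2 ++ w) -> exists n, D z.1.1 z.1.2 z.2 (take n u)).
pose G m u := if unpickle m is Some z then E z u else True.
have dE z v : exists w, E z (v ++ w).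
  case: z => [[i t] j]; pose v' := v ++ nseq (size t) 0%N.
  have [[w e]|h] := pselect (exists w, v' = t ++ w); last first.
    exists (nseq (size t) 0%N); split; first by rewrite size_cat size_nseq leq_addl.
    by move=> hh; exfalso; exact: h.
  rewrite /E /= /D; case: pselect => hf; last first.
    exists (nseq (size t) 0%N); split; first by rewrite size_cat size_nseq leq_addl.
    by move=> _; exists 0%N.
  have [d _] := svalP (cid hf); have [w' hw'] := d j w.
  exists (nseq (size t) 0%N ++ w'); rewrite catA -/v' e; split.
    by rewrite size_cat size_cat -addnA leq_addr.
  by move=> _; exists (size ((t ++ w) ++ w')); rewrite take_size -catA.
exists G; split.
  by move=> m v; rewrite /G; case: unpickle => [z|]; [exact: dE|exists [::]].
move=> x xG i t xt ft.
have [_ h] := svalP (cid ft); apply: h => // j.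
have [n] := xG (pickle (i, t, j)); rewrite /G pickleK => -[/=]; rewrite size_mkseq => tn h.
have [k] := h (in_cyl_prefix xt tn).
rewrite /D; case: pselect => // ft'; rewrite (Prop_irrelevance ft' ft) => hk.
have e : take k (mkseq x n) = mkseq x (minn k n) by rewrite /mkseq -map_take take_iota.
by exists (minn k n); rewrite -e.
Qed.

(** The dense sets of even rank ask for a prefix that forces [P i]; those of odd rank are the
    generic ones, which make true whatever a prefix forces. *)
Lemma forces_bigcap s (P : nat -> set (nat -> nat)) :
  (forall i v, exists w, forces (s ++ v ++ w) (P i)) -> forces s (fun x => forall i, P i x).
Proof.
move=> h; have [G [dG gG]] := generic_family P.
exists (fun m => if odd m then G m./2
   else fun u => exists t w, u = t ++ w /\ forces t (P m./2)); split.
  move=> m v; case: ifP => om.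
    by have [w hw] := dG m./2 (s ++ v); exists w; rewrite catA.
  by have [w hw] := h m./2 v; exists w; exists (s ++ v ++ w), [::]; rewrite cats0.
move=> x xs xD i.
have [n] := xD i.*2; rewrite odd_double doubleK => -[t [w [e ft]]].
apply: (gG x _ i t) => //.
  by move=> m; have := xD m.*2.+1; rewrite /= odd_double /= uphalf_double.
by apply: (@in_cyl_cat _ w); rewrite -e; exact: in_cyl_mkseq.
Qed.

Lemma baireC P : baire P -> baire (~` P).
Proof. by move=> h s; have [v hv] := h s; exists v; rewrite setCK; case: hv; [right|left]. Qed.

(** If no cylinder below [s] forces any [P i], then for each [i] the cylinders that force its
    complement are dense below [s], and the intersection of the complements is forced. *)
Lemma baire_bigcup (P : nat -> set (nat -> nat)) :
  (forall i, baire (P i)) -> baire (fun x => exists i, P i x).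
Proof.
move=> h s; have [[i [v f]]|nf] := pselect (exists i v, forces (s ++ v) (P i)).
  by exists v; left; apply: forces_sub f => x; exists i.
exists [::]; right; rewrite cats0.
apply: (@forces_sub _ (fun x => forall i, (~` P i) x)); first by move=> x hx [i /hx].
apply: forces_bigcap => i v; have [w [f|f]] := h i (s ++ v).
  by exfalso; apply: nf; exists i, (v ++ w); rewrite catA.
by exists w; rewrite catA.
Qed.

Lemma baire_open (P : set (nat -> nat)) :
  (forall x, P x -> exists n, forall y, in_cyl (mkseq x n) y -> P y) -> baire P.
Proof.
move=> h s; have [[v hv]|nv] := pselect (exists v, forall y, in_cyl (s ++ v) y -> P y).
  by exists v; left; exact: forces_all.
exists [::]; right; rewrite cats0; apply: forces_all => x xs Px; apply: nv.
have [n hn] := h x Px.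
have [w e] := in_cyl_prefix xs (leq_maxl (size s) n).
exists w => y; rewrite -e => hy; apply: hn.
by have [w' e'] := mkseq_prefix x (leq_maxr (size s) n); rewrite e' in hy; exact: in_cyl_cat hy.
Qed.

Lemma baire_sigma_algebra : sigma_algebra setT [set P | baire P].
Proof.
split.
- by apply: baire_open => x.
- by move=> A bA; rewrite setTD; exact: baireC.
- move=> F bF; have := baire_bigcup bF; congr baire.
  by apply/seteqP; split => x [i]; exists i.
Qed.

(** Otherwise the complements of all [P i] would be forced together, against the category theorem.
    It turns a bound that depends on the point into one that holds generically on a cylinder. *)
Lemma forces_cover s (P : nat -> set (nat -> nat)) : (forall i, baire (P i)) ->
  (forall x, exists i, P i x) -> exists v i, forces (s ++ v) (P i).
Proof.
move=> bP cP; apply: contrapT => nf.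
have : forces s (fun x => forall i, (~` P i) x).
  apply: forces_bigcap => i v; have [w [f|f]] := bP i (s ++ v).
    by exfalso; apply: nf; exists (v ++ w), i; rewrite catA.
  by exists w; rewrite catA.
by move/forces_nonempty => [x _ hx]; have [i] := cP x; exact: hx.
Qed.

End category_forcing.

(** * Series with bounded partial sums *)

Section bounded_sums.
Context {R : realType}.

Definition bsum (u : nat -> R) := exists K, forall n, \sum_(i < n) u i <= K.

Lemma bsumP (u : nat -> R) : (forall n, 0 <= u n) ->
  bsum u <-> (\sum_(0 <= n <oo) (u n)%:E < +oo)%E.
Proof.
move=> u0; split => [[K hK]|h].
  by apply: le_lt_trans (ltry K); exact: nneseries_partial_le.
have f : (\sum_(0 <= n <oo) (u n)%:E)%E \is a fin_num.
  by rewrite ge0_fin_numE//; apply: nneseries_ge0 => n _ _; rewrite lee_fin.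
exists (fine (\sum_(0 <= n <oo) (u n)%:E)%E) => n.
rewrite -lee_fin fineK// -sumEFin -(big_mkord xpredT (fun i => (u i)%:E)).
by apply: nneseries_lim_ge => i _ _; rewrite lee_fin.
Qed.

Lemma bsum_le (u v : nat -> R) (C : R) : 0 <= C ->
  (forall n, u n <= C * v n) -> bsum v -> bsum u.
Proof.
move=> C0 uv [K hK]; exists (C * K) => n.
apply: (@le_trans _ _ (\sum_(i < n) C * v i)); first by apply: ler_sum => i _.
by rewrite -mulr_sumr ler_wpM2l.
Qed.

Lemma bsumD (u v : nat -> R) : bsum u -> bsum v -> bsum (fun n => u n + v n).
Proof. by move=> [K hK] [L hL]; exists (K + L) => n; rewrite big_split lerD. Qed.

Lemma bsum_tail (u : nat -> R) : (forall n, 0 <= u n) -> bsum u -> forall e : R, 0 < e ->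
  exists l, forall n, \sum_(l <= i < n) u i <= e.
Proof.
move=> u0 [K hK] e e0.
pose A := [set x | exists n : nat, x = \sum_(i < n) u i].
have hA : has_sup A.
  split; first by exists 0, 0%N; rewrite big_ord0.
  by exists K => _ [n ->].
have [_ [l ->] hl] := sup_adherent e0 hA.
exists l => n; have [ln|nl] := leqP l n; last by rewrite big_geq ?ltW// ltnW.
have : \sum_(i < n) u i <= sup A by apply: ub_le_sup; [case: hA|exists n].
rewrite -(big_mkord xpredT u) (big_cat_nat (n := l))//= big_mkord.
by move: hl; lra.
Qed.

End bounded_sums.

(** * Borel reductions and the property of Baire *)

Section measurability_of_reductions.
Context {R : realType} {V W : normedModType R}.

(* sets with the Baire property form the sigma-algebra of [baire_space] *)
Definition baire_space := g_sigma_algebraType [set P : set (nat -> nat) | baire P].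

Lemma baire_measurable (P : set baire_space) : measurable P -> baire P.
Proof. by apply: (smallest_sub baire_sigma_algebra). Qed.

Lemma measurable_baire (P : set baire_space) : baire P -> measurable P.
Proof. by move=> bP; exact: sub_sigma_algebra. Qed.

Lemma measurable_baire_fun (f : baire_space -> R) :
  (forall c, baire [set x | c < f x]) -> measurable_fun setT f.
Proof.
move=> h; apply: (measurability _ (RGenOInfty.measurableE R)).
move=> _ [_ [c ->] <-]; rewrite setTI; apply: measurable_baire.
by have := h c; congr baire; apply/seteqP; split => x /=; rewrite in_itv /= andbT.
Qed.

Variables (theta : {ptws nat -> V} -> {ptws nat -> W}) (btheta : borel_fun theta).
Variables (Q : nat -> V) (phi : (nat -> nat) -> nat -> nat).
Hypothesis phic : forall x n, exists m, forall y, in_cyl (mkseq x m) y -> phi y n = phi x n.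

Let g (x : nat -> nat) : nat -> W := theta (fun n => Q (phi x n)).

(** The map from [x] to the sequence of the [Q (phi x n)] is continuous, as a finite prefix of [x]
    decides each coordinate; Borel preimages under [theta] thus pull back to sets with the property
    of Baire. *)
Lemma baire_reduction (B : set {ptws nat -> W}) : open B -> baire [set x | B (g x)].
Proof.
move=> oB.
have : <<s @open {ptws nat -> V} >> (theta @^-1` B) by apply: btheta; exact: sub_sigma_algebra.
apply: (@smallest_sub _ _ _ [set A | baire [set x | A (fun n => Q (phi x n))]]).
  have [h0 hC hU] := baire_sigma_algebra; split.
  - exact: h0.
  - by move=> A hA; have := hC _ hA; rewrite !setTD.
  - by move=> F hF; have := hU _ hF; congr baire; apply/seteqP; split => x [i]; exists i.
move=> A oA; apply: baire_open => x Ax; apply: contrapT => hn.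
have {}hn n : exists y, in_cyl (mkseq x n) y /\ ~ A (fun k => Q (phi y k)).
  apply: contrapT => h; apply: hn; exists n => y hy.
  by apply: contrapT => nA; apply: h; exists y.
pose y n := sval (cid (hn n)).
have yP n := svalP (cid (hn n)).
have cy : (fun n => (fun k => Q (phi (y n) k)) : {ptws nat -> V}) @ \oo -->
    ((fun k => Q (phi x k)) : {ptws nat -> V}).
  have FF : Filter ((fun n => (fun k => Q (phi (y n) k)) : nat -> V) @ \oo) by apply: fmap_filter.
  apply: (@pointwise_cvgP nat V _ (fun k => Q (phi x k)) FF).2 => k.
  apply: cvg_near_cst; have [m hm] := phic x k; exists m => // n /= mn.
  rewrite hm//; have [w e] := mkseq_prefix x mn.
  have : in_cyl (mkseq x n) (y n) by have [] := yP n.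
  by rewrite e => /in_cyl_cat.
have : \forall n \near \oo, A (fun k => Q (phi (y n) k)).
  by apply: (cy A); exact: open_nbhs_nbhs.
by move=> [N _ hN]; have [_] := yP N; apply; apply: hN => /=.
Qed.

Lemma measurable_dist (i : nat) (w : W) :
  measurable_fun setT ((fun x => `|g x i - w|) : baire_space -> R).
Proof.
apply: measurable_baire_fun => c.
apply: (baire_reduction (B := [set z : {ptws nat -> W} | c < `|z i - w|])).
have cN : continuous (fun z : {ptws nat -> W} => `|z i - w|).
  move=> z; apply: (@continuous_comp _ _ _ (fun z : {ptws nat -> W} => z i) (fun u => `|u - w|)).
    exact: (@proj_continuous nat (fun _ => W) i z).
  apply: cvg_norm; apply: cvgB; [exact: cvg_id|exact: cvg_cst].
rewrite (_ : [set z | _] = (fun z : {ptws nat -> W} => `|z i - w|) @^-1` [set t | c < t])//.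
by apply: open_comp.
Qed.

End measurability_of_reductions.

Section measurable_pairs.
Context {R : realType} {W : normedModType R} (d : nat -> W).
Hypothesis dd : forall (w : W) (e : R), 0 < e -> exists n, `|w - d n| < e.

(** Over a dense sequence, [|u - v|] is the supremum of [|u - d n| - |v - d n|], so measurable
    distances to fixed points are enough. *)
Lemma measurable_dist2 (u v : (nat -> nat) -> W) :
  (forall w, measurable_fun setT ((fun x => `|u x - w|) : baire_space -> R)) ->
  (forall w, measurable_fun setT ((fun x => `|v x - w|) : baire_space -> R)) ->
  measurable_fun setT ((fun x => `|u x - v x|) : baire_space -> R).
Proof.
move=> mu mv; apply: measurable_baire_fun => c.
have -> : [set x | c < `|u x - v x|] = fun x => exists n, c < `|u x - d n| - `|v x - d n|.
  apply/seteqP; split => x /=.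
    move=> h; have e0 : 0 < (`|u x - v x| - c) / 2 by lra.
    have [n hn] := dd (v x) e0; exists n.
    have := ler_distD (d n) (u x) (v x); rewrite (distrC (d n)); lra.
  move=> [n hn]; have := ler_distD (v x) (u x) (d n); lra.
apply: baire_bigcup => n; apply: baire_measurable.
have mB : measurable_fun setT ((fun x => `|u x - d n| - `|v x - d n|) : baire_space -> R).
  exact: measurable_funB.
rewrite (_ : (fun x => _) = (fun x => `|u x - d n| - `|v x - d n|) @^-1` `]c, +oo[%classic); last first.
  by apply/seteqP; split => x /=; rewrite in_itv /= andbT.
by rewrite -[X in measurable X]setTI; apply: mB => //; exact: measurable_itv.
Qed.

End measurable_pairs.

(** * Additive reductions *)

Section additive_reductions.
Context {R : realType} {V W : normedModType R}.

Lemma normD3_powR (x y z : W) (b : R) : 0 <= b ->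
  `|x + y + z| `^ b <= 3 `^ b * (`|x| `^ b + `|y| `^ b + `|z| `^ b).
Proof.
move=> b0; pose m : R := Num.max (Num.max `|x| `|y|) `|z|.
have xm : `|x| <= m by rewrite /m !le_max lexx.
have ym : `|y| <= m by rewrite /m !le_max lexx orbT.
have zm : `|z| <= m by rewrite /m !le_max lexx !orbT.
have m0 : 0 <= m by exact: le_trans xm.
have h1 : `|x + y + z| `^ b <= (3 * m) `^ b.
  apply: ge0_ler_powR; rewrite ?nnegrE ?mulr_ge0//.
  by have := ler_normD (x + y) z; have := ler_normD x y; lra.
apply: (le_trans h1); rewrite powRM// ler_wpM2l ?powR_ge0//.
have hx := powR_ge0 `|x| b; have hy := powR_ge0 `|y| b; have hz := powR_ge0 `|z| b.
by rewrite /m /Num.max; case: ifP => _; [lra|case: ifP => _; lra].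
Qed.

Lemma half_pow_small (e : R) : 0 < e -> exists M : nat, (2 : R)^-1 ^+ M <= e.
Proof.
move=> e0; exists (Num.trunc e^-1).+1; rewrite exprVn invf_ple ?posrE ?exprn_gt0//.
apply: ltW; apply: (lt_le_trans (truncnS_gt _)); rewrite -natrX ler_nat.
exact: ltnW (ltn_expl _ (ltnSn 1)).
Qed.

(** Each demand extends the word found for the previous ones, and monotonicity keeps those
    satisfied: a single word serves finitely many prefixes. *)
Lemma fusion (T : eqType) (A : seq T) (Phi : T -> seq nat -> Prop) :
  (forall t, t \in A -> forall u, exists v, Phi t (u ++ v)) ->
  (forall t u v, Phi t u -> Phi t (u ++ v)) ->
  forall u, exists v, forall t, t \in A -> Phi t (u ++ v).
Proof.
move=> + mon; elim: A => [|a A IH] dA u; first by exists [::].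
have [v hv] := dA a (mem_head _ _) u.
have [w hw] := IH (fun t tA => dA t (mem_behead (s := a :: A) tA)) (u ++ v).
exists (v ++ w) => t; rewrite catA in_cons => /predU1P[->|]; last exact: hw.
exact: mon.
Qed.

Lemma common_bound (T : eqType) (A : seq T) (Psi : T -> nat -> Prop) l0 :
  (forall t, t \in A -> exists l, Psi t l) ->
  (forall t l l', (l <= l')%N -> Psi t l -> Psi t l') ->
  exists l, (l0 <= l)%N /\ forall t, t \in A -> Psi t l.
Proof.
move=> + mon; elim: A => [|a A IH] hA; first by exists l0.
have [l [l0l hl]] := IH (fun t tA => hA t (mem_behead (s := a :: A) tA)).
have [l' hl'] := hA a (mem_head _ _); exists (maxn l l').
split; first exact: leq_trans (leq_maxl _ _).
move=> t; rewrite in_cons => /predU1P[->|/hl]; [apply: mon hl'; exact: leq_maxr|].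
by apply: mon; exact: leq_maxl.
Qed.

Definition splice (r : seq nat) (a : nat -> nat) n := if (n < size r)%N then nth 0%N r n else a n.

Lemma in_cyl_nth s x n : in_cyl s x -> (n < size s)%N -> x n = nth 0%N s n.
Proof. by move=> <-; rewrite size_mkseq => h; rewrite nth_mkseq. Qed.

Lemma splice_cont r x n : exists m, forall y, in_cyl (mkseq x m) y -> splice r y n = splice r x n.
Proof.
exists n.+1 => y hy; rewrite /splice; case: ifP => // _.
by rewrite (in_cyl_nth (n := n) hy) ?nth_mkseq// size_mkseq.
Qed.

Context (p q : R) (p0 : 0 < p) (q1 : 1 <= q).
Context (theta : {ptws nat -> V} -> {ptws nat -> W}) (btheta : borel_fun theta).
Hypothesis hred : forall x y, Erel V p x y <-> Erel W q (theta x) (theta y).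
Context (d : nat -> W) (dd : forall (w : W) (e : R), 0 < e -> exists n, `|w - d n| < e).
Context (Q : nat -> V) (F : nat -> seq nat) (base : nat -> nat) (baseF : forall k, base k \in F k).

Let q0 : 0 < q. Proof. exact: lt_le_trans q1. Qed.
Let g (a : nat -> nat) : nat -> W := theta (fun n => Q (a n)).
Let dW (a b : nat -> nat) (n : nat) : R := `|g a n - g b n| `^ q.
Let dV (a b : nat -> nat) (n : nat) : R := `|Q (a n) - Q (b n)| `^ p.
Let dW0 a b n : 0 <= dW a b n. Proof. exact: powR_ge0. Qed.
Let dV0 a b n : 0 <= dV a b n. Proof. exact: powR_ge0. Qed.
Let eps k : R := 2^-1 ^+ k.
Let eps0 k : 0 < eps k. Proof. by rewrite exprn_gt0// invr_gt0. Qed.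

Let hred' a b : bsum (dV a b) <-> bsum (dW a b).
Proof. rewrite (bsumP (dV0 a b)) (bsumP (dW0 a b)); exact: hred. Qed.

(* [P1 (r, r', l, k)]: exchanging the prefixes [r] and [r'] changes little the image past [l];
   [P2 (i, n, k)]: the [i]-th coordinate of the image is close to [d n] *)
Let P1 (z : seq nat * seq nat * nat * nat) : set (nat -> nat) :=
  fun a => forall n, \sum_(z.1.2 <= i < n) dW (splice z.1.1.1 a) (splice z.1.1.2 a) i <= eps z.2.
Let P2 (z : nat * nat * nat) : set (nat -> nat) := fun a => `|g a z.1.1 - d z.1.2| < eps z.2.

Let mg r i w : measurable_fun setT ((fun x => `|g (splice r x) i - w|) : baire_space -> R).
Proof. exact: (measurable_dist btheta Q (splice_cont r)). Qed.

Let baire_lt (f : baire_space -> R) c : measurable_fun setT f -> baire [set x | f x < c].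
Proof.
move=> mf; apply: baire_measurable.
rewrite (_ : [set x | _] = f @^-1` `]-oo, c[%classic); last first.
  by apply/seteqP; split => x /=; rewrite in_itv /=.
by rewrite -[X in measurable X]setTI; apply: mf => //; exact: measurable_itv.
Qed.

Let bP1 z : baire (P1 z).
Proof.
have -> : P1 z = ~` [set a | exists n,
    (eps z.2 < \sum_(z.1.2 <= i < n) dW (splice z.1.1.1 a) (splice z.1.1.2 a) i)].
  apply/seteqP; split => a /=; first by move=> h [n]; rewrite ltNge h.
  by move=> h n; rewrite leNgt; apply/negP => hn; apply: h; exists n.
apply: baireC; apply: baire_bigcup => n.
have mf : measurable_fun setT
    ((fun a => - \sum_(z.1.2 <= i < n) dW (splice z.1.1.1 a) (splice z.1.1.2 a) i) : baire_space -> R).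
  apply: measurable_funN; apply: measurable_sum => i.
  apply: (measurableT_comp (measurable_powR _)).
  by apply: (measurable_dist2 dd) => w; exact: mg.
have := baire_lt (- eps z.2) mf; congr baire.
by apply/seteqP; split => a /=; rewrite ltrN2.
Qed.

Let bP2 z : baire (P2 z).
Proof. exact: (baire_lt _ (mg [::] _ _)). Qed.

Let P1_mono r r' k l l' : (l <= l')%N -> P1 (r, r', l, k) `<=` P1 (r, r', l', k).
Proof.
move=> ll a h n; rewrite /=; have [l'n|nl'] := leqP l' n; last first.
  by rewrite big_geq ?ltW// ltnW.
apply: le_trans (h n) => /=; rewrite [leRHS](big_cat_nat (n := l'))//= lerDr.
by apply: sumr_ge0.
Qed.

(** Sequences that differ in finitely many places are equivalent in the source, so their images are
    equivalent and the tails of the series of distances tend to 0. *)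
Let cover1 r r' k a : size r = size r' -> exists l, P1 (r, r', l, k) a.
Proof.
move=> rr; suff hs : bsum (dV (splice r a) (splice r' a)).
  by have [l hl] := bsum_tail (dW0 _ _) ((hred' _ _).1 hs) (eps0 k); exists l.
exists (\sum_(i < size r) dV (splice r a) (splice r' a) i) => n.
have z i : (size r <= i)%N -> dV (splice r a) (splice r' a) i = 0.
  by move=> ri; rewrite /dV /splice -rr ltnNge ri /= subrr normr0 powR0// gt_eqF.
have le m : \sum_(i < n) dV (splice r a) (splice r' a) i <= \sum_(i < n + m) dV (splice r a) (splice r' a) i.
  by rewrite big_split_ord /= lerDl sumr_ge0.
apply: (le_trans (le (size r))); rewrite addnC big_split_ord /= gerDl.
by rewrite big1// => i _; rewrite z//= leq_addr.
Qed.

Let G := sval (cid (generic_family (fun z : (seq nat * seq nat * nat * nat) + (nat * nat * nat) =>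
  match z with inl z => P1 z | inr z => P2 z end))).
Let dG m v : exists w, G m (v ++ w).
Proof. by rewrite /G; case: cid => /= G' [h _]; exact: h. Qed.
Let gG1 x : (forall m, meets (G m) x) -> forall z t, in_cyl t x -> forces t (P1 z) -> P1 z x.
Proof. by rewrite /G; case: cid => /= G' [_ h] xG z t; exact: (h x xG (inl z) t). Qed.
Let gG2 x : (forall m, meets (G m) x) -> forall z t, in_cyl t x -> forces t (P2 z) -> P2 z x.
Proof. by rewrite /G; case: cid => /= G' [_ h] xG z t; exact: (h x xG (inr z) t). Qed.

(** The word [u] follows each prefix in [A]. Generic continuations of one prefix then have images
    within [eps k] in total on the first [l] coordinates, and exchanging two prefixes changes the
    remaining coordinates by at most [eps k]. *)
Let good k (A : seq (seq nat)) u l :=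
  [/\ forall r, r \in A -> exists t w, r ++ u = t ++ w /\ G k t,
      forall r r', r \in A -> r' \in A -> forces (r ++ u) (P1 (r, r', l, k)) &
      exists M, [/\ l%:R * (2 * eps M) <= eps k, 2 * eps M <= 1 &
        forall r, r \in A -> forall i, (i < l)%N -> exists n, forces (r ++ u) (P2 (i, n, M))]].

Let step k (A : seq (seq nat)) l0 : exists ul : seq nat * nat,
  (forall r r', r \in A -> r' \in A -> size r = size r') -> (l0 < ul.2)%N /\ good k A ul.1 ul.2.
Proof.
(* Prefixes of different lengths never occur in the construction; a default value there makes the
   choice [f] a total function. *)
have [sA|nsA] := pselect (forall r r', r \in A -> r' \in A -> size r = size r'); last first.
  by exists ([::], 0%N) => /nsA.
have [u1 h1] : exists u, forall r, r \in A -> exists t w, r ++ u = t ++ w /\ G k t.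
  apply: (fusion (A := A) (Phi := fun r u => exists t w, r ++ u = t ++ w /\ G k t) _ _ [::]).
    move=> r rA u; have [w hw] := dG k (r ++ u); exists w, (r ++ u ++ w), [::].
    by rewrite cats0; split => //; rewrite catA.
  by move=> r u v [t [w [e h]]]; exists t, (w ++ v); split => //; rewrite !catA e.
pose AA := [seq (r, r') | r <- A, r' <- A].
have inAA r r' : (r, r') \in AA -> r \in A /\ r' \in A.
  by move=> /allpairsP[z [h h' [-> ->]]].
have [u2 h2] : exists u, forall z, z \in AA -> exists l, forces (z.1 ++ u1 ++ u) (P1 (z.1, z.2, l, k)).
  apply: (fusion (A := AA) (Phi := fun z u => exists l, forces (z.1 ++ u1 ++ u) (P1 (z.1, z.2, l, k))) _ _ [::]).
    move=> [r r'] /inAA[rA r'A] u /=.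
    have [v [l hl]] := forces_cover (r ++ u1 ++ u) (fun l => bP1 (r, r', l, k))
      (fun a => cover1 k a (sA _ _ rA r'A)).
    by exists v, l; move: hl; rewrite -!catA.
  by move=> z u v [l hl]; exists l; have := forces_cat v hl; rewrite -!catA.
have [l [l0l hl]] := common_bound (Psi := fun z l => forces (z.1 ++ u1 ++ u2) (P1 (z.1, z.2, l, k))) l0.+1 h2
  (fun z l l' ll => forces_sub (P1_mono ll)).
(* Then [l] distances of at most [2 * eps M] add up to at most [eps k], and each is at most 1, which
   lets [low_close] drop the power [q >= 1]. *)
have [M hM] := half_pow_small (divr_gt0 (eps0 k) (ltr0Sn R (2 * l.+1))).
have eM : 2 * l.+1%:R * eps M <= eps k.
  move: hM; rewrite ler_pdivlMr// => h; apply: le_trans h; rewrite mulrC ler_wpM2l ?(ltW (eps0 M))//.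
  by rewrite -natrM ler_nat.
have e1 : eps k <= 1 by rewrite exprn_ile1 ?invr_ge0// invf_le1// ler1n.
pose AI := [seq (r, i) | r <- A, i <- iota 0 l].
have inAI r i : (r, i) \in AI -> r \in A /\ (i < l)%N.
  by move=> /allpairsP[z [h h' [-> ->]]]; rewrite mem_iota in h'.
have [u3 h3] : exists u, forall z, z \in AI -> exists n, forces (z.1 ++ u1 ++ u2 ++ u) (P2 (z.2, n, M)).
  apply: (fusion (A := AI) (Phi := fun z u => exists n, forces (z.1 ++ u1 ++ u2 ++ u) (P2 (z.2, n, M))) _ _ [::]).
    move=> [r i] /inAI[rA il] u /=.
    have [v [n hn]] := forces_cover (r ++ u1 ++ u2 ++ u) (fun n => bP2 (i, n, M))
      (fun a => dd (g a i) (eps0 M)).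
    by exists v, n; move: hn; rewrite -!catA.
  by move=> z u v [n hn]; exists n; have := forces_cat v hn; rewrite -!catA.
exists (u1 ++ u2 ++ u3, l) => _ /=; split => //; split.
- move=> r rA; have [t [w [e h]]] := h1 r rA; exists t, (w ++ u2 ++ u3); split => //.
  by rewrite !catA e -!catA.
- move=> r r' rA r'A; have h : (r, r') \in AA by apply: allpairs_f.
  by have := forces_cat u3 (hl _ h); rewrite -!catA.
- exists M; split.
  + apply: le_trans eM; rewrite mulrCA mulrA ler_wpM2r ?(ltW (eps0 M))// ler_wpM2l//.
    by rewrite ler_nat.
  + apply: le_trans e1; apply: le_trans eM; rewrite ler_wpM2r ?(ltW (eps0 M))//.
    by rewrite ler_peMr// ler1n.
  + move=> r rA i il; apply: (h3 (r, i)); apply: allpairs_f => //.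
    by rewrite mem_iota.
Qed.

Let f k A l0 := sval (cid (step k A l0)).
Let fP k A l0 := svalP (cid (step k A l0)).

(* The choices in [F 0], ..., [F k] are coded by the sequences of [A k], where the generic fillers
   [u] separate them; [h x] below codes the whole sequence [x]. *)
Let st := fix st k : seq (seq nat) * nat := if k is k'.+1 then
   ([seq r ++ (f k' (st k').1 (st k').2).1 ++ [:: i] | r <- (st k').1, i <- F k],
    (f k' (st k').1 (st k').2).2)
  else ([seq [:: i] | i <- F 0%N], 0%N).
Let A k := (st k).1.
Let lam k := (st k).2.
Let u k := (f k (A k) (lam k)).1.

Let sA k : forall r r', r \in A k -> r' \in A k -> size r = size r'.
Proof.
elim: k => [|k IH] r r'.
  by move=> /mapP[i _ ->] /mapP[j _ ->].
move=> /allpairsP[z [z1 _ ->]] /allpairsP[z' [z1' _ ->]].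
by rewrite !size_cat (IH _ _ z1 z1').
Qed.

Let lam_lt k : (lam k < lam k.+1)%N.
Proof. by have [h _] := @fP k (A k) (lam k) (@sA k). Qed.

Let goodk k : good k (A k) (u k) (lam k.+1).
Proof. by have [_ h] := @fP k (A k) (lam k) (@sA k). Qed.

Let lam_ge k : (k <= lam k)%N.
Proof. by elim: k => // k IH; exact: leq_ltn_trans IH (lam_lt k). Qed.

Let S x := fix S k := if k is k'.+1 then S k' ++ u k' ++ [:: x k] else [:: x 0%N].

Let inF x := forall k : nat, x k \in F k.

Let SA x k : inF x -> S x k \in A k.
Proof.
move=> xF; elim: k => [|k IH]; first by apply/mapP; exists (x 0%N).
by apply/allpairsP; exists (S x k, x k.+1); split => //=; exact: xF.
Qed.

Let size_S x x' k : size (S x k) = size (S x' k).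
Proof. by elim: k => //= k IH; rewrite !size_cat IH. Qed.

Let S_size x k : (k < size (S x k))%N.
Proof.
elim: k => //= k IH; rewrite !size_cat /= addnA addn1 ltnS.
by apply: leq_trans IH _; exact: leq_addr.
Qed.

Let h x := sval (cid (chain_limit (S := S x) (fun n => ex_intro _ (u n ++ [:: x n.+1]) erefl)
  (fun n => ltnW (S_size x n)))).
Let hS x n : in_cyl (S x n) (h x).
Proof. exact: (svalP (cid (chain_limit (S := S x) (fun n => ex_intro _ (u n ++ [:: x n.+1]) erefl)
  (fun n => ltnW (S_size x n))))). Qed.

Let hSu x n : in_cyl (S x n ++ u n) (h x).
Proof. by have := hS x n.+1; rewrite /= catA => /in_cyl_cat. Qed.

Let hG x : inF x -> forall m, meets (G m) (h x).
Proof.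
move=> xF m; have [hg _ _] := goodk m; have [t [w [e Gt]]] := hg _ (SA m xF).
by exists (size t); have := hSu x m; rewrite e => /in_cyl_cat ->.
Qed.

(** When [x] and [x'] agree after [k], [h x'] arises from [h x] by exchanging a prefix, since the
    words [u] are common to all choices. *)
Let tail_close x x' k : inF x -> inF x' -> (forall j, (k < j)%N -> x j = x' j) ->
  forall n, \sum_(lam k.+1 <= i < n) dW (h x) (h x') i <= eps k.
Proof.
move=> xF x'F xx' n.
have [_ hf _] := goodk k.
have := gG1 (hG xF) (hSu x k) (hf _ _ (SA k xF) (SA k x'F)); move/(_ n) => /=.
have s1 : splice (S x k) (h x) = h x.
  apply/funext => i; rewrite /splice; case: ifP => // ik.
  by rewrite (in_cyl_nth (hS x k) ik).
have s2 : splice (S x' k) (h x) = h x'.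
  apply/funext => i; rewrite /splice; case: ltnP => ik.
    by rewrite (in_cyl_nth (hS x' k) ik).
  have [w [e e']] : exists w, S x (k + i) = S x k ++ w /\ S x' (k + i) = S x' k ++ w.
    elim: (i) => [|j [w [e e']]]; first by exists [::]; rewrite addn0 !cats0.
    exists (w ++ u (k + j) ++ [:: x (k + j).+1]); rewrite addnS /= e e'.
    by rewrite (xx' (k + j).+1) ?ltnS ?leq_addr// !catA.
  have i1 : (i < size (S x (k + i)))%N by apply: leq_ltn_trans (S_size _ _); exact: leq_addl.
  rewrite (in_cyl_nth (hS x (k + i)) i1) (in_cyl_nth (hS x' (k + i))); last by rewrite -(size_S x).
  by rewrite e e' !nth_cat (size_S x x' k) ltnNge ik.
by rewrite s1 s2.
Qed.

(** When [x] and [x'] agree up to [k], both codes extend the same [S x k ++ u k], which forces each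
    low coordinate of the image to be near one fixed [d n]. *)
Let low_close x x' k : inF x -> inF x' -> (forall j, (j <= k)%N -> x j = x' j) ->
  \sum_(i < lam k.+1) dW (h x) (h x') i <= eps k.
Proof.
move=> xF x'F xx'.
have eS : S x k = S x' k.
  elim: k xx' => [|k IH] xx' /=; first by rewrite xx'.
  by rewrite IH ?xx'// => j jk; apply: xx'; exact: leq_trans (leqnSn _).
have [_ _ [M [hM hM1 hf]]] := goodk k.
apply: le_trans hM; rewrite -[X in _ <= X%:R * _]card_ord -sum1_card natr_sum mulr_suml.
apply: ler_sum => i _; rewrite mul1r.
have [n hn] := hf _ (SA k xF) i (ltn_ord i).
have a1 := gG2 (hG xF) (hSu x k) hn.
have a2 : P2 (i : nat, n, M) (h x') by apply: gG2 (hG x'F) _ _ _ hn; rewrite eS; exact: hSu.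
rewrite /P2 /= in a1 a2.
have hd : `|g (h x) i - g (h x') i| <= 2 * eps M.
  have := ler_distD (d n) (g (h x) i) (g (h x') i); rewrite (distrC (d n)); lra.
rewrite /dW; apply: (@le_trans _ _ `|g (h x) i - g (h x') i|) => //.
have [->|n0] := eqVneq `|g (h x) i - g (h x') i| 0; first by rewrite powR0// gt_eqF.
rewrite -[leRHS]powRr1//; apply: ger_powR => //.
by rewrite lt_def n0 normr_ge0 (le_trans hd).
Qed.

Let upd k a : nat -> nat := fun j => if j == k then a else base j.

Let updF k a : a \in F k -> inF (upd k a).
Proof. by move=> aF j; rewrite /upd; case: eqP => [->|]. Qed.

Let q00 : 0 <= q. Proof. exact: ltW. Qed.

(** The sequence [z] is [base] before [k] and [x] from [k] on. Passing from [x] to [z] costs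
    [eps (k - 1) = 2 * eps k] past [lam k], and nothing if [k = 0]; passing from [z] to
    [upd k (x k)] costs [eps k] below [lam k.+1]. Up to a summable error, block [k] of the image
    depends on [x k] alone. *)
Let block_close x k : inF x ->
  \sum_(lam k <= i < lam k.+1) dW (h x) (h (upd k (x k))) i <= 3 `^ q * 3 * eps k.
Proof.
move=> xF; pose z j := if (j < k)%N then base j else x j.
have zF : inF z by move=> j; rewrite /z; case: ifP.
apply: (@le_trans _ _ (\sum_(lam k <= i < lam k.+1) 3 `^ q * (dW (h x) (h z) i + dW (h z) (h (upd k (x k))) i))).
  apply: ler_sum => i _; rewrite /dW.
  have -> : g (h x) i - g (h (upd k (x k))) i =
      (g (h x) i - g (h z) i) + (g (h z) i - g (h (upd k (x k))) i) + 0.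
    by rewrite addr0 addrA subrK.
  by apply: le_trans (normD3_powR _ _ _ q00) _; rewrite normr0 powR0 ?addr0// gt_eqF.
rewrite -mulr_sumr -mulrA ler_wpM2l ?powR_ge0// big_split /=.
have h2 : \sum_(lam k <= i < lam k.+1) dW (h z) (h (upd k (x k))) i <= eps k.
  have : \sum_(i < lam k.+1) dW (h z) (h (upd k (x k))) i <= eps k.
    apply: low_close => //; first exact: updF.
    move=> j; rewrite leq_eqVlt /z /upd => /predU1P[->|jk]; first by rewrite ltnn eqxx.
    by rewrite jk; case: eqP => // jk'; move: jk; rewrite jk' ltnn.
  apply: le_trans; rewrite -(big_mkord xpredT (dW (h z) (h (upd k (x k))))).
  by rewrite [leRHS](big_cat_nat (n := lam k))//= ?lerDr ?sumr_ge0//; exact: ltnW.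
have h1 : \sum_(lam k <= i < lam k.+1) dW (h x) (h z) i <= 2 * eps k.
  case: k @z zF h2 => [|k] z zF _.
    rewrite (_ : z = x) ?big1 ?mulr_ge0// => i _.
    by rewrite /dW subrr normr0 powR0// gt_eqF.
  rewrite /eps exprS mulrA divff// mul1r; apply: tail_close => // j kj.
  by rewrite /z ltnNge kj.
by move: h1 h2; lra.
Qed.

Let bsum_block x : inF x ->
  bsum (fun k => \sum_(lam k <= i < lam k.+1) dW (h x) (h (upd k (x k))) i).
Proof.
move=> xF; apply: (@bsum_le _ _ eps (3 `^ q * 3)); first by rewrite mulr_ge0// powR_ge0.
  by move=> n; exact: block_close.
by exists 2 => n; exact: sum_half_pow.
Qed.

Let bsum_cofinal (v w : nat -> R) (N : nat -> nat) : (forall n, 0 <= v n) ->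
  (forall k, k <= N k)%N -> (forall k, \sum_(i < N k) v i = \sum_(i < k) w i) -> bsum v <-> bsum w.
Proof.
move=> v0 kN e; split => -[K hK]; exists K => n; first by rewrite -e.
apply: le_trans (hK n); rewrite -e (big_ord_widen _ v (kN n)) big_mkcond /=.
by apply: ler_sum => i _; case: ifP.
Qed.

(** The image is cut at the [lam k], and [T k] records block [k] with all choices but the [k]-th set
    to [base]. By [bsum_block] this replacement does not affect convergence. *)
Lemma additive_reduction : exists (L : nat -> nat) (T : nat -> nat -> nat -> W),
  forall x x' : nat -> nat, (forall k, x k \in F k) -> (forall k, x' k \in F k) ->
  (bsum (fun k => `|Q (x k) - Q (x' k)| `^ p) <->
   bsum (fun k => \sum_(n < L k) `|T k (x k) n - T k (x' k) n| `^ q)).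
Proof.
exists (fun k => lam k.+1 - lam k)%N, (fun k a n => g (h (upd k a)) (n + lam k)).
move=> x x' xF x'F.
(* The words [u k] are the same in [h x] and [h x'] and contribute nothing to the distance. *)
have -> : bsum (fun k => `|Q (x k) - Q (x' k)| `^ p) <-> bsum (dV (h x) (h x')).
  have e k : \sum_(i < size (S x k)) dV (h x) (h x') i = \sum_(i < k.+1) `|Q (x i) - Q (x' i)| `^ p.
    pose ds s s' : R := \sum_(i < size s) `|Q (nth 0%N s i) - Q (nth 0%N s' i)| `^ p.
    have ds_cat s s' v v' : size s = size s' -> ds (s ++ v) (s' ++ v') = ds s s' + ds v v'.
      move=> ss; rewrite /ds size_cat big_split_ord /=; congr (_ + _); apply: eq_bigr => i _ /=.
        by rewrite !nth_cat -ss ltn_ord.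
      by rewrite !nth_cat -ss ltnNge leq_addr /= addKn.
    have -> : \sum_(i < size (S x k)) dV (h x) (h x') i = ds (S x k) (S x' k).
      apply: eq_bigr => i _; rewrite /dV (in_cyl_nth (hS x k))// (in_cyl_nth (hS x' k))//.
      by rewrite -(size_S x).
    elim: k => [|k IH]; first by rewrite /ds /= !big_ord1.
    rewrite big_ord_recr /= -IH ds_cat; last exact: size_S.
    congr (_ + _); rewrite ds_cat// {1}/ds big1 ?add0r; last first.
      by move=> i _; rewrite subrr normr0 powR0// gt_eqF.
    by rewrite /ds /= big_ord1.
  symmetry; apply: (bsum_cofinal (N := fun k => if k is k'.+1 then size (S x k') else 0%N)) => //.
    by case => // k; exact: S_size.
  by case => [|k]; [rewrite !big_ord0|exact: e].
rewrite hred'.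
pose B k := \sum_(lam k <= i < lam k.+1) dW (h x) (h x') i.
have -> : bsum (dW (h x) (h x')) <-> bsum B.
  apply: (bsum_cofinal (N := lam)) => // k.
  rewrite -(big_mkord xpredT (dW (h x) (h x'))).
  elim: k => [|k IH]; first by rewrite big_ord0 big_geq.
  by rewrite big_ord_recr /= -IH -big_cat_nat// ltnW.
pose E y k := \sum_(lam k <= i < lam k.+1) dW (h y) (h (upd k (y k))) i.
pose D k := \sum_(lam k <= i < lam k.+1) dW (h (upd k (x k))) (h (upd k (x' k))) i.
have -> : (fun k => \sum_(n < lam k.+1 - lam k) `|g (h (upd k (x k))) (n + lam k) -
    g (h (upd k (x' k))) (n + lam k)| `^ q) = D.
  have shift (v : nat -> R) m n : \sum_(m <= i < n) v i = \sum_(i < n - m) v (i + m)%N.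
    by rewrite -{1}[m]add0n big_addn big_mkord.
  by apply/funext => k; rewrite /D shift.
have Ex := bsum_block xF; have Ex' := bsum_block x'F.
have sw a b i : dW a b i = dW b a i by rewrite /dW distrC.
have tri a b c e i : dW a e i <= 3 `^ q * (dW a b i + dW b c i + dW c e i).
  rewrite /dW (_ : g a i - g e i = (g a i - g b i) + (g b i - g c i) + (g c i - g e i)).
    exact: normD3_powR.
  by rewrite !addrA !subrK.
split => hB.
  apply: (@bsum_le _ _ (fun k => E x k + B k + E x' k) (3 `^ q)); first exact: powR_ge0.
    move=> k; rewrite /E /B -!big_split /= mulr_sumr; apply: ler_sum => i _.
    by apply: le_trans (tri _ (h x) (h x') _ _) _; rewrite (sw (h (upd k (x k)))).
  by apply: bsumD => //; exact: bsumD.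
apply: (@bsum_le _ _ (fun k => E x k + D k + E x' k) (3 `^ q)); first exact: powR_ge0.
  move=> k; rewrite /E /B -!big_split /= mulr_sumr; apply: ler_sum => i _.
  apply: le_trans (tri _ (h (upd k (x k))) (h (upd k (x' k))) _ _) _.
  by rewrite (sw (h (upd k (x' k)))).
by apply: bsumD => //; exact: bsumD.
Qed.

End additive_reductions.

(** * Comparison of exponents through badly embeddable spaces *)

Section exponent_comparison.
Context {R : realType} {V W : normedModType R} (p q : R) (p1 : 1 <= p) (q1 : 1 <= q).
Context (d : nat -> W) (dd : forall (w : W) (e : R), 0 < e -> exists n, `|w - d n| < e).

Let p0 : 0 < p. Proof. exact: lt_le_trans p1. Qed.

Definition pow_dist (L : nat) (T : nat -> nat -> W) (a b : nat) : R :=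
  \sum_(n < L) `|T a n - T b n| `^ q.

(* Every map of the finite metric space [S] into [l_q(W)] stretches some long pair at most
   [C (2 ^ n) ^ B] times as much as some short pair, in the [q]-th power of the distance. *)
Definition poor_embedding (A B C : R) := forall n : nat, exists (S : seq nat) (P : nat -> V),
  forall L T, exists a b a' b', [/\ a \in S, b \in S, a' \in S & b' \in S] /\
    [/\ `|P a - P b| <= 1, (2 ^+ n) `^ A <= `|P a' - P b'| `^ p &
        pow_dist L T a' b' <= C * (2 ^+ n) `^ B * pow_dist L T a b].

Lemma bsum_levels (u : nat -> R) (K : R) : (forall n, 0 <= u n) ->
  (forall I, \sum_(i < I) \sum_(c < 2 ^ i) u ((2 ^ i).-1 + c)%N <= K) -> bsum u.
Proof.
move=> u0 h; exists K => n; apply: le_trans (h n); rewrite -sum_levels.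
have n2 : (n <= (2 ^ n).-1)%N by rewrite -ltnS prednK ?expn_gt0// ltn_expl.
rewrite (big_ord_widen _ u n2) big_mkcond /=.
by apply: ler_sum => i _; case: ifP.
Qed.

Lemma bsum_geometric (rho : R) : 0 < rho < 1 -> forall n, \sum_(i < n) rho `^ i%:R <= 2 / (1 - rho).
Proof.
move=> r01 n; have := two_sided_geometric 0 n r01; apply: le_trans.
by apply: ler_sum => i _; rewrite addr0 ger0_norm.
Qed.

Lemma exponents_le (A B C : R) : 0 <= B -> 0 <= C -> poor_embedding A B C ->
  borel_reducible (Erel V p) (Erel W q) -> A <= B.
Proof.
move=> B0 C0 geo [theta btheta hred]; rewrite leNgt; apply/negP => BA.
(* A rational [l / m] strictly between [B] and [A]. With [nn i] about [i m / l], the power [B] of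
   [2 ^ nn i] grows geometrically slower than [2 ^ i] and the power [A] geometrically faster. *)
have [m [l [m0 l0 Bml lAm]]] : exists m l : nat, [/\ (0 < m)%N, (0 < l)%N, B * m%:R < l%:R & l%:R < A * m%:R].
  have AB0 : 0 < A - B by lra.
  pose m := (Num.trunc (A - B)^-1).+1; pose l := (Num.trunc (B * m%:R)).+1.
  have Bm0 : 0 <= B * m%:R by rewrite mulr_ge0.
  exists m, l; split => //; first exact: truncnS_gt.
  have h1 : 1 < (A - B) * m%:R.
    by rewrite -ltr_pdivrMl// mulr1; exact: truncnS_gt.
  have h2 : (Num.trunc (B * m%:R))%:R <= B * m%:R by case/andP: (truncn_itv Bm0).
  by rewrite /l -natr1; move: h1 h2; rewrite mulrBl; lra.
have lR : 0 < l%:R :> R by rewrite ltr0n.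
pose eta := A * m%:R / l%:R - 1.
have eta0 : 0 < eta by rewrite /eta subr_gt0 ltr_pdivlMr// mul1r.
pose lev k := trunc_log 2 k.+1.
pose nn i := (m * (i %/ l))%N.
have nn_le i : (nn i)%:R <= m%:R / l%:R * i%:R :> R.
  rewrite /nn natrM -mulrA ler_wpM2l// ler_pdivlMl// -natrM ler_nat mulnC.
  exact: leq_trunc_div.
have nn_ge i : m%:R / l%:R * i%:R - m%:R <= (nn i)%:R :> R.
  rewrite lerBlDr -natrD /nn addnC -mulnS natrM -mulrA ler_wpM2l// ler_pdivrMl// -natrM ler_nat.
  by rewrite mulnC ltnW// ltn_ceil.
pose S i := sval (cid (geo (nn i))).
have geo' i : exists P : nat -> V, forall L T, exists a b a' b', [/\ a \in S i, b \in S i, a' \in S i & b' \in S i] /\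
    [/\ `|P a - P b| <= 1, (2 ^+ nn i) `^ A <= `|P a' - P b'| `^ p &
        pow_dist L T a' b' <= C * (2 ^+ nn i) `^ B * pow_dist L T a b].
  exact: (svalP (cid (geo (nn i)))).
pose P i := sval (cid (geo' i)).
have PP i := svalP (cid (geo' i)).
have rS i : exists a, a \in S i.
  by have [a [_ [_ [_ [[h _ _ _] _]]]]] := PP i 0%N (fun _ _ => 0); exists a.
(* Level [i] consists of [2 ^ i] copies of the [i]-th space, scaled by [2 `^ (- (1 + eta) * i / p)]:
   the short pairs of all the copies are summable, hence so are their images, and one copy per
   level has a short pair of small image. The long pairs of these copies have summable images,
   but they are not summable. *)
pose delta k : R := 2 `^ (- (1 + eta) * (lev k)%:R / p).
have delta0 k : 0 <= delta k by exact: powR_ge0.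
have deltap k : delta k `^ p = 2 `^ (- (1 + eta) * (lev k)%:R).
  by rewrite /delta -powRrM divfK// gt_eqF.
pose Q z : V := if unpickle z is Some (k, a) then delta k *: P (lev k) a else 0.
have QE k a : Q (pickle (k : nat, a : nat)) = delta k *: P (lev k) a by rewrite /Q pickleK.
pose F k := [seq pickle (k, a) | a <- S (lev k)].
have inF k a : a \in S (lev k) -> pickle (k, a) \in F k by move=> aS; apply/mapP; exists a.
pose base k := pickle (k, sval (cid (rS (lev k)))).
have baseF k : base k \in F k by apply: inF; exact: (svalP (cid (rS (lev k)))).
have [L [T HT]] := additive_reduction p0 q1 btheta hred dd Q baseF.
pose T' (k a n : nat) : W := T k (pickle (k, a)) n.
have PP' k : exists z : nat * nat * (nat * nat),
   [/\ z.1.1 \in S (lev k), z.1.2 \in S (lev k), z.2.1 \in S (lev k) & z.2.2 \in S (lev k)] /\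
   [/\ `|P (lev k) z.1.1 - P (lev k) z.1.2| <= 1,
       (2 ^+ nn (lev k)) `^ A <= `|P (lev k) z.2.1 - P (lev k) z.2.2| `^ p &
       pow_dist (L k) (T' k) z.2.1 z.2.2 <= C * (2 ^+ nn (lev k)) `^ B * pow_dist (L k) (T' k) z.1.1 z.1.2].
  by have [a [b [a' [b' h]]]] := PP (lev k) (L k) (T' k); exists (a, b, (a', b')).
pose z k := sval (cid (PP' k)).
have zP k := svalP (cid (PP' k)).
have zS k : [/\ (z k).1.1 \in S (lev k), (z k).1.2 \in S (lev k), (z k).2.1 \in S (lev k) & (z k).2.2 \in S (lev k)].
  by have [] := zP k.
have zE k : `|P (lev k) (z k).1.1 - P (lev k) (z k).1.2| <= 1 by have [_ []] := zP k.
have zD k : (2 ^+ nn (lev k)) `^ A <= `|P (lev k) (z k).2.1 - P (lev k) (z k).2.2| `^ p by have [_ []] := zP k.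
pose De k := pow_dist (L k) (T' k) (z k).1.1 (z k).1.2.
pose Dd k := pow_dist (L k) (T' k) (z k).2.1 (z k).2.2.
have zT k : Dd k <= C * (2 ^+ nn (lev k)) `^ B * De k by have [_ []] := zP k.
have De0 k : 0 <= De k by apply: sumr_ge0 => n _; exact: powR_ge0.
have Dd0 k : 0 <= Dd k by apply: sumr_ge0 => n _; exact: powR_ge0.
have normQ k a b : `|Q (pickle (k, a)) - Q (pickle (k, b))| `^ p =
    2 `^ (- (1 + eta) * (lev k)%:R) * `|P (lev k) a - P (lev k) b| `^ p.
  by rewrite !QE -scalerBr normrZ (ger0_norm (delta0 k)) powRM// deltap.
have levE i c : (c < 2 ^ i)%N -> lev ((2 ^ i).-1 + c)%N = i by exact: trunc_log_level.
have rho01 (t : R) : t < 0 -> 0 < (2 : R) `^ t < 1.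
  move=> t0; rewrite powR_gt0//= -(invrK (2 `^ t)) -powRN invf_lt1 ?powR_gt0//.
  by rewrite /powR gt_eqF// expR_gt1 mulr_gt0// ?oppr_gt0// ln_gt0// ltr1n.
have [K HK] : bsum De.
  apply: (HT (fun k => pickle (k, (z k).1.1)) (fun k => pickle (k, (z k).1.2)) _ _).1.
  - by move=> k; apply: inF; case: (zS k).
  - by move=> k; apply: inF; case: (zS k).
  apply: (bsum_levels (K := 2 / (1 - 2 `^ (- eta)))); first by move=> k; exact: powR_ge0.
  move=> I; apply: le_trans (bsum_geometric (rho01 (- eta) _) I); last by rewrite oppr_lt0.
  apply: ler_sum => i _.
  apply: (@le_trans _ _ (\sum_(c < 2 ^ i) 2 `^ (- (1 + eta) * i%:R))).
    apply: ler_sum => c _; rewrite normQ levE// ler_piMr ?powR_ge0//.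
    have := zE ((2 ^ i).-1 + c)%N; rewrite levE// => h.
    rewrite -[leRHS](congr1 (fun f => f p) (powR1 R)).
    by apply: ge0_ler_powR; rewrite ?nnegrE// ltW.
  rewrite sumr_const card_ord -[leLHS]mulr_natl natrX -powR_mulrn//.
  rewrite -powRD; last by apply/implyP.
  rewrite -powRrM le_eqVlt; apply/orP; left; apply/eqP; congr (_ `^ _); ring.
have K0 : 0 <= K by have := HK 0%N; rewrite big_ord0.
(* Among [2 ^ i] nonnegative terms of total at most [K], one is at most the average. *)
have best i : exists c, (c < 2 ^ i)%N /\ De ((2 ^ i).-1 + c)%N <= K / 2 ^+ i.
  apply: contrapT => nb.
  have h (c : 'I_(2 ^ i)) : K / 2 ^+ i < De ((2 ^ i).-1 + c)%N.
    by rewrite ltNge; apply/negP => hc; apply: nb; exists c.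
  have := HK (2 ^ i.+1).-1; rewrite sum_levels big_ord_recr /= => h1.
  have h2 : 0 <= \sum_(j < i) \sum_(k < 2 ^ j) De ((2 ^ j).-1 + k)%N.
    by apply: sumr_ge0 => j _; apply: sumr_ge0.
  have h3 : \sum_(k < 2 ^ i) (K / 2 ^+ i) < \sum_(k < 2 ^ i) De ((2 ^ i).-1 + k)%N.
    by apply: ltr_sum => //; apply/hasP; exists (Ordinal (expn_gt0 2 i)) => //.
  move: h3; rewrite sumr_const card_ord -[ltLHS]mulr_natl natrX mulrC divfK ?gt_eqF ?exprn_gt0//.
  by rewrite ltNge (le_trans _ h1)// lerDr.
pose c i := sval (cid (best i)).
have cP i : (c i < 2 ^ i)%N /\ De ((2 ^ i).-1 + c i)%N <= K / 2 ^+ i by exact: (svalP (cid (best i))).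
pose isbest k := k == ((2 ^ lev k).-1 + c (lev k))%N.
have bestE (v : nat -> R) i : \sum_(e < 2 ^ i) (if isbest ((2 ^ i).-1 + e)%N then v ((2 ^ i).-1 + e)%N else 0)
    = v ((2 ^ i).-1 + c i)%N.
  have [ci _] := cP i; rewrite (bigD1 (Ordinal ci))//= big1 ?addr0.
    by rewrite /isbest levE// eqxx.
  move=> e ne; rewrite /isbest levE// eqn_add2l ifF//.
  by apply/negbTE; move: ne; rewrite -val_eqE.
(* A long pair in the best copy of each level; in all other copies [y] and [y'] coincide and
   contribute 0. *)
pose y k := pickle (k, if isbest k then (z k).2.1 else (z k).1.1).
pose y' k := pickle (k, if isbest k then (z k).2.2 else (z k).1.1).
have yF k : y k \in F k by apply: inF; case: (zS k); case: (isbest k).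
have y'F k : y' k \in F k by apply: inF; case: (zS k); case: (isbest k).
have q0 : q != 0 by rewrite gt_eqF// (lt_le_trans ltr01).
have [M HM] : bsum (fun k => `|Q (y k) - Q (y' k)| `^ p).
  apply: (HT y y' yF y'F).2.
  have -> : (fun k => \sum_(n < L k) `|T k (y k) n - T k (y' k) n| `^ q) =
      (fun k => if isbest k then Dd k else 0).
    apply/funext => k; rewrite /y /y'; case: ifP => // _.
    by rewrite big1// => n _; rewrite subrr normr0 powR0.
  have ex : B * m%:R / l%:R - 1 < 0 by rewrite subr_lt0 ltr_pdivrMr// mul1r.
  apply: (bsum_levels (K := C * K * (2 / (1 - 2 `^ (B * m%:R / l%:R - 1))))).
    by move=> k; case: ifP.
  move=> I; rewrite (eq_bigr (fun i : 'I_I => Dd ((2 ^ i).-1 + c i)%N)); last by move=> i _; exact: bestE.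
  apply: (@le_trans _ _ (\sum_(i < I) C * K * (2 `^ (B * m%:R / l%:R - 1)) `^ i%:R)); last first.
    by rewrite -mulr_sumr ler_wpM2l ?mulr_ge0//; apply: bsum_geometric; exact: rho01.
  apply: ler_sum => i _; have [ci hc] := cP i.
  apply: le_trans (zT _) _; rewrite levE//.
  apply: (@le_trans _ _ (C * (2 ^+ nn i) `^ B * (K / 2 ^+ i))).
    by rewrite ler_wpM2l// mulr_ge0// powR_ge0.
  rewrite -!mulrA ler_wpM2l// mulrCA ler_wpM2l//.
  rewrite -!powR_mulrn// -!powRrM -powRN -powRD; last by apply/implyP.
  apply: ler_powR; first by rewrite ler1n.
  have := ler_wpM2l B0 (nn_le i).
  rewrite (mulrC (nn i)%:R) mulrBl mul1r -!mulrA => h; exact: lerD.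
(* A lower bound for the contribution of each level: as [1 + eta = A m / l], scaling and stretching
   cancel up to the rounding in [nn i], which costs at most [A * m] in the exponent. *)
pose c0 : R := 2 `^ (- (A * m%:R)).
have c00 : 0 < c0 by exact: powR_gt0.
have A0 : 0 <= A by exact: le_trans B0 (ltW BA).
have low I : c0 * I%:R <= M.
  apply: le_trans (HM (2 ^ I).-1).
  rewrite (sum_levels (fun k => `|Q (y k) - Q (y' k)| `^ p)).
  rewrite mulr_natr -[X in c0 *+ X]card_ord -sumr_const; apply: ler_sum => i _.
  have [ci _] := cP i.
  rewrite (bigD1 (Ordinal ci))//= -[leLHS]addr0 lerD ?sumr_ge0//.
  rewrite /y /y' /isbest levE// eqxx normQ levE//.
  apply: (@le_trans _ _ (2 `^ (- (1 + eta) * i%:R) * (2 ^+ nn i) `^ A)); last first.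
    by rewrite ler_wpM2l ?powR_ge0//; have := zD ((2 ^ i).-1 + c i)%N; rewrite levE.
  rewrite -powR_mulrn// -powRrM -powRD; last by apply/implyP.
  apply: ler_powR; first by rewrite ler1n.
  have := ler_wpM2l A0 (nn_ge i).
  have -> : - (1 + eta) * i%:R = - (A * (m%:R / l%:R * i%:R)) by rewrite /eta; ring.
  by rewrite mulrBr (mulrC _ A) -lerBlDl opprK addrC.
have M0 : 0 <= M by apply: le_trans (low 0%N); rewrite mulr0.
have := low (Num.trunc (M / c0)).+1; rewrite mulrC -ler_pdivlMr//.
by rewrite leNgt truncnS_gt.
Qed.

End exponent_comparison.

(** * Smoothness and cubes *)

Section powR_inequalities.
Context {R : realType}.

Lemma powR_conv (l x y t : R) : 0 <= l <= 1 -> 0 <= x -> 0 <= y -> 1 <= t ->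
  (l * x + (1 - l) * y) `^ t <= l * x `^ t + (1 - l) * y `^ t.
Proof.
move=> /andP[l0 l1] x0 y0 t1.
have xi : x \in (`[0, +oo[%classic : set R) by rewrite inE /= in_itv /= x0.
have yi : y \in (`[0, +oo[%classic : set R) by rewrite inE /= in_itv /= y0.
by have := convex_powR t1 (Itv01 l0 l1) xi yi; rewrite !convRE.
Qed.

Lemma powR_mean2 (x y t : R) : 0 <= x -> 0 <= y -> 1 <= t ->
  ((x + y) / 2) `^ t <= (x `^ t + y `^ t) / 2.
Proof.
move=> x0 y0 t1; have h : 0 <= (2^-1 : R) <= 1 by rewrite invr_ge0 invf_le1// ler1n ler0n.
have := powR_conv h x0 y0 t1.
have e z w : 2^-1 * z + (1 - 2^-1) * w = (z + w) / 2 :> R by field.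
by rewrite !e.
Qed.

(** Convexity at [a / alpha] and [b / beta]. The right side is linear in [a ^ t] and [b ^ t], hence
    can be summed; if these sum to [alpha ^ t] and [beta ^ t], it becomes [(alpha + beta) ^ t], as
    in Minkowski's inequality. *)
Lemma powR_minkowski_weights (a b alpha beta t : R) : 0 <= a -> 0 <= b -> 0 < alpha -> 0 < beta -> 1 <= t ->
  (a + b) `^ t <= (alpha + beta) `^ t / (alpha + beta) * (alpha / alpha `^ t * a `^ t + beta / beta `^ t * b `^ t).
Proof.
move=> a0 b0 al0 be0 t1; have ab : 0 < alpha + beta by rewrite addr_gt0.
pose l := alpha / (alpha + beta).
have l01 : 0 <= l <= 1.
  by rewrite /l divr_ge0 ?(ltW al0) ?(ltW ab)//= ler_pdivrMr// mul1r lerDl ltW.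
have lb : 1 - l = beta / (alpha + beta) by rewrite /l; field; rewrite gt_eqF.
have x0 : 0 <= a / alpha by rewrite divr_ge0// ltW.
have y0 : 0 <= b / beta by rewrite divr_ge0// ltW.
have -> : a + b = (alpha + beta) * (l * (a / alpha) + (1 - l) * (b / beta)).
  by rewrite lb /l; field; rewrite !gt_eqF.
have l0 : 0 <= l by case/andP: l01.
have l1 : 0 <= 1 - l by rewrite subr_ge0; case/andP: l01.
rewrite powRM ?(ltW ab)//; last by rewrite addr_ge0// mulr_ge0.
rewrite -mulrA ler_wpM2l ?powR_ge0//.
apply: le_trans (powR_conv l01 x0 y0 t1) _.
rewrite lb /l (powRM t a0) ?invr_ge0 ?(ltW al0)// (powRM t b0) ?invr_ge0 ?(ltW be0)//.
have inv (z : R) : 0 < z -> z^-1 `^ t = (z `^ t)^-1.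
  by move=> z0; rewrite -powR_inv1 ?ltW// -powRrM mulN1r powRN.
rewrite !inv//.
by rewrite le_eqVlt; apply/orP; left; apply/eqP; field; rewrite !gt_eqF ?powR_gt0.
Qed.

(** A joint induction: at each step the sum gains [t] times the difference and the difference gains
    [t] times the sum. *)
Lemma two_point_integer (t : R) (m : nat) : 0 <= t <= 1 ->
  (1 + t) ^+ m + (1 - t) ^+ m <= 2 * (1 + 4 ^+ m * t ^+ 2) /\
  (1 + t) ^+ m - (1 - t) ^+ m <= 2 * (4 ^+ m * t).
Proof.
move=> /andP[t0 t1]; elim: m => [|m [IH1 IH2]].
  by rewrite !expr0 mul1r; have := sqr_ge0 t; lra.
rewrite !exprS; set a := (1 + t) ^+ m in IH1 IH2 *; set b := (1 - t) ^+ m in IH1 IH2 *.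
have c1 : 1 <= (4 : R) ^+ m by rewrite exprn_ege1// ler1n.
set c := 4 ^+ m in IH1 IH2 c1 *.
have h2 := ler_wpM2l t0 IH2; have h1 := ler_wpM2l t0 IH1.
have tt : t ^+ 2 <= 1 by rewrite exprn_ile1.
have h3 : 0 <= c * t by rewrite mulr_ge0// (le_trans ler01).
have h4 : c * t * t ^+ 2 <= c * t by rewrite ler_piMr.
have h5 : t <= c * t by rewrite ler_peMl.
have h6 : 0 <= c * t ^+ 2 by rewrite mulr_ge0 ?sqr_ge0// (le_trans ler01).
move: h1 h2 h4 h6; rewrite !expr2 => h1 h2 h4 h6.
split; lra.
Qed.

(** If [|x| < |y|], a large [K] suffices. Otherwise homogeneity reduces to [1 + t] and [1 - t] with
    t in [0, 1]; power means lead from [q] to the integer [m], and [t ^ 2 <= t ^ s] since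
    [s <= 2]. *)
Lemma two_point_scalar (s q : R) : 1 <= s -> s <= 2 -> s <= q -> exists2 K : R, 1 <= K &
  forall x y : R, (`|x + y| `^ q + `|x - y| `^ q) <= 2 * (`|x| `^ s + K * `|y| `^ s) `^ (q / s).
Proof.
move=> s1 s2 sq; have s0 : 0 < s by lra. have q0 : 0 < q by lra.
pose m := (Num.trunc q).+1.
have qm : q <= m%:R by rewrite ltW// truncnS_gt.
have m0 : 0 < (m%:R : R) by rewrite ltr0n.
have c1 : 1 <= (4 : R) ^+ m by rewrite exprn_ege1// ler1n.
have t1 : 1 <= q / s by rewrite ler_pdivlMr// mul1r.
exists (4 ^+ m) => // x y.
have c0 : 0 <= (4 : R) ^+ m by lra.
have sgn : `|x + y| `^ q + `|x - y| `^ q = (`|x| + `|y|) `^ q + `| `|x| - `|y| | `^ q.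
  have [x0|x0] := leP 0 x; have [y0|y0] := leP 0 y.
  - by rewrite (ger0_norm x0) (ger0_norm y0) (ger0_norm (addr_ge0 x0 y0)).
  - rewrite (ger0_norm x0) (ltr0_norm y0) opprK addrC; congr (_ `^ _ + _).
    by rewrite ger0_norm//; lra.
  - rewrite (ltr0_norm x0) (ger0_norm y0) addrC; congr (_ `^ _ + _ `^ _).
      by rewrite ltr0_norm//; lra.
    by rewrite -normrN; congr `|_|; ring.
  - rewrite (ltr0_norm x0) (ltr0_norm y0); congr (_ `^ _ + _ `^ _).
      by rewrite ltr0_norm; lra.
    by rewrite -normrN; congr `|_|; ring.
have qs0 : 0 <= q / s by rewrite divr_ge0// ltW.
have q0' : 0 <= q by exact: ltW.
rewrite sgn; move: (normr_ge0 x) (normr_ge0 y); move: `|x| `|y| => X Y X0 Y0 {sgn x y}.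
have sq1 (z : R) : 0 <= z -> z `^ q = (z `^ s) `^ (q / s).
  by move=> z0; rewrite -powRrM mulrCA mulfV ?mulr1// gt_eqF.
have Xs := powR_ge0 X s; have Ys := powR_ge0 Y s.
have [YX|XY] := leP Y X; last first.
  have h1 : (X + Y) `^ q <= (2 * Y) `^ q.
    by apply: ge0_ler_powR => //; rewrite ?nnegrE ?addr_ge0 ?mulr_ge0//; lra.
  have h2 : `|X - Y| `^ q <= (2 * Y) `^ q.
    by apply: ge0_ler_powR => //; rewrite ?nnegrE ?mulr_ge0// ltr0_norm//; lra.
  have h3 : (2 * Y) `^ q <= (X `^ s + 4 ^+ m * Y `^ s) `^ (q / s).
    rewrite sq1 ?mulr_ge0//; apply: ge0_ler_powR => //; rewrite ?nnegrE ?powR_ge0 ?addr_ge0 ?mulr_ge0//.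
    rewrite powRM//; apply: (@le_trans _ _ (4 ^+ m * Y `^ s)); last by rewrite lerDr.
    rewrite ler_wpM2r//; apply: (@le_trans _ _ 4).
      have -> : (4 : R) = 2 `^ 2 by rewrite powR_mulrn//; ring.
      by apply: ler_powR => //; rewrite ler1n.
    by rewrite /m exprS ler_peMr// exprn_ege1// ler1n.
  lra.
have [Xz|Xn] := eqVneq X 0.
  have Yz : Y = 0 by lra.
  rewrite Xz Yz addr0 subr0 normr0 (@powR0 _ q) ?gt_eqF// addr0.
  by apply: mulr_ge0 => //; exact: powR_ge0.
have Xp : 0 < X by rewrite lt_def Xn.
pose t := Y / X; have tt : 0 <= t <= 1 by rewrite /t divr_ge0//= ler_pdivrMr// mul1r.
have [t0 t1'] := andP tt.
have eY : Y = X * t by rewrite /t mulrC divfK.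
have e1 : X + Y = X * (1 + t) by rewrite eY; ring.
have e2 : `|X - Y| = X * (1 - t) by rewrite ger0_norm ?subr_ge0// {1}eY; ring.
have a0 : 0 <= 1 + t by lra. have b0 : 0 <= 1 - t by lra.
rewrite e1 e2 !(powRM q)// -mulrDr.
have mq1 : 1 <= m%:R / q by rewrite ler_pdivlMr// mul1r.
have pm (z : R) : 0 <= z -> (z `^ q) `^ (m%:R / q) = z ^+ m.
  by move=> z0; rewrite -powRrM mulrCA mulfV ?mulr1 ?gt_eqF// powR_mulrn.
have [h _] := two_point_integer m tt.
pose U := ((1 + t) `^ q + (1 - t) `^ q) / 2.
have U0 : 0 <= U by rewrite divr_ge0// addr_ge0// powR_ge0.
have w1 : 1 <= 1 + 4 ^+ m * t ^+ 2 by rewrite lerDl mulr_ge0// sqr_ge0.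
have hU : U <= 1 + 4 ^+ m * t ^+ 2.
  have hm : U `^ (m%:R / q) <= 1 + 4 ^+ m * t ^+ 2.
    by apply: le_trans (powR_mean2 (powR_ge0 _ _) (powR_ge0 _ _) mq1) _; rewrite !pm//; lra.
  have [U1|U1] := leP U 1; first exact: le_trans w1.
  apply: le_trans hm; rewrite -[leLHS]powRr1//; apply: ler_powR => //; exact: ltW.
have ht : t ^+ 2 <= t `^ s.
  have [->|tn] := eqVneq t 0; first by rewrite expr2 mul0r powR_ge0.
  by rewrite -powR_mulrn//; apply: ger_powR => //; rewrite lt_def tn t0.
have hU2 : U <= (1 + 4 ^+ m * t `^ s) `^ (q / s).
  have w2 : 1 <= 1 + 4 ^+ m * t `^ s by rewrite lerDl mulr_ge0// powR_ge0.
  apply: (@le_trans _ _ (1 + 4 ^+ m * t `^ s)).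
    by apply: le_trans hU _; rewrite lerD2l ler_wpM2l.
  have w0 : 0 <= 1 + 4 ^+ m * t `^ s by exact: le_trans w2.
  by rewrite -[leLHS](powRr1 w0); exact: ler_powR.
have -> : X `^ s + 4 ^+ m * Y `^ s = X `^ s * (1 + 4 ^+ m * t `^ s).
  by rewrite eY powRM//; ring.
rewrite [(_ * _) `^ (q / s)]powRM//; last by rewrite addr_ge0// mulr_ge0// powR_ge0.
rewrite -sq1// mulrCA ler_wpM2l ?powR_ge0//.
by move: hU2; rewrite /U ler_pdivrMr// mulrC.
Qed.

(* Minkowski's inequality in [L_t] of two points *)
Lemma two_point_integral (A B M : R -> R) (alpha beta gamma t : R) : 1 <= t ->
  mf01 A -> mf01 B -> mf01 M -> (forall x, 0 <= A x) -> (forall x, 0 <= B x) -> (forall x, 0 <= M x) ->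
  (forall x, A x `^ t + B x `^ t <= 2 * M x `^ t) ->
  int01 A = alpha%:E -> int01 B = beta%:E -> int01 M = gamma%:E ->
  alpha `^ t + beta `^ t <= 2 * gamma `^ t.
Proof.
move=> t1 mA mB mM A0 B0 M0 hM iA iB iM.
have al0 : 0 <= alpha by rewrite -lee_fin -iA int01_ge0.
have be0 : 0 <= beta by rewrite -lee_fin -iB int01_ge0.
have ga0 : 0 <= gamma by rewrite -lee_fin -iM int01_ge0.
have t0 : 0 < t by lra.
have lin (a b c : R) : 0 <= a -> 0 <= b -> 0 <= c -> (forall x, a * A x + b * B x <= c * M x) ->
    a * alpha + b * beta <= c * gamma.
  move=> a0 b0 c0 h.
  have : (int01 (fun x => a * A x + b * B x)%R <= int01 (fun x => c * M x)%R)%E.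
    apply: int01_le => //.
    - by apply: mf01_add; apply: mf01_mul => //; exact: mf01_cst.
    - by apply: mf01_mul => //; exact: mf01_cst.
    - by move=> x; rewrite addr_ge0// mulr_ge0.
  rewrite int01D; [|by apply: mf01_mul => //; exact: mf01_cst|by apply: mf01_mul => //; exact: mf01_cst|
    by move=> x; rewrite mulr_ge0|by move=> x; rewrite mulr_ge0].
  by rewrite !int01Z// iA iB iM -!EFinM -EFinD lee_fin.
have [te|tn] := eqVneq t 1.
  rewrite te !powRr1// -[alpha]mul1r -[beta]mul1r; apply: lin => // x.
  by rewrite !mul1r; have := hM x; rewrite te !powRr1.
have tgt : 1 < t by rewrite lt_neqAle eq_sym tn.
have t1n : t - 1 != 0 by rewrite gt_eqF// subr_gt0.
pose t' := t / (t - 1).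
have t'0 : 0 < t' by rewrite divr_gt0// subr_gt0.
have conj : t'^-1 + t^-1 = 1 by rewrite /t'; field; rewrite t1n gt_eqF.
pose D := alpha `^ t + beta `^ t.
have D0 : 0 <= D by rewrite addr_ge0// powR_ge0.
have [Dz|Dn] := eqVneq D 0; first by rewrite -/D Dz mulr_ge0// powR_ge0.
have Dp : 0 < D by rewrite lt_def Dn.
have e (z : R) : 0 <= z -> (z `^ (t - 1)) `^ t' = z `^ t.
  by move=> z0; rewrite -powRrM /t' mulrCA mulfV// mulr1.
have e2 (z : R) : 0 <= z -> z `^ (t - 1) * z = z `^ t.
  move=> z0; rewrite -{2}(powRr1 z0) -powRD ?subrK//.
  by rewrite gt_eqF//.
(* Duality: Hoelder's inequality with the weights [alpha ^ (t - 1)] and [beta ^ (t - 1)] makes the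
   pointwise inequality linear in [A], [B] and [M]. Once integrated, its left side is [D]. *)
have key x : alpha `^ (t - 1) * A x + beta `^ (t - 1) * B x <= (D `^ t'^-1 * 2 `^ t^-1) * M x.
  apply: le_trans (hoelder2 (powR_ge0 _ _) (powR_ge0 _ _) (A0 x) (B0 x) t'0 t0 conj) _.
  rewrite !e// -mulrA ler_wpM2l ?powR_ge0//.
  apply: (@le_trans _ _ ((2 * M x `^ t) `^ t^-1)).
    apply: ge0_ler_powR; rewrite ?nnegrE ?invr_ge0 ?addr_ge0 ?mulr_ge0 ?powR_ge0//; exact: ltW.
  by rewrite powRM ?powR_ge0// -powRrM mulfV ?gt_eqF// powRr1.
have := lin _ _ _ (powR_ge0 alpha (t - 1)) (powR_ge0 beta (t - 1))
  (mulr_ge0 (powR_ge0 D t'^-1) (powR_ge0 2 t^-1)) key.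
rewrite !e2// -/D => h.
have h2 : D `^ t^-1 <= 2 `^ t^-1 * gamma.
  rewrite -(ler_pM2l (powR_gt0 t'^-1 Dp)) -powRD; last by rewrite Dn implybT.
  by rewrite conj powRr1// mulrA.
have : (D `^ t^-1) `^ t <= (2 `^ t^-1 * gamma) `^ t.
  by apply: ge0_ler_powR; rewrite ?nnegrE ?mulr_ge0 ?powR_ge0// ltW.
rewrite powRM ?powR_ge0// -!powRrM mulVf ?gt_eqF// !powRr1//.
Qed.

End powR_inequalities.

Section segments_and_cubes.
Context {R : realType} {V W : normedModType R} (p q : R) (q1 : 1 <= q).

Let q0 : 0 < q. Proof. exact: lt_le_trans q1. Qed.
Let q00 : 0 <= q. Proof. exact: ltW. Qed.

Lemma norm_powR_mean2 (x y : W) : `|2^-1 *: (x + y)| `^ q <= (`|x| `^ q + `|y| `^ q) / 2.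
Proof.
apply: le_trans (powR_mean2 (normr_ge0 x) (normr_ge0 y) q1).
apply: ge0_ler_powR => //; rewrite ?nnegrE ?divr_ge0 ?addr_ge0//.
by rewrite normrZ ger0_norm ?invr_ge0// mulrC ler_wpM2r ?invr_ge0// ler_normD.
Qed.

Lemma max_in (T : eqType) (s : seq T) (D : T -> R) x : x \in s ->
  exists2 y, y \in s & forall z, z \in s -> D z <= D y.
Proof.
elim: s x => // a s IH x _; case: s IH => [|b s] IH.
  by exists a; rewrite ?mem_seq1// => z; rewrite mem_seq1 => /eqP ->.
have [y ys hy] := IH b (mem_head _ _).
have [ay|ya] := leP (D a) (D y).
  exists y; first by rewrite in_cons ys orbT.
  by move=> z; rewrite in_cons => /predU1P[->//|/hy].
exists a; first exact: mem_head.
by move=> z; rewrite in_cons => /predU1P[->//|/hy h]; exact: le_trans h (ltW ya).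
Qed.

(** The segment is halved: by convexity the [q]-th power of a sum of two is at most [2 ^ q] times
    the mean of the powers, so each doubling costs [2 ^ q]. *)
Lemma pow_dist_segment L (T : nat -> nat -> W) (e : R) n a :
  (forall i, (a <= i < a + 2 ^ n)%N -> pow_dist q L T i i.+1 <= e) ->
  pow_dist q L T a (a + 2 ^ n)%N <= (2 ^+ n) `^ q * e.
Proof.
have tq (x : R) : 2 * x / 2 = x by field.
elim: n a => [|n IH] a h.
  by rewrite expr0 (congr1 (fun f => f q) (powR1 R)) mul1r addn1; apply: h; rewrite leqnn addn1 /=.
have h1 : pow_dist q L T a (a + 2 ^ n)%N <= (2 ^+ n) `^ q * e.
  apply: IH => i /andP[h1 h2]; apply: h; rewrite h1 /= (leq_trans h2)//.
  by rewrite leq_add2l leq_exp2l.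
have h2 : pow_dist q L T (a + 2 ^ n)%N (a + 2 ^ n + 2 ^ n)%N <= (2 ^+ n) `^ q * e.
  apply: IH => i /andP[h2 h3]; apply: h; rewrite (leq_trans _ h2) ?leq_addr//=.
  by rewrite expnS mul2n -addnn addnA.
have -> : (a + 2 ^ n.+1 = a + 2 ^ n + 2 ^ n)%N by rewrite expnS mul2n -addnn addnA.
set b := (a + 2 ^ n)%N in h1 h2 *; set c := (b + 2 ^ n)%N in h2 *.
apply: (@le_trans _ _ (2 `^ q * ((pow_dist q L T a b + pow_dist q L T b c) / 2))); last first.
  rewrite exprS powRM ?exprn_ge0// -mulrA ler_wpM2l ?powR_ge0// ler_pdivrMr//.
  by move: h1 h2; lra.
rewrite /pow_dist -big_split /= mulr_suml mulr_sumr; apply: ler_sum => i _.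
have -> : T a i - T c i = 2 *: (2^-1 *: ((T a i - T b i) + (T b i - T c i))).
  by rewrite scalerA mulfV// scale1r addrA subrK.
by rewrite normrZ ger0_norm// powRM// ler_wpM2l ?powR_ge0//; exact: norm_powR_mean2.
Qed.

Lemma segment_poor_embedding (u : V) : 0 <= p -> `|u| = 1 -> @poor_embedding R V W p q p q 1.
Proof.
move=> p0 u1 n; exists (iota 0 (2 ^ n).+1), (fun a => a%:R *: u) => L T.
have p2 : (0 < 2 ^ n)%N by rewrite expn_gt0.
have m0 : 0%N \in iota 0 (2 ^ n) by rewrite mem_iota.
have [a aI ha] := max_in (fun i => pow_dist q L T i i.+1) m0.
exists a, a.+1, 0%N, (2 ^ n)%N.
have a2 : (a < 2 ^ n)%N by move: aI; rewrite mem_iota add0n.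
split; first by split; rewrite mem_iota add0n ?ltnS ?(ltnW a2)//=.
split.
- by rewrite -scalerBl -natr1 opprD addrA subrr sub0r normrZ u1 mulr1 normrN normr1.
- rewrite scale0r sub0r normrN normrZ u1 mulr1 natrX ger0_norm// exprn_ge0//.
- rewrite mul1r -{1}[(2 ^ n)%N]add0n; apply: pow_dist_segment => i.
  by rewrite add0n => hi; apply: ha; rewrite mem_iota add0n.
Qed.

(** The sum over the vertices of the cube, by recursion on the dimension so that inductions can
    split off the first coordinate. *)
Fixpoint csum (M : nmodType) (N : nat) (g : seq bool -> M) : M :=
  if N is N'.+1 then csum N' (fun v => g (false :: v)) + csum N' (fun v => g (true :: v))
  else g [::].

Lemma csumD (M : nmodType) N (g h : seq bool -> M) :
  csum N (fun v => g v + h v) = csum N g + csum N h.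
Proof. by elim: N g h => //= N IH g h; rewrite !IH addrACA. Qed.

Lemma csumZ (U : lmodType R) N (k : R) (g : seq bool -> U) :
  csum N (fun v => k *: g v) = k *: csum N g.
Proof. by elim: N g => //= N IH g; rewrite !IH scalerDr. Qed.

Lemma csumMl N (k : R) (g : seq bool -> R) : csum N (fun v => k * g v) = k * csum N g.
Proof. exact: (@csumZ R^o). Qed.

Lemma csum_le N (g h : seq bool -> R) : (forall v, size v = N -> g v <= h v) -> csum N g <= csum N h.
Proof.
elim: N g h => [|N IH] g h gh /=; first exact: gh.
by apply: lerD; apply: IH => v sv; apply: gh; rewrite /= sv.
Qed.

Lemma csum_cst N (c : R) : csum N (fun=> c) = 2 ^+ N * c.
Proof. by elim: N => [|N IH] /=; rewrite ?expr0 ?mul1r// IH exprS; ring. Qed.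

Lemma csum_negb N (g : seq bool -> R) : csum N (fun v => g (map negb v)) = csum N g.
Proof.
elim: N g => //= N IH g; rewrite addrC; congr (_ + _).
  exact: (IH (fun v => g (false :: v))).
exact: (IH (fun v => g (true :: v))).
Qed.

Lemma csum_exists N (g : seq bool -> R) c : csum N g <= 2 ^+ N * c ->
  exists2 v, size v = N & g v <= c.
Proof.
elim: N g => [|N IH] g /=; first by rewrite expr0 mul1r => h; exists [::].
rewrite exprS => h.
have [h0|h1] := leP (csum N (fun v => g (false :: v))) (2 ^+ N * c).
  by have [v sv gv] := IH _ h0; exists (false :: v); rewrite /= ?sv.
have [|v sv gv] := IH (fun v => g (true :: v)); first by move: h h1; lra.
by exists (true :: v); rewrite /= ?sv.
Qed.

Fixpoint cedge (v w : seq bool) : bool :=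
  match v, w with
  | a :: v', b :: w' => ((a != b) && (v' == w')) || ((a == b) && cedge v' w')
  | _, _ => false
  end.

Definition cdist (L : nat) (f : seq bool -> nat -> W) v w : R :=
  \sum_(n < L) `|f v n - f w n| `^ q.

Definition cmean N (f : seq bool -> nat -> W) (n : nat) : W :=
  (2 ^+ N)^-1 *: csum N (fun v => f v n).

Context (s K : R) (s0 : 0 < s) (sq : s <= q) (K1 : 1 <= K).
(* a martingale type inequality: [W] is uniformly smooth with modulus of power type [s] *)
Hypothesis two_point : forall a b : W,
  `|a + b| `^ q + `|a - b| `^ q <= 2 * (`|a| `^ s + K * `|b| `^ s) `^ (q / s).

Let t := q / s.
Let t1 : 1 <= t. Proof. by rewrite ler_pdivlMr// mul1r. Qed.
Let tp : 0 < t. Proof. exact: lt_le_trans t1. Qed.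
Let K0 : 0 <= K. Proof. exact: le_trans K1. Qed.
Let st (x : R) : 0 <= x -> (x `^ s) `^ t = x `^ q.
Proof. by move=> x0; rewrite -powRrM /t mulrCA mulfV ?mulr1// gt_eqF. Qed.

(** On the two facets [f] is [g + h] and [g - h], where [g] averages over the first coordinate and
    inherits the edge bound, and [h] is half an edge. [two_point] combines the variance of [g] with
    the size of [h], and by Minkowski's inequality the [t]-th root of the normalised bound grows
    linearly with the dimension. *)
Lemma cube_variance L N (f : seq bool -> nat -> W) (e : R) : 0 < e ->
  (forall v w, size v = N -> size w = N -> cedge v w -> cdist L f v w <= e) ->
  csum N (fun v => \sum_(n < L) `|f v n - cmean N f n| `^ q) <= 2 ^+ N * ((K * N.+1%:R) `^ t * e).
Proof.
move=> e0; elim: N f => [|N IH] f hf.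
  rewrite /= expr0 mul1r big1 ?mulr_ge0 ?powR_ge0 ?(ltW e0)// => i _.
  by rewrite /cmean /= expr0 invr1 scale1r subrr normr0 powR0// gt_eqF.
pose f0 v n := f (false :: v) n; pose f1 v n := f (true :: v) n.
pose g v n := 2^-1 *: (f0 v n + f1 v n); pose h v n := 2^-1 *: (f0 v n - f1 v n).
have h2 : (2 : R)^-1 + 2^-1 = 1 by field.
have e0' v n : f0 v n = g v n + h v n.
  by rewrite /g /h -scalerDr addrACA subrr addr0 scalerDr -scalerDl h2 scale1r.
have e1' v n : f1 v n = g v n - h v n.
  rewrite /g /h -scalerBr opprB [f0 v n + _]addrC addrACA subrr addr0.
  by rewrite scalerDr -scalerDl h2 scale1r.
have em n : cmean N.+1 f n = cmean N g n.
  rewrite /cmean /= -csumD /g csumZ scalerA; congr (_ *: _).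
  by rewrite exprS invfM mulrC.
have hg v w : size v = N -> size w = N -> cedge v w -> cdist L g v w <= e.
  move=> sv sw vw.
  have d0 : cdist L f (false :: v) (false :: w) <= e by apply: hf; rewrite /= ?sv ?sw// vw orbT.
  have d1 : cdist L f (true :: v) (true :: w) <= e by apply: hf; rewrite /= ?sv ?sw// vw orbT.
  apply: (@le_trans _ _ ((cdist L f (false :: v) (false :: w) + cdist L f (true :: v) (true :: w)) / 2)).
    rewrite /cdist -big_split /= mulr_suml; apply: ler_sum => i _.
    rewrite /g -scalerBr opprD addrACA; exact: norm_powR_mean2.
  by move: d0 d1; lra.
have hh : csum N (fun v => \sum_(n < L) `|h v n| `^ q) <= 2 ^+ N * e.
  rewrite -csum_cst; apply: csum_le => v sv.
  apply: (@le_trans _ _ (cdist L f (false :: v) (true :: v))).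
    apply: ler_sum => i _; apply: ge0_ler_powR; rewrite ?nnegrE//.
    by rewrite /h normrZ ger0_norm ?invr_ge0// ler_piMl// invf_le1// ler1n.
  by apply: hf; rewrite /= ?sv// eqxx.
have {IH}IH := IH g hg.
(* The [t]-th powers of [al] and [be] are the bounds for the parts from [g] and [h], and that of
   [al + be] is half the bound to be proved. Counting [N.+1] keeps [al] positive at [N = 0]. *)
pose al : R := (2 ^+ N * e) `^ t^-1 * (K * N.+1%:R).
pose be : R := (2 ^+ N * e) `^ t^-1 * K.
have c0 : 0 < 2 ^+ N * e by rewrite mulr_gt0// exprn_gt0.
have Kp : 0 < K by exact: lt_le_trans K1.
have al0 : 0 < al by rewrite !mulr_gt0// powR_gt0.
have be0 : 0 < be by rewrite mulr_gt0// powR_gt0.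
have ct : ((2 ^+ N * e) `^ t^-1) `^ t = 2 ^+ N * e.
  by rewrite -powRrM mulVf ?gt_eqF// powRr1// ltW.
have alt : al `^ t = 2 ^+ N * ((K * N.+1%:R) `^ t * e).
  by rewrite /al powRM ?powR_ge0 ?mulr_ge0// ct; ring.
have bet : be `^ t = 2 ^+ N * (K `^ t * e) by rewrite /be powRM ?powR_ge0// ct; ring.
have abt : (al + be) `^ t = 2 ^+ N * ((K * N.+2%:R) `^ t * e).
  have -> : al + be = (2 ^+ N * e) `^ t^-1 * (K * N.+2%:R).
    by rewrite /al /be -(natr1 N.+1); ring.
  by rewrite powRM ?powR_ge0 ?mulr_ge0// ct; ring.
pose c := (al + be) `^ t / (al + be); pose ca := al / al `^ t; pose cb := be / be `^ t.
have cc0 : 0 <= c by rewrite divr_ge0 ?powR_ge0// ltW// addr_gt0.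
have ca0 : 0 <= ca by rewrite divr_ge0 ?powR_ge0// ltW.
have cb0 : 0 <= cb by rewrite divr_ge0 ?powR_ge0// ltW.
have pt v n : `|f0 v n - cmean N g n| `^ q + `|f1 v n - cmean N g n| `^ q <=
    2 * (c * (ca * `|g v n - cmean N g n| `^ q + cb * (K `^ t * `|h v n| `^ q))).
  rewrite e0' e1' ![_ + _ - cmean N g n]addrAC; set a := g v n - _.
  apply: le_trans (two_point a (h v n)) _; rewrite ler_wpM2l//.
  apply: le_trans (powR_minkowski_weights (powR_ge0 _ _) _ al0 be0 t1) _.
    by rewrite mulr_ge0 ?powR_ge0.
  by rewrite st// [(K * _) `^ t]powRM ?powR_ge0// st.
rewrite /= -csumD.
apply: (@le_trans _ _ (csum N (fun v => 2 * (c * (ca * \sum_(n < L) `|g v n - cmean N g n| `^ q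
   + cb * K `^ t * \sum_(n < L) `|h v n| `^ q))))).
  apply: csum_le => v sv; rewrite -big_split /= !mulr_sumr -big_split /= !mulr_sumr.
  by apply: ler_sum => n _; rewrite em -[cb * _ * _]mulrA; exact: pt.
have -> : 2 ^+ N.+1 * ((K * N.+2%:R) `^ t * e) = 2 * (2 ^+ N * ((K * N.+2%:R) `^ t * e)).
  by rewrite exprS -!mulrA.
rewrite !csumMl csumD !csumMl -abt ler_wpM2l//.
apply: (@le_trans _ _ (c * (ca * al `^ t + cb * be `^ t))).
  rewrite ler_wpM2l// lerD ?ler_wpM2l ?alt//.
  rewrite -mulrA ler_wpM2l// bet mulrCA ler_wpM2l ?powR_ge0//.
have -> : ca * al `^ t = al by rewrite /ca divfK// gt_eqF// powR_gt0.
have -> : cb * be `^ t = be by rewrite /cb divfK// gt_eqF// powR_gt0.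
by rewrite /c divfK// gt_eqF// addr_gt0.
Qed.

(** Both ends of a diagonal are compared with the mean. As [map negb] permutes the vertices, the
    average over the diagonals is controlled by the variance, and some diagonal is at most
    average. *)
Lemma cube_diagonal L N (f : seq bool -> nat -> W) (e : R) : 0 < e ->
  (forall v w, size v = N -> size w = N -> cedge v w -> cdist L f v w <= e) ->
  exists2 v, size v = N & cdist L f v (map negb v) <= 2 `^ q * ((K * N.+1%:R) `^ t * e).
Proof.
move=> e0 hf; apply: csum_exists.
pose m := cmean N f.
apply: (@le_trans _ _ (csum N (fun v => 2 `^ q / 2 * (\sum_(n < L) `|f v n - m n| `^ q +
   \sum_(n < L) `|f (map negb v) n - m n| `^ q)))).
  apply: csum_le => v sv; rewrite /cdist -big_split /= mulr_sumr; apply: ler_sum => n _.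
  have -> : f v n - f (map negb v) n = 2 *: (2^-1 *: ((f v n - m n) + (m n - f (map negb v) n))).
    by rewrite scalerA mulfV// scale1r addrA subrK.
  rewrite normrZ ger0_norm// powRM// -mulrA ler_wpM2l ?powR_ge0// mulrC.
  by rewrite (distrC (f (map negb v) n)); exact: norm_powR_mean2.
rewrite csumMl csumD (csum_negb N (fun v => \sum_(n < L) `|f v n - m n| `^ q)).
have h := cube_variance e0 hf.
have p2 := powR_ge0 2 q.
have -> : 2 ^+ N * (2 `^ q * ((K * N.+1%:R) `^ t * e)) = 2 `^ q * (2 ^+ N * ((K * N.+1%:R) `^ t * e)).
  by ring.
rewrite -mulrA ler_wpM2l// mulrC ler_pdivrMr// /m; lra.
Qed.

Fixpoint cube N : seq (seq bool) :=
  if N is N'.+1 then map (cons false) (cube N') ++ map (cons true) (cube N') else [:: [::]].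

Lemma mem_cube N v : (v \in cube N) = (size v == N).
Proof.
elim: N v => [|N IH] [|a v] //=; rewrite mem_cat.
  by apply/negbTE; rewrite negb_or; apply/andP; split; apply/negP => /mapP[].
have inj b : injective (cons b : seq bool -> seq bool) by move=> x y [].
rewrite eqSS -IH; case: a; rewrite mem_map//.
  by rewrite orb_idl// => /mapP[].
by rewrite orb_idr// => /mapP[].
Qed.

Definition bvec (v : seq bool) (i : nat) : R := (nth false v i)%:R.

Lemma cedge_dist (r : R) N v w : r != 0 -> size v = N -> size w = N -> cedge v w ->
  \sum_(i < N) `|bvec v i - bvec w i| `^ r = 1.
Proof.
move=> rn; elim: N v w => [|N IH] [|a v] [|b w]//= [sv] [sw] /orP[/andP[ab /eqP vw]|/andP[/eqP -> vw]].
  rewrite big_ord_recl big1 ?addr0 => [|i _].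
    rewrite /bvec /=; case: a b ab => -[]//= _.
      by rewrite subr0 normr1 (congr1 (fun f => f r) (powR1 R)).
    by rewrite sub0r normrN normr1 (congr1 (fun f => f r) (powR1 R)).
  by rewrite /bvec /= vw subrr normr0 powR0.
by rewrite big_ord_recl /bvec /= subrr normr0 powR0// add0r; exact: IH.
Qed.

Lemma negb_dist (r : R) N v : size v = N ->
  \sum_(i < N) `|bvec v i - bvec (map negb v) i| `^ r = N%:R.
Proof.
move=> sv; rewrite -[RHS]mulr1 -[X in X%:R * _]card_ord -sum1_card natr_sum mulr_suml.
apply: eq_bigr => i _; rewrite /bvec (nth_map false) ?sv//; case: nth => /=.
  by rewrite subr0 normr1 (congr1 (fun f => f r) (powR1 R)) mul1r.
by rewrite sub0r normrN normr1 (congr1 (fun f => f r) (powR1 R)) mul1r.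
Qed.

(** The dimension is [N = 2 ^ n], and [2 * K] absorbs [N.+1 <= 2 * N]. *)
Lemma cube_poor_embedding (r : R) (E : nat -> (nat -> R) -> V) : 0 < r -> 0 <= p ->
  (forall n c c', `|E n c - E n c'| `^ r = \sum_(i < 2 ^ n) `|c i - c' i| `^ r) ->
  @poor_embedding R V W p q (p / r) t (2 `^ q * (2 * K) `^ t).
Proof.
move=> r0 p0 HE n; set N := (2 ^ n)%N.
have rn : r != 0 by rewrite gt_eqF.
pose dec z : seq bool := odflt [::] (unpickle z).
have decK v : dec (pickle v) = v by rewrite /dec pickleK.
exists (map pickle (cube N)), (fun z => E n (bvec (dec z))) => L T.
pose f v m := T (pickle (v : seq bool)) m.
pose EE := [seq z <- [seq (v, w) | v <- cube N, w <- cube N] | cedge z.1 z.2].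
have inEE v w : size v = N -> size w = N -> cedge v w -> (v, w) \in EE.
  move=> sv sw vw; rewrite mem_filter; apply/andP; split => //.
  by apply: allpairs_f; rewrite mem_cube; exact/eqP.
have EEin z : z \in EE -> [/\ size z.1 = N, size z.2 = N & cedge z.1 z.2].
  rewrite mem_filter => /andP[c /allpairsP[[v w] [/= vc wc e]]].
  by move: vc wc c; rewrite !mem_cube e => /eqP vc /eqP wc c.
have N0 : (0 < N)%N by rewrite expn_gt0.
have z0 : (nseq N false, true :: nseq N.-1 false) \in EE.
  apply: inEE; rewrite /= ?size_nseq// ?prednK//.
  by rewrite -(prednK N0) /= eqxx.
have [[a b] abE hmax] := max_in (fun z => cdist L f z.1 z.2) z0.
have [/= sa sb ab] := EEin _ abE.
have v00 : nseq N false \in cube N by rewrite mem_cube size_nseq.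
have [v0 v0c hmin] := max_in (fun v => - cdist L f v (map negb v)) v00.
have sv0 : size v0 = N by move: v0c; rewrite mem_cube => /eqP.
set e := cdist L f a b in hmax.
have e0 : 0 <= e by apply: sumr_ge0 => i _; exact: powR_ge0.
pose c := 2 `^ q * (K * N.+1%:R) `^ t.
have c0 : 0 < c by rewrite mulr_gt0// powR_gt0// mulr_gt0// (lt_le_trans ltr01).
(* [cube_diagonal] takes a positive edge bound while [e] may be 0, so [e] is raised by [d / c]. The
   shortest diagonal [v0] does not depend on [d], which may then tend to 0. *)
have diag : cdist L f v0 (map negb v0) <= c * e.
  apply/ler_addgt0Pr => d d0.
  have ed0 : 0 < e + d / c by rewrite ltr_pwDr// divr_gt0.
  have [v w sv sw vw|v sv hv] := @cube_diagonal L N f _ ed0.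
    apply: le_trans (hmax _ (inEE _ _ sv sw vw)) _; rewrite /= lerDl divr_ge0// ltW//.
  have hv0 : cdist L f v0 (map negb v0) <= cdist L f v (map negb v).
    by rewrite -lerN2; apply: hmin; rewrite mem_cube sv.
  apply: (le_trans hv0); apply: (le_trans hv).
  by rewrite mulrA -/c mulrDr [c * (d / c)]mulrC divfK// gt_eqF.
exists (pickle a), (pickle b), (pickle v0), (pickle (map negb v0)).
split.
  by split; apply: map_f; rewrite mem_cube ?size_map ?sa ?sb ?sv0.
rewrite !decK; split.
- have h : `|E n (bvec a) - E n (bvec b)| `^ r = 1 by rewrite HE; exact: cedge_dist.
  have -> : `|E n (bvec a) - E n (bvec b)| = (`|E n (bvec a) - E n (bvec b)| `^ r) `^ r^-1.
    by rewrite -powRrM mulfV// powRr1.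
  rewrite h.
  by rewrite (congr1 (fun f => f r^-1) (powR1 R)).
- have h : `|E n (bvec v0) - E n (bvec (map negb v0))| `^ r = N%:R by rewrite HE; exact: negb_dist.
  have -> : `|E n (bvec v0) - E n (bvec (map negb v0))| `^ p = N%:R `^ (p / r).
    by rewrite -h -powRrM mulrCA mulfV// mulr1.
  by rewrite /N natrX.
- apply: (le_trans diag); rewrite ler_wpM2r// /c -mulrA ler_wpM2l ?powR_ge0//.
  have K2 : 0 <= 2 * K by rewrite mulr_ge0.
  have h2 : 0 <= (2 : R) ^+ n by rewrite exprn_ge0.
  rewrite -powRM//; apply: ge0_ler_powR; [exact: ltW|by rewrite nnegrE mulr_ge0|by rewrite nnegrE mulr_ge0|].
  rewrite [2 * K]mulrC -mulrA ler_wpM2l// -natrX -natrM ler_nat -/N mul2n -addnn -addn1 leq_add2l.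
  exact: N0.
Qed.

End segments_and_cubes.

(** * Geometry of L_s[0, 1] *)

Section L01_facts.
Context {R : realType}.

Lemma L01fun0 (s : R) (s1 : 1 <= s) : ae_eq (@P01 R) setT (L01fun (0 : L01 s1)) (fun=> 0).
Proof. exact: LclassE. Qed.

Lemma L01funD (s : R) (s1 : 1 <= s) (f g : L01 s1) :
  ae_eq (@P01 R) setT (L01fun (f + g)) (fun x => L01fun f x + L01fun g x).
Proof. exact: LclassE. Qed.

Lemma L01_norm (s : R) (s1 : 1 <= s) (f : L01 s1) :
  (`|f| `^ s)%:E = int01 (fun x => `|L01fun f x| `^ s)%R.
Proof.
rewrite -[f]subr0 L01_normE subr0; apply: int01_ae.
- by apply: mf01_powR; apply: mf01_sub; exact: measurable_L01fun.
- by apply: mf01_powR; exact: measurable_L01fun.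
- by move=> x; exact: powR_ge0.
- by move=> x; exact: powR_ge0.
- by apply: filterS (L01fun0 s1) => x /= h; rewrite h// subr0.
Qed.

Lemma L01_normD (s : R) (s1 : 1 <= s) (f g : L01 s1) :
  (`|f + g| `^ s)%:E = int01 (fun x => `|L01fun f x + L01fun g x| `^ s)%R.
Proof.
rewrite L01_norm; apply: int01_ae.
- by apply: mf01_powR; exact: measurable_L01fun.
- by apply: mf01_powR; apply: mf01_add; exact: measurable_L01fun.
- by move=> x; exact: powR_ge0.
- by move=> x; exact: powR_ge0.
- by apply: filterS (L01funD f g) => x /= h; rewrite h.
Qed.

Lemma L01_mkP (s : R) (s1 : 1 <= s) (F : R -> R) : mf01 F -> (int01 (fun x => `|F x| `^ s)%R < +oo)%E ->
  {f : L01 s1 | forall g : L01 s1, (`|g - f| `^ s)%:E = int01 (fun x => `|L01fun g x - F x| `^ s)%R &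
                ae_eq (@P01 R) setT (L01fun f) F}.
Proof.
move=> mF Foo; have [f fF] := L01_mk s1 mF Foo; exists f => // g.
rewrite L01_normE; apply: int01_ae.
- by apply: mf01_powR; apply: mf01_sub; exact: measurable_L01fun.
- by apply: mf01_powR; apply: mf01_sub => //; exact: measurable_L01fun.
- by move=> x; exact: powR_ge0.
- by move=> x; exact: powR_ge0.
- by apply: filterS fF => x /= h; rewrite h.
Qed.

Lemma dstep_powR k c (r : R) : 0 < r ->
  int01 (fun x => `|dstep k c x| `^ r)%R = (2^-1 ^+ k * \sum_(i < 2 ^ k) `|c i| `^ r)%:E.
Proof.
move=> r0.
have mi i : mf01 (fun x => `|c i| `^ r * \1_(cell k i) x).
  by apply: mf01_mul; [exact: mf01_cst|exact: mf01_cell].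
transitivity (int01 (fun x => \sum_(i < 2 ^ k) `|c i| `^ r * \1_(cell k i) x)%R).
  apply: int01_ae.
  - by apply: mf01_powR; exact: mf01_dstep.
  - exact: (mf01_sum _ (fun i : 'I_(2 ^ k) => mi i)).
  - by move=> x; exact: powR_ge0.
  - by move=> x; apply: sumr_ge0 => i _; rewrite mulr_ge0 ?powR_ge0// indicE.
  - have [Z [mZ Z0 sZ]] := @P01_le1 R; exists Z; split => //.
    apply: subset_trans sZ; apply: subsetC => x /= x01.
    by rewrite -[RHS]/(dstep k (fun i => `|c i| `^ r) x) !dstepE.
rewrite (int01_sum _ mi); last by move=> i x; rewrite mulr_ge0 ?powR_ge0// indicE.
rewrite mulr_sumr -sumEFin; apply: eq_bigr => i _.
rewrite int01Z ?powR_ge0//; last exact: mf01_cell.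
rewrite int01_indic; last exact: measurable_itv.
have p2 : 0 < (2 : R) ^+ k by rewrite exprn_gt0.
have -> : (@P01 R) (cell k i) = (2^-1 ^+ k)%:E.
  have -> : (@P01 R) (cell k i) = lebesgue_measure (cell k i).
    rewrite /P01 /= /unif01 /mrestr; congr lebesgue_measure; apply: setIidl => x.
    rewrite /cell /= !in_itv /= => /andP[h1 h2]; rewrite (le_trans _ h1) ?divr_ge0 ?(ltW p2)//=.
    by apply: ltW; apply: (lt_le_trans h2); rewrite ler_pdivrMr// mul1r -natrX ler_nat ltn_ord.
  rewrite lebesgue_measure_itv /= lte_fin ltr_pM2r ?invr_gt0// ltr_nat ltnSn -EFinB.
  by rewrite -mulrBl -(natr1 i) addrAC subrr add0r mul1r exprVn.
by rewrite -EFinM mulrC.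
Qed.

Lemma dstepB k (c c' : nat -> R) x : dstep k c x - dstep k c' x = dstep k (fun i => c i - c' i) x.
Proof. by rewrite /dstep -sumrB; apply: eq_bigr => i _; rewrite mulrBl. Qed.

(** The indicators of the [2 ^ n] dyadic cells, multiplied by [(2 ^ n) ^ (1 / r)], are unit vectors
    with disjoint supports. *)
Lemma L01_finite_lp (r : R) (r1 : 1 <= r) : exists E : nat -> (nat -> R) -> L01 r1,
  forall n c c', `|E n c - E n c'| `^ r = \sum_(i < 2 ^ n) `|c i - c' i| `^ r.
Proof.
have r0 : 0 < r by exact: (lt_le_trans ltr01 r1).
pose a n : R := (2 ^+ n) `^ r^-1.
have moo n c : mf01 (dstep n (fun i => a n * c i)) /\
    (int01 (fun x => `|dstep n (fun i => a n * c i) x| `^ r)%R < +oo)%E.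
  by split; [exact: mf01_dstep|rewrite dstep_powR// ltry].
pose E n c := s2val (L01_mkP r1 (moo n c).1 (moo n c).2).
have EP n c : ae_eq (@P01 R) setT (L01fun (E n c)) (dstep n (fun i => a n * c i)).
  exact: (s2valP' (L01_mkP r1 (moo n c).1 (moo n c).2)).
have EN n c g : (`|g - E n c| `^ r)%:E = int01 (fun x => `|L01fun g x - dstep n (fun i => a n * c i) x| `^ r)%R.
  exact: (s2valP (L01_mkP r1 (moo n c).1 (moo n c).2)).
exists E => n c c'; apply: EFin_inj; rewrite EN.
have p2 : 0 < (2 : R) ^+ n by rewrite exprn_gt0.
transitivity (int01 (fun x => `|dstep n (fun i => a n * c i - a n * c' i) x| `^ r)%R).
  apply: int01_ae.
  - by apply: mf01_powR; apply: mf01_sub; [exact: measurable_L01fun|exact: mf01_dstep].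
  - by apply: mf01_powR; exact: mf01_dstep.
  - by move=> x; exact: powR_ge0.
  - by move=> x; exact: powR_ge0.
  - by apply: filterS (EP n c) => x /= h; rewrite h// dstepB.
rewrite dstep_powR// mulr_sumr; congr EFin; apply: eq_bigr => i _.
rewrite -mulrBr normrM powRM// (ger0_norm (powR_ge0 _ _)) -powRrM mulVf ?gt_eqF// powRr1 ?(ltW p2)//.
by rewrite mulrA exprVn mulVf ?mul1r// gt_eqF.
Qed.

Lemma L01_separable (s : R) (s1 : 1 <= s) : s <= 2 ->
  exists d : nat -> L01 s1, forall w e, 0 < e -> exists n, `|w - d n| < e.
Proof.
move=> s2; have s0 : 0 < s by exact: (lt_le_trans ltr01 s1).
pose St (z : nat * seq rat) : R -> R := dstep z.1 (fun i => ratr (nth 0 z.2 i)).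
have moo z : mf01 (St z) /\ (int01 (fun x => `|St z x| `^ s)%R < +oo)%E.
  by split; [exact: mf01_dstep|rewrite dstep_powR// ltry].
pose D z := s2val (L01_mkP s1 (moo z).1 (moo z).2).
have DN z g : (`|g - D z| `^ s)%:E = int01 (fun x => `|L01fun g x - St z x| `^ s)%R.
  exact: (s2valP (L01_mkP s1 (moo z).1 (moo z).2)).
exists (fun n => if unpickle n is Some z then D z else 0) => w e e0.
have s12 : 1 <= s <= 2 by rewrite s1.
have woo : (int01 (fun x => `|L01fun w x| `^ s)%R < +oo)%E by rewrite -L01_norm ltry.
have e2 : 0 < (e / 2) `^ s by rewrite powR_gt0// divr_gt0.
have [k [c hc]] := dstep_dense s12 (measurable_L01fun w) woo e2.
exists (pickle (k, c)); rewrite pickleK.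
have := DN (k, c) w; rewrite /St /= => h; rewrite -h lee_fin in hc.
apply: (@le_lt_trans _ _ (e / 2)); last by rewrite ltr_pdivrMr// ltr_pMr// ltr1n.
rewrite leNgt; apply/negP => he; move: hc; apply/negP; rewrite -ltNge.
by apply: gt0_ltr_powR; rewrite ?nnegrE// ltW// divr_gt0.
Qed.

(** The scalar inequality holds at each point for [|.| ^ s] raised to the power [q / s >= 1];
    [two_point_integral] moves the integral inside that power. *)
Lemma L01_two_point (s q : R) (s1 : 1 <= s) : s <= 2 -> s <= q -> exists2 K : R, 1 <= K &
  forall a b : L01 s1, `|a + b| `^ q + `|a - b| `^ q <= 2 * (`|a| `^ s + K * `|b| `^ s) `^ (q / s).
Proof.
move=> s2 sq; have s0 : 0 < s by exact: (lt_le_trans ltr01 s1).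
have [K K1 hK] := two_point_scalar s1 s2 sq; exists K => // a b.
have K0 : 0 <= K by exact: le_trans K1.
have t1 : 1 <= q / s by rewrite ler_pdivlMr// mul1r.
have st (x : R) : 0 <= x -> x `^ q = (x `^ s) `^ (q / s).
  by move=> x0; rewrite -powRrM mulrCA mulfV ?mulr1// gt_eqF.
rewrite !st//.
have ma := measurable_L01fun a; have mb := measurable_L01fun b.
have ms (F : R -> R) : mf01 F -> mf01 (fun x => `|F x| `^ s) by exact: mf01_powR.
have p0 (F : R -> R) x : 0 <= `|F x| `^ s by exact: powR_ge0.
apply: (two_point_integral (A := fun x => `|L01fun a x + L01fun b x| `^ s)
  (B := fun x => `|L01fun a x - L01fun b x| `^ s)
  (M := fun x => `|L01fun a x| `^ s + K * `|L01fun b x| `^ s) t1).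
- by apply: ms; exact: mf01_add.
- by apply: ms; exact: mf01_sub.
- by apply: mf01_add; [exact: ms|apply: mf01_mul; [exact: mf01_cst|exact: ms]].
- by move=> x; exact: powR_ge0.
- by move=> x; exact: powR_ge0.
- by move=> x; rewrite addr_ge0 ?mulr_ge0.
- by move=> x; rewrite -!st.
- by rewrite -L01_normD.
- by rewrite L01_normE.
- rewrite int01D ?int01Z//.
  + by rewrite -!L01_norm.
  + exact: ms.
  + exact: ms.
  + by apply: mf01_mul; [exact: mf01_cst|exact: ms].
  + by move=> x; rewrite mulr_ge0.
Qed.

Lemma L01_nonreduction (r s p q : R) (r1 : 1 <= r) (s1 : 1 <= s) : s <= 2 ->
  1 <= p -> 1 <= q -> s <= q ->
  borel_reducible (Erel (L01 r1) p) (Erel (L01 s1) q) -> p <= q /\ s / q <= r / p.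
Proof.
move=> s2 p1 q1 sq red.
have p0 : 0 < p by exact: lt_le_trans p1.
have q0 : 0 < q by exact: lt_le_trans q1.
have r0 : 0 < r by exact: (lt_le_trans ltr01 r1).
have s0 : 0 < s by exact: (lt_le_trans ltr01 s1).
have [d dd] := L01_separable s1 s2.
have [E HE] := L01_finite_lp r1.
have [K K1 hK] := L01_two_point s1 s2 sq.
split.
  pose u := E 0%N (fun=> 1) - E 0%N (fun=> 0).
  have u1 : `|u| = 1.
    have h : `|u| `^ r = 1.
      by rewrite /u HE expn0 big_ord1 subr0 normr1 (congr1 (fun f => f r) (powR1 R)).
    have -> : `|u| = (`|u| `^ r) `^ r^-1 by rewrite -powRrM mulfV ?gt_eqF// powRr1.
    by rewrite h (congr1 (fun f => f r^-1) (powR1 R)).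
  by apply: (exponents_le p1 q1 dd (ltW q0) ler01 (segment_poor_embedding q1 (ltW p0) u1) red).
have t0 : 0 <= q / s by rewrite divr_ge0// ltW.
have C0 : 0 <= 2 `^ q * (2 * K) `^ (q / s) by rewrite mulr_ge0// powR_ge0.
have := exponents_le p1 q1 dd t0 C0 (cube_poor_embedding q1 s0 sq K1 hK r0 (ltW p0) HE) red.
by rewrite -[s / q]invf_div -[r / p]invf_div lef_pV2// posrE divr_gt0.
Qed.

End L01_facts.

Theorem theorem1p4 (R : realType) (r s p q : R)
    (r1 : 1 <= r) (r2 : r <= 2) (s1 : 1 <= s) (s2 : s <= 2)
    (p1 : 1 <= p) (q1 : 1 <= q) (sq : s <= q) :
  borel_reducible (Erel (L01 r1) p) (Erel (L01 s1) q) <->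
  p <= q /\ r / p >= s / q.
Proof.
split=> [red|[pq srpq]]; first exact: (L01_nonreduction s2 p1 q1 sq red).
exact: L01_reduction.
Qed.
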